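(* Suppose that for some $\varepsilon>0$ and some $\delta$ with $\frac12\le\delta\le1$ $$\sup_{n\in\mathbb{Z}}\bigl\{\exp(\varepsilon|n|^\delta)\,(|1-a_n|+|v_n|)\bigr\}<\infty .$$ Then the Klein–Gordon type difference operator $\Gamma$ corresponding to the equation $$\Delta(a_{n-1}\Delta y_{n-1})+(v_n-\lambda)^2y_n=0,\qquad n\in\mathbb{Z},$$ has a finite number of eigenvalues and spectral singularities, and each of them is of finite multiplicity.
   Context: Here $(a_n)_{n\in\mathbb{Z}}$, $(v_n)_{n\in\mathbb{Z}}$ are complex sequences with $a_n\ne0$ for all $n$, and $\Delta y_n=y_{n+1}-y_n$. The operator $\Gamma=\Gamma_\lambda$ acts in $\ell^2(\mathbb{Z})$ by $(\Gamma y)_n=\Delta(a_{n-1}\Delta y_{n-1})+(v_n-\lambda)^2y_n$. It is the special case $p_n=-v_n$, $q_n=v_n^2$ of the pencil $(L_\lambda y)_n=\Delta(a_{n-1}\Delta y_{n-1})+(q_n+2\lambda p_n+\lambda^2)y_n$, and its eigenvalues, spectral singularities and multiplicities are defined as for that pencil, as follows. Jost solutions. For $\operatorname{Im}z\ge0$ and $\lambda=2\cos(z/2)$, the equation $L_\lambda y=0$ has the solutions $f_n^+(z)=\alpha_n^+e^{inz}(1+\sum_{m\ge1}K_{n,m}^+e^{imz/2})$ and $f_n^-(z)=\alpha_n^-e^{-inz}(1+\sum_{m\le-1}K_{n,m}^-e^{-imz/2})$, where, with $h_n=2-a_n-a_{n-1}+q_n$, $\alpha_n^+=(-1)^n(\prod_{r\ge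 n}a_r)^{-1}$, $K_{n,1}^+=2\sum_{r\ge n+1}p_r$, $K_{n,2}^+=\sum_{r\ge n+1}(h_r+2p_rK_{r,1}^+)$, $K_{n,3}^+=\sum_{r\ge n+1}(h_rK_{r,1}^++2p_r(K_{r,2}^++1))$, $K_{n,4}^+=\sum_{r\ge n+1}((1-a_r^2)+h_rK_{r,2}^++2p_r(K_{r,3}^++K_{r,1}^+))$, $K_{n,m+4}^+=K_{n+1,m}^++\sum_{r\ge n+1}((1-a_r^2)K_{r+1,m}^++h_rK_{r,m+2}^++2p_r(K_{r,m+1}^++K_{r,m+3}^+))$ for $m\ge1$; and $\alpha_n^-=(-1)^n(\prod_{r\le n-1}a_r)^{-1}$, $K_{n,-1}^-=2\sum_{r\le n-1}p_r$, $K_{n,-2}^-=\sum_{r\le n-1}(h_r+2p_rK_{r,-1}^-)$, $K_{n,-3}^-=\sum_{r\le n-1}(h_rK_{r,-1}^-+2p_r(K_{r,-2}^-+1))$, $K_{n,-4}^-=\sum_{r\le n-1}((1-a_{r-1}^2)+h_rK_{r,-2}^-+2p_r(K_{r,-3}^-+K_{r,-1}^-))$, $K_{n,m-4}^-=K_{n-1,m}^-+\sum_{r\le n-1}((1-a_{r-1}^2)K_{r-1,m}^-+h_rK_{r,m-2}^-+2p_r(K_{r,m-1}^-+K_{r,m-3}^-))$ for $m\le-1$. These are analytic in $z$ for $\operatorname{Im}z>0$ and continuous for $\operatorname{Im}z\ge0$. Put $\Phi(z)=W[f^-(z),f^+(z)]$ with $W[u,v]=a_n(u_nv_{n+1}-u_{n+1}v_n)$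 (independent of $n$). Let $P^+=\{\eta+i\varphi:\eta\in[-\pi,3\pi],\varphi>0\}$ and $P_0=(-\pi,3\pi)\setminus\{0,\pi,2\pi\}$. Eigenvalues are the $\lambda$ for which the equation has a nonzero solution in $\ell^2(\mathbb{Z})$; they form the set $\{\lambda=2\cos\frac z2:z\in P^+,\Phi(z)=0\}$. The spectral singularities (poles of the resolvent kernel embedded in the continuous spectrum) form the set $\{\lambda=2\cos\frac z2:z\in P_0,\Phi(z)=0\}$. The multiplicity of an eigenvalue or spectral singularity is the multiplicity of the corresponding zero of $\Phi$ in $P^+\cup P_0$ (at a real zero, the order of vanishing in terms of the derivatives of $\Phi$, which extend continuously to the real axis under the hypothesis). *)

(* Defs.v *)
From Stdlib Require Export Reals ZArith List.
From Coquelicot Require Export Coquelicot.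
Open Scope C_scope.

(** Complex exponential and cosine, limits, sums and products over [C]. *)

Definition Cexp (z : C) : C :=
  (exp (Re z) * cos (Im z), exp (Re z) * sin (Im z))%R.

Definition Ccos (z : C) : C := (Cexp (Ci * z) + Cexp (- (Ci * z))) / 2.

(** Componentwise limit: total, with no meaning unless [u] converges. *)
Definition Clim_seq (u : nat -> C) : C :=
  (real (Lim_seq (fun N => Re (u N))), real (Lim_seq (fun N => Im (u N)))).

Definition Csum (u : nat -> C) : C := Clim_seq (fun N => sum_n u N).

Fixpoint Cprod_n (u : nat -> C) (N : nat) : C :=
  match N with
  | O => u O
  | S N' => Cprod_n u N' * u (S N')
  end.

Definition Cprod (u : nat -> C) : C := Clim_seq (Cprod_n u).

(** [sum_ge n u], [sum_le n u]: sums of [u r] over [r >= n], [r <= n];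
    likewise for the products. *)
Definition sum_ge (n : Z) (u : Z -> C) : C :=
  Csum (fun k => u (n + Z.of_nat k)%Z).
Definition sum_le (n : Z) (u : Z -> C) : C :=
  Csum (fun k => u (n - Z.of_nat k)%Z).
Definition prod_ge (n : Z) (u : Z -> C) : C :=
  Cprod (fun k => u (n + Z.of_nat k)%Z).
Definition prod_le (n : Z) (u : Z -> C) : C :=
  Cprod (fun k => u (n - Z.of_nat k)%Z).

Definition sgnZ (n : Z) : C := if Z.even n then 1 else - (1).

(** [|n|^delta] for [delta > 0]; [Rpower] does not give [0] at base [0]. *)
Definition Zabs_pow (n : Z) (delta : R) : R :=
  if Z.eq_dec n 0 then 0%R else Rpower (IZR (Z.abs n)) delta.

(** The difference operators *)

Definition Delta (y : Z -> C) (n : Z) : C := y (n + 1)%Z - y n.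

Definition pencil (a p q : Z -> C) (lam : C) (y : Z -> C) (n : Z) : C :=
  Delta (fun k => a (k - 1)%Z * Delta y (k - 1)%Z) n
  + (q n + 2 * lam * p n + lam ^ 2) * y n.

Definition Gamma (a v : Z -> C) (lam : C) (y : Z -> C) (n : Z) : C :=
  Delta (fun k => a (k - 1)%Z * Delta y (k - 1)%Z) n
  + (v n - lam) ^ 2 * y n.

Lemma Gamma_pencil (a v : Z -> C) (lam : C) (y : Z -> C) (n : Z) :
  Gamma a v lam y n
  = pencil a (fun k => - v k) (fun k => v k ^ 2) lam y n.
Proof. unfold Gamma, pencil; simpl; ring. Qed.

(** Jost solutions of the pencil *)

Definition hcoef (a q : Z -> C) (n : Z) : C := 2 - a n - a (n - 1)%Z + q n.

Definition alpha_plus (a : Z -> C) (n : Z) : C := sgnZ n / prod_ge n a.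
Definition alpha_minus (a : Z -> C) (n : Z) : C := sgnZ n / prod_le (n - 1) a.

(** [Kplus a p q m n] is K^+_{n,m} and [Kminus a p q m n] is K^-_{n,-m}, for
    [m >= 1]; the value at [m = 0] is never used. In the last branch the
    index is [m1 + 4], with [mj = m1 + (j - 1)]. *)
Fixpoint Kplus (a p q : Z -> C) (m : nat) {struct m} : Z -> C :=
  let h := hcoef a q in
  match m with
  | O => fun _ => 0
  | S O => fun n => 2 * sum_ge (n + 1) p
  | S (S O as m1) => fun n =>
      sum_ge (n + 1) (fun r => h r + 2 * p r * Kplus a p q m1 r)
  | S (S (S O as m1) as m2) => fun n =>
      sum_ge (n + 1) (fun r =>
        h r * Kplus a p q m1 r + 2 * p r * (Kplus a p q m2 r + 1))
  | S (S (S (S O as m1) as m2) as m3) => fun n =>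
      sum_ge (n + 1) (fun r =>
        (1 - a r ^ 2) + h r * Kplus a p q m2 r
        + 2 * p r * (Kplus a p q m3 r + Kplus a p q m1 r))
  | S (S (S (S (S _ as m1) as m2) as m3) as m4) => fun n =>
      Kplus a p q m1 (n + 1)%Z
      + sum_ge (n + 1) (fun r =>
          (1 - a r ^ 2) * Kplus a p q m1 (r + 1)%Z
          + h r * Kplus a p q m3 r
          + 2 * p r * (Kplus a p q m2 r + Kplus a p q m4 r))
  end.

Fixpoint Kminus (a p q : Z -> C) (m : nat) {struct m} : Z -> C :=
  let h := hcoef a q in
  match m with
  | O => fun _ => 0
  | S O => fun n => 2 * sum_le (n - 1) p
  | S (S O as m1) => fun n =>
      sum_le (n - 1) (fun r => h r + 2 * p r * Kminus a p q m1 r)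
  | S (S (S O as m1) as m2) => fun n =>
      sum_le (n - 1) (fun r =>
        h r * Kminus a p q m1 r + 2 * p r * (Kminus a p q m2 r + 1))
  | S (S (S (S O as m1) as m2) as m3) => fun n =>
      sum_le (n - 1) (fun r =>
        (1 - a (r - 1)%Z ^ 2) + h r * Kminus a p q m2 r
        + 2 * p r * (Kminus a p q m3 r + Kminus a p q m1 r))
  | S (S (S (S (S _ as m1) as m2) as m3) as m4) => fun n =>
      Kminus a p q m1 (n - 1)%Z
      + sum_le (n - 1) (fun r =>
          (1 - a (r - 1)%Z ^ 2) * Kminus a p q m1 (r - 1)%Z
          + h r * Kminus a p q m3 r
          + 2 * p r * (Kminus a p q m2 r + Kminus a p q m4 r))
  end.

(** With [m = S k >= 1], the exponential factor of K^-_{n,-m} is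
    e^{-i(-m)z/2} = e^{imz/2}. *)
Definition jost_plus (a p q : Z -> C) (z : C) (n : Z) : C :=
  alpha_plus a n * Cexp (Ci * IZR n * z)
  * (1 + Csum (fun k => Kplus a p q (S k) n * Cexp (Ci * INR (S k) * z / 2))).

Definition jost_minus (a p q : Z -> C) (z : C) (n : Z) : C :=
  alpha_minus a n * Cexp (- (Ci * IZR n * z))
  * (1 + Csum (fun k => Kminus a p q (S k) n * Cexp (Ci * INR (S k) * z / 2))).

Definition wronskian (a u v : Z -> C) (n : Z) : C :=
  a n * (u n * v (n + 1)%Z - u (n + 1)%Z * v n).

(** The Wronskian of two solutions does not depend on [n]; it is taken at
    [n = 0]. *)
Definition Phi (a p q : Z -> C) (z : C) : C :=
  wronskian a (jost_minus a p q z) (jost_plus a p q z) 0.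

(** Eigenvalues, spectral singularities and multiplicities *)

Definition ell2 (y : Z -> C) : Prop :=
  ex_series (fun k => Cmod (y (Z.of_nat k)) ^ 2)%R /\
  ex_series (fun k => Cmod (y (- Z.of_nat k)%Z) ^ 2)%R.

Definition is_eigenvalue (L : C -> (Z -> C) -> Z -> C) (lam : C) : Prop :=
  exists y : Z -> C,
    (exists n, y n <> 0) /\ ell2 y /\ (forall n, L lam y n = 0).

Definition in_Pplus (z : C) : Prop :=
  (- PI <= Re z <= 3 * PI /\ 0 < Im z)%R.

Definition in_P0 (z : C) : Prop :=
  (Im z = 0 /\ - PI < Re z < 3 * PI /\
   Re z <> 0 /\ Re z <> PI /\ Re z <> 2 * PI)%R.

(** The predicates below take the function [Phi a p q] as [F]. The resolvent
    kernel is built from products of Jost solutions divided by Phi, so its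
    poles on the continuous spectrum are given by the zeros of Phi in P_0. *)
Definition is_spectral_singularity (F : C -> C) (lam : C) : Prop :=
  exists z, in_P0 z /\ F z = 0 /\ lam = 2 * Ccos (z / 2).

(** Order of vanishing at [z0] of a function on the closed upper half-plane:
    [D j] is the [j]-th complex derivative in the open half-plane and, when
    [z0] is real, its limit from the closed half-plane at [z0]. *)
Definition zero_multiplicity (F : C -> C) (z0 : C) (m : nat) : Prop :=
  exists D : nat -> C -> C,
    (forall z, (0 <= Im z)%R -> D O z = F z) /\
    (forall j z, (j < m)%nat -> (0 < Im z)%R ->
       is_derive (K := C_AbsRing) (V := C_NormedModule) (D j) z (D (S j) z)) /\
    (forall j, (j <= m)%nat ->
       filterlim (D j) (within (fun z => (0 <= Im z)%R) (locally z0))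
                 (locally (D j z0))) /\
    (forall j, (j < m)%nat -> D j z0 = 0) /\
    D m z0 <> 0.

Definition corresponding_zero (F : C -> C) (lam z : C) : Prop :=
  (in_Pplus z \/ in_P0 z) /\ F z = 0 /\ lam = 2 * Ccos (z / 2).

(** Two points of P_0, [z] and [- z] or [z] and [4 PI - z], give the same
    [lam]; every zero of Phi over [lam] is required to have finite order. *)
Definition finite_multiplicity (F : C -> C) (lam : C) : Prop :=
  (exists z, corresponding_zero F lam z) /\
  (forall z, corresponding_zero F lam z ->
     exists m, zero_multiplicity F z m).

Definition finite_set (P : C -> Prop) : Prop :=
  exists l : list C, forall x, P x -> In x l.

(* Main.v *)
Require Import Defs.
From Stdlib Require Import Lra Lia FunctionalExtensionality ClassicalEpsilon.

(** With [w = exp (i z / 2)], the function [w^2 Phi] is a power series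
    [sum c_m w^m] on the closed unit disc, with [c_0 <> 0] and
    [|c_m| <= A exp (- e sqrt m)]: the recursion for [K] advances [n] by at least
    one whenever [m] drops by at most four, so [K_{n,m}] inherits the decay of the
    coefficients. If all derivatives of such a series vanished at a point [w0] of
    the closed disc, all moments [sum c_m w0^m m^k] would vanish, and [c_0 = 0] by
    uniqueness in the Stieltjes moment problem. So every zero in the closed disc
    has finite order and is isolated (Taylor's formula holds up to the circle), and
    compactness leaves finitely many. For a solution [y] in [l^2], the Wronskians of [y] with
    both Jost solutions vanish, hence [Phi = 0]; on the circle the Jost solution
    does not tend to [0], so there are no such [y]. *)

(** * Complex series *)

(** The rate [exp (- e sqrt m)] shapes the proof. It need not allow [w^2 Phi] to be continued
    analytically across the unit circle, where zeros might accumulate, but its moments grow no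
    faster than [(2 k)!] up to geometric factors, which is the borderline for uniqueness in the
    Stieltjes problem. The exponent [delta] enters only through [sqrt |n| <= |n|^delta]. The
    functions [cos (sqrt m t)] are chosen because their even derivatives at 0 are, up to sign, the
    powers of [m]; the decay of [c_m] makes their sum analytic in a strip around the real line.
    Estimates are made on the right half-line only: the left Jost solution is the right one of the
    operator reflected by [n -> - n]. The half-line begins at -1 because [Phi] is a Wronskian at 0,
    and [f^-_1] is the reflected solution at index -1. The factor [w^2] cancels the pole coming from
    [e^{-iz}] in [f^-_1], and [c_0 = - a_0 alpha^-_1 alpha^+_0]. *)

Definition Cser (u : nat -> C) (l : C) : Prop := @is_series C_AbsRing C_NormedModule u l.

Lemma filterlim_C_Re_Im (u : nat -> C) (l : C) :
  filterlim u eventually (locally (T := C_UniformSpace) l) <->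
  is_lim_seq (fun n => Re (u n)) (Re l) /\ is_lim_seq (fun n => Im (u n)) (Im l).
Proof.
  split.
  - intros H; split; intros P [e He].
    + apply (H (fun z => P (Re z))). exists e. intros y [H1 H2]. apply He, H1.
    + apply (H (fun z => P (Im z))). exists e. intros y [H1 H2]. apply He, H2.
  - intros [H1 H2] P [e He].
    assert (E1 : eventually (fun n => ball (Re l) e (Re (u n)))).
    { apply (H1 (fun x => ball (Re l) e x)). exists e; auto. }
    assert (E2 : eventually (fun n => ball (Im l) e (Im (u n)))).
    { apply (H2 (fun x => ball (Im l) e x)). exists e; auto. }
    destruct E1 as [N1 E1], E2 as [N2 E2]. exists (Nat.max N1 N2).
    intros n Hn. apply He. split; [apply E1 | apply E2]; lia.
Qed.

(** The total limit of the definitions is the true limit once convergence is known; this is how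
    [Csum] and [Cprod] are evaluated below. *)
Lemma Clim_seq_unique (u : nat -> C) (l : C) :
  filterlim u eventually (locally (T := C_UniformSpace) l) -> Clim_seq u = l.
Proof.
  intros H. apply filterlim_C_Re_Im in H. destruct H as [H1 H2].
  unfold Clim_seq. rewrite (is_lim_seq_unique _ _ H1), (is_lim_seq_unique _ _ H2).
  now destruct l.
Qed.

Lemma Cser_Csum (u : nat -> C) (l : C) : Cser u l -> Csum u = l.
Proof. intros H. apply Clim_seq_unique, H. Qed.

Lemma Cser_ext (u v : nat -> C) (l : C) :
  (forall n, u n = v n) -> Cser u l -> Cser v l.
Proof. apply is_series_ext. Qed.

Lemma Cser_plus (u v : nat -> C) (l m : C) :
  Cser u l -> Cser v m -> Cser (fun n => u n + v n) (l + m).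
Proof. intros; now apply (is_series_plus (V := C_NormedModule)). Qed.

Lemma Cser_scal (c : C) (u : nat -> C) (l : C) :
  Cser u l -> Cser (fun n => c * u n) (c * l).
Proof. intros; now apply (is_series_scal (V := C_NormedModule) c). Qed.

Lemma Cser_minus (u v : nat -> C) (l m : C) :
  Cser u l -> Cser v m -> Cser (fun n => u n - v n) (l - m).
Proof. intros; now apply (is_series_minus (V := C_NormedModule)). Qed.

Lemma Cser_cons (u : nat -> C) (l : C) :
  Cser (fun n => u (S n)) l -> Cser u (u O + l).
Proof.
  intros H. apply (is_series_decr_1 (V := C_NormedModule)).
  match goal with |- is_series _ ?x => replace x with (l : C) end; [exact H|].
  change (l = (u 0%nat + l) - u 0%nat). ring.
Qed.

Lemma Cser_zero (u : nat -> C) : (forall n, u n = 0) -> Cser u 0.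
Proof.
  intros H. unfold Cser, is_series.
  apply filterlim_ext with (fun _ => (0 : C)).
  - intros n. induction n as [|n IH].
    + now rewrite sum_O, H.
    + rewrite sum_Sn, <- IH, H. change ((0 : C) = 0 + 0). ring.
  - apply filterlim_const.
Qed.

Lemma Cser_unique (u : nat -> C) (l m : C) : Cser u l -> Cser u m -> l = m.
Proof. intros H1 H2. rewrite <- (Cser_Csum _ _ H1). now apply Cser_Csum. Qed.

Lemma Cser_Re_Im (u : nat -> C) (l : C) :
  Cser u l <-> is_series (fun n => Re (u n)) (Re l) /\ is_series (fun n => Im (u n)) (Im l).
Proof.
  unfold Cser, is_series.
  assert (ER : forall n, Re (sum_n u n) = sum_n (fun k => Re (u k)) n).
  { induction n as [|n IH]; [now rewrite !sum_O|].
    rewrite !sum_Sn, <- IH. reflexivity. }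
  assert (EI : forall n, Im (sum_n u n) = sum_n (fun k => Im (u k)) n).
  { induction n as [|n IH]; [now rewrite !sum_O|].
    rewrite !sum_Sn, <- IH. reflexivity. }
  split.
  - intros H. apply filterlim_C_Re_Im in H. destruct H as [H1 H2].
    split; [apply (is_lim_seq_ext _ _ _ ER) in H1 | apply (is_lim_seq_ext _ _ _ EI) in H2];
      assumption.
  - intros [H1 H2]. apply filterlim_C_Re_Im. split.
    + apply is_lim_seq_ext with (2 := H1). now intros n.
    + apply is_lim_seq_ext with (2 := H2). now intros n.
Qed.

Lemma Cser_abs (u : nat -> C) : ex_series (fun n => Cmod (u n)) -> Cser u (Csum u).
Proof.
  intros H.
  destruct (ex_series_le (V := C_CompleteNormedModule) u (fun n => Cmod (u n))) as [l Hl].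
  - intros n. apply Rle_refl.
  - exact H.
  - replace (Csum u) with (l : C); [exact Hl|]. symmetry. now apply Cser_Csum.
Qed.

Lemma Cser_dom (u : nat -> C) (b : nat -> R) :
  (forall n, Cmod (u n) <= b n)%R -> ex_series b -> Cser u (Csum u).
Proof.
  intros H Hb. apply Cser_abs. apply (ex_series_le (V := R_CompleteNormedModule) _ b); [|exact Hb].
  intros n. change (norm (Cmod (u n))) with (Rabs (Cmod (u n))).
  rewrite Rabs_pos_eq; [apply H | apply Cmod_ge_0].
Qed.

Lemma Cmod_sum_n (u : nat -> C) (n : nat) :
  (Cmod (sum_n u n) <= sum_n (fun k => Cmod (u k)) n)%R.
Proof.
  induction n as [|n IH]; [rewrite !sum_O; apply Rle_refl|].
  rewrite !sum_Sn. eapply Rle_trans; [apply Cmod_triangle|].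
  now apply Rplus_le_compat_r.
Qed.

Lemma is_lim_seq_Cmod (u : nat -> C) (l : C) :
  filterlim u eventually (locally (T := C_UniformSpace) l) ->
  is_lim_seq (fun n => Cmod (u n)) (Cmod l).
Proof.
  intros H. apply is_lim_seq_ext with (fun n => @norm C_AbsRing C_NormedModule (u n)).
  - reflexivity.
  - change (Cmod l) with (@norm C_AbsRing C_NormedModule l).
    eapply filterlim_comp; [exact H|]. apply (@filterlim_norm C_AbsRing C_NormedModule).
Qed.

Lemma Cmod_lim_le (u : nat -> C) (l : C) (M : R) :
  filterlim u eventually (locally (T := C_UniformSpace) l) ->
  (forall n, Cmod (u n) <= M)%R -> (Cmod l <= M)%R.
Proof.
  intros H HM. apply is_lim_seq_Cmod in H.
  apply (is_lim_seq_le (fun n => Cmod (u n)) (fun _ => M) (Cmod l) M HM H (is_lim_seq_const M)).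
Qed.

Lemma sum_n_le_series (b : nat -> R) (s : R) (n : nat) :
  (forall k, 0 <= b k)%R -> is_series b s -> (sum_n b n <= s)%R.
Proof.
  intros Hb Hs.
  apply (is_lim_seq_incr_compare (sum_n b)); [exact Hs|].
  intros k. rewrite sum_Sn. specialize (Hb (S k)). unfold plus; simpl. lra.
Qed.

Lemma Cser_bound (u : nat -> C) (l : C) (b : nat -> R) (s : R) :
  Cser u l -> (forall n, Cmod (u n) <= b n)%R -> is_series b s -> (Cmod l <= s)%R.
Proof.
  intros Hu Hb Hs. apply (Cmod_lim_le (sum_n u)); [exact Hu|].
  intros n. eapply Rle_trans; [apply Cmod_sum_n|].
  apply Rle_trans with (sum_n b n).
  - apply sum_n_m_le; intros; apply Hb.
  - apply sum_n_le_series; [|exact Hs]. intros k.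
    eapply Rle_trans; [apply Cmod_ge_0 | apply Hb].
Qed.

Lemma ex_series_Rle (a b : nat -> R) :
  (forall n, 0 <= a n <= b n)%R -> ex_series b -> ex_series a.
Proof.
  intros H. apply (ex_series_le (V := R_CompleteNormedModule)).
  intros n. change (Rabs (a n) <= b n)%R. rewrite Rabs_pos_eq; apply H.
Qed.

Lemma ex_series_Rscal (c : R) (a : nat -> R) :
  ex_series a -> ex_series (fun n => c * a n)%R.
Proof. intros H. now apply (ex_series_scal (V := R_NormedModule) c). Qed.

(** Majorants are mostly written as differences of a nonnegative sequence [t]: partial sums then
    stay below [t O], and summability comes together with a bound for the sum. *)
Lemma telescoping (u : nat -> R) (t : nat -> R) :
  (forall n, 0 <= t n)%R -> (forall n, 0 <= u n <= t n - t (S n))%R ->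
  ex_series u /\ (Series u <= t O)%R.
Proof.
  intros Ht Hu.
  assert (B : forall n, (sum_n u n <= t O - t (S n))%R).
  { induction n as [|n IH].
    - rewrite sum_O. apply Hu.
    - rewrite sum_Sn. specialize (Hu (S n)). unfold plus; simpl. lra. }
  assert (M : forall n, (sum_n u n <= t O)%R).
  { intros n. specialize (B n). specialize (Ht (S n)). lra. }
  assert (E : ex_finite_lim_seq (sum_n u)).
  { apply ex_finite_lim_seq_incr with (t O); [|exact M].
    intros n. rewrite sum_Sn. specialize (Hu (S n)). unfold plus; simpl. lra. }
  destruct E as [l Hl].
  assert (HS : is_series u l) by exact Hl.
  split; [now exists l|].
  rewrite (is_series_unique _ _ HS).
  apply (is_lim_seq_le (sum_n u) (fun _ => t O) l (t O) M Hl (is_lim_seq_const _)).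
Qed.

Lemma im_le_Cmod (z : C) : (Rabs (Im z) <= Cmod z)%R.
Proof. eapply Rle_trans; [|apply (Rmax_Cmod z)]. apply Rmax_r. Qed.

(** Cauchy products are transferred from the real case through real and
    imaginary parts. *)
Lemma Cser_mult (a b : nat -> C) (la lb : C) :
  ex_series (fun n => Cmod (a n)) -> ex_series (fun n => Cmod (b n)) ->
  Cser a la -> Cser b lb ->
  Cser (fun n => sum_n (fun k => a k * b (n - k)%nat) n) (la * lb).
Proof.
  intros Ha Hb Sa Sb.
  apply Cser_Re_Im in Sa. apply Cser_Re_Im in Sb.
  destruct Sa as [Sa1 Sa2], Sb as [Sb1 Sb2].
  assert (dom : forall (p : C -> R) (c : nat -> C), (forall z, Rabs (p z) <= Cmod z)%R ->
     ex_series (fun n => Cmod (c n)) -> ex_series (fun n => Rabs (p (c n)))).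
  { intros p c Hp. apply ex_series_Rle. intros n. split; [apply Rabs_pos | apply Hp]. }
  pose proof (dom Re a re_le_Cmod Ha) as A1. pose proof (dom Im a im_le_Cmod Ha) as A2.
  pose proof (dom Re b re_le_Cmod Hb) as B1. pose proof (dom Im b im_le_Cmod Hb) as B2.
  assert (RE : forall (u : nat -> C) n, Re (sum_n u n) = sum_n (fun k => Re (u k)) n).
  { induction n as [|n IH]; [now rewrite !sum_O|]. rewrite !sum_Sn, <- IH. reflexivity. }
  assert (IM : forall (u : nat -> C) n, Im (sum_n u n) = sum_n (fun k => Im (u k)) n).
  { induction n as [|n IH]; [now rewrite !sum_O|]. rewrite !sum_Sn, <- IH. reflexivity. }
  apply Cser_Re_Im. split.
  - change (Re (la * lb)) with (Re la * Re lb - Im la * Im lb)%R.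
    eapply is_series_ext; [|apply (is_series_minus (V := R_NormedModule)
      _ _ _ _ (is_series_mult _ _ _ _ Sa1 Sb1 A1 B1) (is_series_mult _ _ _ _ Sa2 Sb2 A2 B2))].
    intros n. rewrite RE. rewrite <- !sum_n_Reals.
    generalize n at 2 4 6. intros N. induction N as [|N IH]; [now rewrite !sum_O|].
    rewrite !sum_Sn, <- IH. unfold plus, opp; simpl. unfold Re, Im; simpl. ring.
  - change (Im (la * lb)) with (Re la * Im lb + Im la * Re lb)%R.
    eapply is_series_ext; [|apply (is_series_plus (V := R_NormedModule)
      _ _ _ _ (is_series_mult _ _ _ _ Sa1 Sb2 A1 B2) (is_series_mult _ _ _ _ Sa2 Sb1 A2 B1))].
    intros n. rewrite IM. rewrite <- !sum_n_Reals.
    rewrite <- sum_n_plus. apply sum_n_ext. intros k.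
    unfold plus; simpl. unfold Re, Im; simpl. reflexivity.
Qed.

(** * The weights [exp (- c sqrt x)] *)

Local Open Scope R_scope.

Definition wt (c x : R) : R := exp (- (c * sqrt x)).

Lemma wt_pos (c x : R) : 0 < wt c x.
Proof. apply exp_pos. Qed.

Lemma exp_le (x y : R) : x <= y -> exp x <= exp y.
Proof. intros [H|H]; [left; now apply exp_increasing | right; now rewrite H]. Qed.

Lemma wt_le (c d x y : R) : 0 <= c <= d -> x <= y -> wt d y <= wt c x.
Proof.
  intros [Hc Hd] H. apply exp_le. apply Ropp_le_contravar.
  apply Rmult_le_compat; [lra | apply sqrt_pos | lra | now apply sqrt_le_1_alt].
Qed.

Lemma wt_le_1 (c x : R) : 0 <= c -> wt c x <= 1.
Proof.
  intros H. rewrite <- exp_0. apply exp_le.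
  pose proof (Rmult_le_pos _ _ H (sqrt_pos x)). lra.
Qed.

Lemma sqrt_plus_le (x y : R) : 0 <= x -> 0 <= y -> sqrt (x + y) <= sqrt x + sqrt y.
Proof.
  intros Hx Hy. apply Rsqr_incr_0_var.
  - rewrite Rsqr_plus, !Rsqr_sqrt by lra.
    pose proof (Rmult_le_pos _ _ (sqrt_pos x) (sqrt_pos y)). lra.
  - pose proof (sqrt_pos x). pose proof (sqrt_pos y). lra.
Qed.

(** Subadditivity of [sqrt]; this makes decaying sequences stable under Cauchy products. *)
Lemma wt_mult_le (c x y : R) :
  0 <= c -> 0 <= x -> 0 <= y -> wt c x * wt c y <= wt c (x + y).
Proof.
  intros Hc Hx Hy. unfold wt. rewrite <- exp_plus. apply exp_le.
  pose proof (Rmult_le_compat_l c _ _ Hc (sqrt_plus_le x y Hx Hy)). lra.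
Qed.

(** Both square roots are at most [sqrt (x + y)], so each variable receives half of the rate. It
    separates the position [n] from the index [m] in the estimate of the kernels. *)
Lemma wt_split (c x y : R) :
  0 <= c -> 0 <= x -> 0 <= y -> wt (2 * c) (x + y) <= wt c x * wt c y.
Proof.
  intros Hc Hx Hy. unfold wt. rewrite <- exp_plus. apply exp_le.
  assert (H1 : sqrt x <= sqrt (x + y)) by (apply sqrt_le_1_alt; lra).
  assert (H2 : sqrt y <= sqrt (x + y)) by (apply sqrt_le_1_alt; lra).
  pose proof (Rmult_le_compat_l c _ _ Hc H1). pose proof (Rmult_le_compat_l c _ _ Hc H2). lra.
Qed.

(** Applied with [y = 1]: moving the argument by one costs a constant factor. *)
Lemma wt_shift (c x y : R) : 0 <= c -> 0 <= x -> 0 <= y -> wt c x <= exp (c * sqrt y) * wt c (x + y).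
Proof.
  intros Hc Hx Hy. unfold wt. rewrite <- exp_plus. apply exp_le.
  pose proof (Rmult_le_compat_l c _ _ Hc (sqrt_plus_le x y Hx Hy)). lra.
Qed.

(** With [s = sqrt (x + 1)], the increment of [sqrt] is at least [1 / (2 s)],
    and [1 / s] dominates a multiple of [exp (- c s)]. *)
Lemma wt_step (c : R) : 0 < c ->
  exists k, 0 < k /\ forall x, 0 <= x -> k * wt (2 * c) x <= wt c x - wt c (x + 1).
Proof.
  intros Hc. pose proof (exp_pos (- c)) as He.
  exists (c * c * exp (- c) / (2 * (1 + c))). split.
  { apply Rdiv_lt_0_compat; [|lra]. repeat apply Rmult_lt_0_compat; lra. }
  intros x Hx.
  set (r := sqrt x). set (s := sqrt (x + 1)).
  assert (Hr : 0 <= r) by apply sqrt_pos.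
  assert (Hrr : r * r = x) by (apply sqrt_sqrt; lra).
  assert (Hss : s * s = x + 1) by (apply sqrt_sqrt; lra).
  assert (Hs0 : 0 <= s) by apply sqrt_pos.
  assert (Hs : 1 <= s) by nra.
  assert (Hrs : r <= s) by (apply sqrt_le_1_alt; lra).
  assert (Hsr : s <= r + 1) by nra.
  assert (Hd : 1 <= 2 * s * (s - r)) by nra.
  set (d := c * (s - r)).
  assert (Hd0 : 0 <= d) by (unfold d; nra).
  assert (Hdc : d <= c) by (unfold d; nra).
  assert (Hdd : c <= 2 * s * d) by (unfold d; nra).
  assert (E1 : wt c (x + 1) = wt c x * exp (- d)).
  { unfold wt. rewrite <- exp_plus. f_equal. unfold d. fold r s. ring. }
  assert (E2 : wt (2 * c) x = wt c x * wt c x).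
  { unfold wt. rewrite <- exp_plus. f_equal. ring. }
  rewrite E1, E2.
  assert (Hw : 0 < wt c x) by apply wt_pos.
  (* [1 - exp (- d) >= d / (1 + d)] follows from [exp d >= 1 + d]; [d <= c] then makes the
     denominator constant. *)
  assert (X1 : d / (1 + c) <= 1 - exp (- d)).
  { assert (1 + d <= exp d) by (destruct (Req_dec d 0) as [->|]; [rewrite exp_0; lra | left; apply exp_ineq1; lra]).
    rewrite exp_Ropp.
    assert (/ exp d <= / (1 + d)) by (apply Rinv_le_contravar; lra).
    assert (d / (1 + c) <= d / (1 + d)).
    { apply Rmult_le_compat_l; [lra|]. apply Rinv_le_contravar; lra. }
    assert (d / (1 + d) = 1 - / (1 + d)) by (field; lra). lra. }
  assert (X2 : c * exp (- c) * wt c x * s <= 1).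
  { assert (Y : c * s <= exp (c * s)).
    { left. apply Rlt_trans with (1 + c * s); [lra|]. apply exp_ineq1. nra. }
    assert (Z : exp (- c) * wt c x <= exp (- (c * s))).
    { unfold wt. rewrite <- exp_plus. apply exp_le. fold r. nra. }
    assert (exp (c * s) * exp (- (c * s)) = 1).
    { rewrite <- exp_plus, Rplus_opp_r. apply exp_0. }
    pose proof (exp_pos (- (c * s))). pose proof (exp_pos (c * s)).
    apply Rle_trans with (c * s * exp (- (c * s))); [|nra].
    replace (c * exp (- c) * wt c x * s) with (c * s * (exp (- c) * wt c x)) by ring.
    apply Rmult_le_compat_l; nra. }
  assert (X3 : c * c * exp (- c) * wt c x <= 2 * d).
  { assert (0 <= c * exp (- c) * wt c x).
    { apply Rmult_le_pos; [apply Rmult_le_pos|]; lra. }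
    set (q := c * exp (- c) * wt c x) in *.
    replace (c * c * exp (- c) * wt c x) with (c * q) by (unfold q; ring). nra. }
  apply Rle_trans with (wt c x * (d / (1 + c))); [|nra].
  replace (c * c * exp (- c) / (2 * (1 + c)) * (wt c x * wt c x))
    with (wt c x * ((c * c * exp (- c) * wt c x) * / (2 * (1 + c)))) by (field; lra).
  apply Rmult_le_compat_l; [lra|].
  replace (d / (1 + c)) with (2 * d * / (2 * (1 + c))) by (field; lra).
  apply Rmult_le_compat_r; [|exact X3]. left. apply Rinv_0_lt_compat. lra.
Qed.

Lemma ex_series_wt (c : R) : 0 < c -> ex_series (fun n => wt c (INR n)).
Proof.
  intros Hc. destruct (wt_step (c / 2)) as (k & Hk & H); [lra|].
  replace (2 * (c / 2)) with c in H by field.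
  apply ex_series_ext with (fun n => / k * (k * wt c (INR n))).
  { intros n. change (/ k * (k * wt c (INR n)) = wt c (INR n)). field. lra. }
  apply ex_series_Rscal.
  apply (telescoping _ (fun n => wt (c / 2) (INR n))).
  { intros n. left. apply wt_pos. }
  intros n. rewrite S_INR. split; [|apply H, pos_INR].
  left. apply Rmult_lt_0_compat; [exact Hk | apply wt_pos].
Qed.

Lemma pow_le_exp (n : nat) (x : R) : 0 <= x -> x ^ n / INR (fact n) <= exp x.
Proof.
  intros Hx. pose proof (is_exp_Reals x) as H. apply is_pseries_R in H.
  assert (P : forall k, 0 <= / INR (fact k) * x ^ k).
  { intros k. apply Rmult_le_pos; [|now apply pow_le].
    left. apply Rinv_0_lt_compat, INR_fact_lt_0. }
  apply Rle_trans with (sum_n (fun k => / INR (fact k) * x ^ k) n).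
  - destruct n as [|n]; [rewrite sum_O; right; unfold Rdiv; ring|].
    rewrite sum_Sn. 
    assert (0 <= sum_n (fun k => / INR (fact k) * x ^ k) n).
    { clear -P. induction n as [|n IH]; [rewrite sum_O; apply P|].
      rewrite sum_Sn. specialize (P (S n)). unfold plus; simpl in *. lra. }
    match goal with |- _ <= plus ?s ?t => change (plus s t) with (s + t) end.
    unfold Rdiv. lra.
  - now apply sum_n_le_series.
Qed.

(** One term of the exponential series, [(c sqrt x)^j / j! <= exp (c sqrt x)], lets half of the rate
    absorb a power of [sqrt x]. *)
Lemma wt_pow (c : R) (j : nat) : 0 < c ->
  exists A, 0 < A /\ forall x, 0 <= x -> sqrt x ^ j * wt (2 * c) x <= A * wt c x.
Proof.
  intros Hc. exists (INR (fact j) / c ^ j). 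
  pose proof (pow_lt c j Hc) as Hcj. pose proof (INR_fact_lt_0 j) as Hf. split.
  { now apply Rdiv_lt_0_compat. }
  intros x Hx. pose proof (sqrt_pos x) as Hs.
  assert (H := pow_le_exp j (c * sqrt x) ltac:(apply Rmult_le_pos; lra)).
  rewrite Rpow_mult_distr in H.
  assert (E : wt c x * exp (c * sqrt x) = 1).
  { unfold wt. rewrite <- exp_plus, Rplus_opp_l. apply exp_0. }
  assert (E2 : wt (2 * c) x = wt c x * wt c x).
  { unfold wt. rewrite <- exp_plus. f_equal. ring. }
  rewrite E2. pose proof (wt_pos c x) as Hw.
  assert (K : sqrt x ^ j <= INR (fact j) / c ^ j * exp (c * sqrt x)).
  { replace (sqrt x ^ j) with (INR (fact j) / c ^ j * (c ^ j * sqrt x ^ j / INR (fact j))) by (field; lra).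
    apply Rmult_le_compat_l; [|exact H]. left; now apply Rdiv_lt_0_compat. }
  apply Rle_trans with (INR (fact j) / c ^ j * exp (c * sqrt x) * (wt c x * wt c x)).
  - apply Rmult_le_compat_r; [nra | exact K].
  - right. replace (INR (fact j) / c ^ j * exp (c * sqrt x) * (wt c x * wt c x)) with
      (INR (fact j) / c ^ j * wt c x * (wt c x * exp (c * sqrt x))) by ring. rewrite E. ring.
Qed.

(** * Sequences of decay [exp (- e sqrt m)] *)

(** The constants are existential, so that a loss of rate, as for polynomial factors, stays inside
    the class. *)
Definition decays (u : nat -> C) : Prop :=
  exists A e, 0 < e /\ forall m, Cmod (u m) <= A * wt e (INR m).

Lemma decays_ex_series (u : nat -> C) : decays u -> ex_series (fun m => Cmod (u m)).
Proof.
  intros (A & e & He & H). apply ex_series_Rle with (fun m => A * wt e (INR m)).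
  - intros n. split; [apply Cmod_ge_0 | apply H].
  - now apply ex_series_Rscal, ex_series_wt.
Qed.

(** [(m + 1)^j] is the power [2 j] of [sqrt (m + 1)], which half of the rate absorbs. Hence
    differentiating a series term by term preserves [decays]. *)
Lemma decays_poly (u v : nat -> C) (B : R) (j : nat) :
  (forall m, Cmod (v m) <= B * (INR m + 1) ^ j * Cmod (u m)) -> decays u -> decays v.
Proof.
  intros Hv (A & e & He & Hu).
  destruct (wt_pow (e / 2) (2 * j)) as (K & HK & HP); [lra|].
  replace (2 * (e / 2)) with e in HP by field.
  assert (A0 : 0 <= A).
  { specialize (Hu O). pose proof (Cmod_ge_0 (u O)). pose proof (wt_pos e (INR 0)). nra. }
  exists (Rabs B * A * exp (e * sqrt 1) * K), (e / 2). split; [lra|].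
  intros m. pose proof (pos_INR m) as Hm.
  assert (P0 : 0 <= (INR m + 1) ^ j) by (apply pow_le; lra).
  assert (E : (INR m + 1) ^ j = sqrt (INR m + 1) ^ (2 * j)).
  { rewrite pow_mult. f_equal. simpl. rewrite Rmult_1_r, sqrt_sqrt; lra. }
  pose proof (wt_shift e (INR m) 1 ltac:(lra) Hm ltac:(lra)) as S1.
  specialize (HP (INR m + 1) ltac:(lra)). rewrite <- E in HP.
  assert (S2 : wt (e / 2) (INR m + 1) <= wt (e / 2) (INR m)) by (apply wt_le; lra).
  set (X := exp (e * sqrt 1)) in *. assert (X0 : 0 < X) by apply exp_pos.
  set (Q := (INR m + 1) ^ j) in *.
  assert (AQ : Cmod (u m) <= A * (X * wt e (INR m + 1))).
  { eapply Rle_trans; [apply Hu|]. now apply Rmult_le_compat_l. }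
  apply Rle_trans with (Rabs B * (Q * Cmod (u m))).
  { eapply Rle_trans; [apply Hv|]. fold Q. rewrite Rmult_assoc.
    apply Rmult_le_compat_r; [|apply Rle_abs].
    apply Rmult_le_pos; [lra | apply Cmod_ge_0]. }
  rewrite !Rmult_assoc. apply Rmult_le_compat_l; [apply Rabs_pos|].
  apply Rle_trans with (Q * (A * (X * wt e (INR m + 1)))); [now apply Rmult_le_compat_l|].
  replace (Q * (A * (X * wt e (INR m + 1)))) with (A * (X * (Q * wt e (INR m + 1)))) by ring.
  apply Rmult_le_compat_l; [lra|]. apply Rmult_le_compat_l; [lra|].
  eapply Rle_trans; [apply HP|]. apply Rmult_le_compat_l; lra.
Qed.

Lemma decays_le (u v : nat -> C) (B : R) :
  (forall m, Cmod (v m) <= B * Cmod (u m)) -> decays u -> decays v.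
Proof.
  intros H. apply (decays_poly u v B 0). intros m. specialize (H m). simpl. lra.
Qed.

Lemma decays_plus (u v : nat -> C) : decays u -> decays v -> decays (fun m => (u m + v m)%C).
Proof.
  intros (A & e & He & HA) (B & f & Hf & HB).
  assert (Ae : 0 <= A).
  { specialize (HA O). pose proof (Cmod_ge_0 (u O)). pose proof (wt_pos e (INR 0)). nra. }
  assert (Be : 0 <= B).
  { specialize (HB O). pose proof (Cmod_ge_0 (v O)). pose proof (wt_pos f (INR 0)). nra. }
  assert (M := Rmin_pos _ _ He Hf).
  exists (A + B), (Rmin e f). split; [exact M|]. intros m.
  eapply Rle_trans; [apply Cmod_triangle|].
  assert (wt e (INR m) <= wt (Rmin e f) (INR m)).
  { apply wt_le; [split; [lra | apply Rmin_l] | lra]. }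
  assert (wt f (INR m) <= wt (Rmin e f) (INR m)).
  { apply wt_le; [split; [lra | apply Rmin_r] | lra]. }
  specialize (HA m). specialize (HB m). nra.
Qed.

Lemma sum_n_le_loc (a b : nat -> R) (n : nat) :
  (forall k, (k <= n)%nat -> a k <= b k) -> sum_n a n <= sum_n b n.
Proof.
  induction n as [|n IH]; intros H; [rewrite !sum_O; now apply H|].
  rewrite !sum_Sn. apply Rplus_le_compat; [|now apply H].
  apply IH. intros k Hk. apply H. lia.
Qed.

(** By [wt_mult_le] each of the [m + 1] terms is at most [A B wt g m], and [decays_poly] absorbs
    their number. *)
Lemma decays_conv (u v : nat -> C) :
  decays u -> decays v -> decays (fun m => sum_n (fun k => (u k * v (m - k)%nat)%C) m).
Proof.
  intros (A & e & He & HA) (B & f & Hf & HB).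
  assert (Ae : 0 <= A).
  { specialize (HA O). pose proof (Cmod_ge_0 (u O)). pose proof (wt_pos e (INR 0)). nra. }
  assert (Be : 0 <= B).
  { specialize (HB O). pose proof (Cmod_ge_0 (v O)). pose proof (wt_pos f (INR 0)). nra. }
  assert (M := Rmin_pos _ _ He Hf). set (g := Rmin e f) in *.
  apply (decays_poly (fun m => RtoC (A * B * wt g (INR m))) _ 1 1).
  - intros m.
    assert (AB : 0 <= A * B * wt g (INR m)).
    { apply Rmult_le_pos; [nra | left; apply wt_pos]. }
    rewrite Cmod_R, Rabs_pos_eq by exact AB.
    eapply Rle_trans; [apply Cmod_sum_n|].
    apply Rle_trans with (sum_n (fun _ => A * B * wt g (INR m)) m).
    + apply sum_n_le_loc. intros k Hk. rewrite Cmod_mult.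
      pose proof (wt_le g e (INR k) (INR k) ltac:(split; [lra | apply Rmin_l]) (Rle_refl _)) as W1.
      pose proof (wt_le g f (INR (m - k)) (INR (m - k)) ltac:(split; [lra | apply Rmin_r]) (Rle_refl _)) as W2.
      pose proof (wt_mult_le g (INR k) (INR (m - k)) ltac:(lra) (pos_INR _) (pos_INR _)) as W3.
      rewrite <- plus_INR in W3. replace (k + (m - k))%nat with m in W3 by lia.
      apply Rle_trans with ((A * wt g (INR k)) * (B * wt g (INR (m - k)))).
      * apply Rmult_le_compat; [apply Cmod_ge_0 | apply Cmod_ge_0 | |].
        -- eapply Rle_trans; [apply HA|]. now apply Rmult_le_compat_l.
        -- eapply Rle_trans; [apply HB|]. now apply Rmult_le_compat_l.
      * replace ((A * wt g (INR k)) * (B * wt g (INR (m - k)))) with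
          (A * B * (wt g (INR k) * wt g (INR (m - k)))) by ring.
        apply Rmult_le_compat_l; [nra | exact W3].
    + rewrite sum_n_const. rewrite S_INR. lra.
  - exists (A * B), g. split; [exact M|]. intros m.
    rewrite Cmod_R, Rabs_pos_eq; [lra|].
    apply Rmult_le_pos; [nra | left; apply wt_pos].
Qed.

(** * The moment problem *)

Lemma Rser_bound (u b : nat -> R) (l s : R) :
  is_series u l -> (forall n, Rabs (u n) <= b n) -> is_series b s -> Rabs l <= s.
Proof.
  intros Hu Hb Hs. rewrite <- (is_series_unique _ _ Hu), <- (is_series_unique _ _ Hs).
  assert (EB : ex_series b) by now exists s.
  eapply Rle_trans; [apply Series_Rabs|].
  - apply ex_series_Rle with b; [|exact EB]. intros n. split; [apply Rabs_pos | apply Hb].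
  - apply Series_le; [|exact EB]. intros n. split; [apply Rabs_pos | apply Hb].
Qed.

(** [trig s 0] is an antiderivative of [cos (s t)], and [trig s (S j)] its
    [j]-th derivative. *)
Definition trig (s : R) (j : nat) (t : R) : R :=
  match j with
  | O => if Req_EM_T s 0 then t else sin (s * t) / s
  | S i => s ^ i * cos (s * t + INR i * (PI / 2))
  end.

Lemma is_derive_trig (s : R) (j : nat) (t : R) :
  is_derive (trig s j) t (trig s (S j) t).
Proof.
  destruct j as [|i].
  - destruct (Req_EM_T s 0) as [->|Hs].
    + apply is_derive_ext with (fun x => x).
      { intros x. simpl. now destruct (Req_EM_T 0 0). }
      replace (trig 0 1 t) with 1; [apply (is_derive_id t)|].
      simpl. rewrite !Rmult_0_l, Rplus_0_l, cos_0. ring.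
    + apply is_derive_ext with (fun x => sin (s * x) / s).
      { intros x. simpl. now destruct (Req_EM_T s 0). }
      auto_derive; [trivial|]. simpl. rewrite Rmult_0_l, Rplus_0_r. field. exact Hs.
  - unfold trig. auto_derive; [trivial|].
    replace (INR (S i) * (PI / 2)) with (INR i * (PI / 2) + PI / 2) by (rewrite S_INR; ring).
    rewrite <- Rplus_assoc, (cos_plus _ (PI / 2)), cos_PI2, sin_PI2. simpl pow. ring.
Qed.

Lemma Derive_n_trig (s : R) (j k : nat) (t : R) :
  Derive_n (trig s j) k t = trig s (j + k) t.
Proof.
  revert t. induction k as [|k IH]; intros t.
  - now rewrite Nat.add_0_r.
  - simpl Derive_n. rewrite (Derive_ext _ _ _ IH), Nat.add_succ_r.
    apply is_derive_unique, is_derive_trig.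
Qed.

Lemma ex_derive_n_trig (s : R) (j k : nat) (t : R) : ex_derive_n (trig s j) k t.
Proof.
  destruct k as [|k]; [exact I|]. simpl.
  apply ex_derive_ext with (trig s (j + k)).
  - intros x. symmetry. apply Derive_n_trig.
  - eexists. apply is_derive_trig.
Qed.

Lemma trig_bound (s : R) (j : nat) (t : R) : 0 <= s -> Rabs (trig s (S j) t) <= s ^ j.
Proof.
  intros Hs. simpl. rewrite Rabs_mult, (Rabs_pos_eq (s ^ j)) by now apply pow_le.
  rewrite <- (Rmult_1_r (s ^ j)) at 2. apply Rmult_le_compat_l; [now apply pow_le|].
  apply Rabs_le. apply COS_bound.
Qed.

Lemma fact_S_ge (n : nat) : INR (fact n) <= INR (fact (S n)).
Proof. apply le_INR. simpl. lia. Qed.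

(** In the Lagrange remainder, of size at most [h^(n+1) s^(j+n) / (n+1)!], the factor
    [(2 h s)^n / n!] is bounded by [exp (2 h s)]; the spare [2^(-n)] gives geometric convergence at
    a rate independent of [s]. *)
Lemma trig_taylor (s : R) (j n : nat) (t h : R) : 0 <= s -> 0 < h ->
  Rabs (trig s j (t + h)
        - sum_n (fun i => h ^ i / INR (fact i) * trig s (j + i) t) n)
  <= h * (1 / 2) ^ n * (s ^ j * exp (2 * h * s)).
Proof.
  intros Hs Hh.
  destruct (Taylor_Lagrange (trig s j) n t (t + h)) as (z & _ & Hz); [lra| |].
  { intros; apply ex_derive_n_trig. }
  replace (t + h - t) with h in Hz by ring.
  rewrite Hz, sum_n_Reals.
  rewrite (sum_eq _ (fun i => h ^ i / INR (fact i) * trig s (j + i) t))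
    by (intros; now rewrite Derive_n_trig).
  rewrite Derive_n_trig.
  match goal with |- Rabs (?a + ?b - ?a) <= _ => replace (a + b - a) with b by ring end.
  (* The remainder has derivative index [S (j + n)], so [trig_bound] applies even for [j = 0], where
     [trig] itself has no such bound. *)
  rewrite Nat.add_succ_r, Rabs_mult.
  assert (P1 : 0 < h ^ S n) by now apply pow_lt.
  assert (P2 := INR_fact_lt_0 n). assert (P3 := INR_fact_lt_0 (S n)). assert (P4 := fact_S_ge n).
  assert (Sj : 0 <= s ^ j) by now apply pow_le.
  assert (Sn : 0 <= s ^ n) by now apply pow_le.
  rewrite (Rabs_pos_eq (h ^ S n / INR (fact (S n)))) by (left; now apply Rdiv_lt_0_compat).
  assert (B := trig_bound s (j + n) z Hs).
  assert (X := pow_le_exp n (2 * h * s) ltac:(nra)).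
  apply Rle_trans with (h ^ S n / INR (fact n) * s ^ (j + n)).
  - apply Rmult_le_compat; [left; now apply Rdiv_lt_0_compat | apply Rabs_pos | | exact B].
    apply Rmult_le_compat_l; [lra|]. now apply Rinv_le_contravar.
  - rewrite pow_add.
    replace (h ^ S n / INR (fact n) * (s ^ j * s ^ n)) with
      (h * (1 / 2) ^ n * (s ^ j * ((2 * h * s) ^ n / INR (fact n)))).
    + apply Rmult_le_compat_l; [apply Rmult_le_pos; [lra | apply pow_le; lra]|].
      now apply Rmult_le_compat_l.
    + rewrite !Rpow_mult_distr. simpl pow.
      replace ((1 / 2) ^ n) with (/ 2 ^ n) by (unfold Rdiv; rewrite Rmult_1_l, pow_inv; reflexivity).
      field. split; [lra|]. apply pow_nonzero; lra.
Qed.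

Lemma half_pow_squeeze (x B : R) : (forall n, Rabs x <= B * (1 / 2) ^ n) -> x = 0.
Proof.
  intros H.
  assert (L : is_lim_seq (fun n => B * (1 / 2) ^ n) (Rbar_mult B 0)).
  { apply is_lim_seq_scal_l, is_lim_seq_geom. rewrite Rabs_pos_eq; lra. }
  simpl in L. rewrite Rmult_0_r in L.
  assert (Rabs x <= 0).
  { apply (is_lim_seq_le (fun _ => Rabs x) (fun n => B * (1 / 2) ^ n) (Rabs x) 0 H
      (is_lim_seq_const _) L). }
  pose proof (Rabs_pos x). destruct (Req_dec x 0) as [E|E]; [exact E|].
  pose proof (Rabs_pos_lt x E). lra.
Qed.

Lemma cos_half_pi_odd (i : nat) : Nat.odd i = true -> cos (INR i * (PI / 2)) = 0.
Proof.
  intros H. apply Nat.odd_spec in H. destruct H as [k ->].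
  apply cos_eq_0_1. exists (Z.of_nat k).
  rewrite plus_INR, mult_INR, INR_IZR_INZ. simpl. rewrite <- INR_IZR_INZ. field.
Qed.

(** Uniqueness in the Stieltjes moment problem for measures on the natural
    numbers. The function [g t = sum d_m cos (sqrt m t)] is real-analytic with
    radius of convergence bounded below uniformly in [t], and its Taylor
    coefficients at [0] are the moments, so it vanishes identically; its mean
    value is [d_0]. *)
Lemma moments_zero (d : nat -> R) (A e : R) : 0 < e ->
  (forall m, Rabs (d m) <= A * wt e (INR m)) ->
  (forall k, is_series (fun m => d m * INR m ^ k) 0) ->
  d O = 0.
Proof.
  intros He Hd Hm.
  set (s := fun m => sqrt (INR m)).
  assert (Hs : forall m, 0 <= s m) by (intros; apply sqrt_pos).
  assert (Hss : forall m, s m * s m = INR m) by (intros; apply sqrt_sqrt, pos_INR).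
  (* Index 0 is included: the antiderivative of [g] vanishes together with all derivatives, which is
     what the mean value needs. *)
  set (Z := fun t => forall j, is_series (fun m => d m * trig (s m) j t) 0).
  (* With this step [exp (2 h s_m)] uses up half of the rate [e], so the Taylor remainders stay
     summable over [m], and the same step works from every [t]. *)
  set (h := e / 4).
  assert (A0 : 0 <= A).
  { specialize (Hd O). pose proof (Rabs_pos (d O)). pose proof (wt_pos e (INR 0)). nra. }
  assert (DOM : forall j, ex_series (fun m => Rabs (d m) * (s m ^ j * exp (2 * h * s m)))).
  { intros j. destruct (wt_pow (e / 4) j) as (K & HK & HP); [lra|].
    apply ex_series_Rle with (fun m => A * K * wt (e / 4) (INR m)).
    2: { apply ex_series_Rscal, ex_series_wt. lra. }
    intros m.
    assert (0 <= s m ^ j) by now apply pow_le.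
    pose proof (exp_pos (2 * h * s m)). split.
    { apply Rmult_le_pos; [apply Rabs_pos | nra]. }
    apply Rle_trans with (A * wt e (INR m) * (s m ^ j * exp (2 * h * s m))).
    { apply Rmult_le_compat_r; [nra | apply Hd]. }
    replace (A * wt e (INR m) * (s m ^ j * exp (2 * h * s m))) with
      (A * (s m ^ j * (wt e (INR m) * exp (2 * h * s m)))) by ring.
    rewrite (Rmult_assoc A K). apply Rmult_le_compat_l; [exact A0|].
    replace (wt e (INR m) * exp (2 * h * s m)) with (wt (2 * (e / 4)) (INR m)).
    { apply HP, pos_INR. }
    unfold wt. rewrite <- exp_plus. f_equal. unfold h. fold (s m). field. }
  (* At 0 the antiderivative and the odd derivatives of the cosine vanish term by term; the even
     derivatives give the moments up to sign. *)
  assert (Z0 : Z 0).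
  { intros [|i].
    - apply is_series_ext with (fun m => d m * INR m ^ 0 * 0).
      + intros m. simpl. rewrite (Rmult_0_r (s m)), sin_0.
        destruct (Req_EM_T (s m) 0); [ring|]. unfold Rdiv. ring.
      + pose proof (is_series_scal_r 0 _ _ (Hm O)) as X. now rewrite Rmult_0_l in X.
    - destruct (Nat.odd i) eqn:E.
      + apply is_series_ext with (fun m => d m * INR m ^ 0 * 0).
        * intros m. simpl. rewrite (Rmult_0_r (s m)), Rplus_0_l, cos_half_pi_odd by exact E. ring.
        * pose proof (is_series_scal_r 0 _ _ (Hm O)) as X. now rewrite Rmult_0_l in X.
      + rewrite <- Nat.negb_even in E. apply Bool.negb_false_iff in E.
        apply Nat.even_spec in E. destruct E as [k ->].
        pose proof (is_series_scal_r (cos (INR (2 * k) * (PI / 2))) _ _ (Hm k)) as X.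
        rewrite Rmult_0_l in X.
        eapply is_series_ext; [|exact X]. intros m. cbv beta.
        change (trig (s m) (S (2 * k)) 0) with
          (s m ^ (2 * k) * cos (s m * 0 + INR (2 * k) * (PI / 2))).
        rewrite Rmult_0_r, Rplus_0_l, pow_mult.
        replace (s m ^ 2) with (INR m) by (rewrite <- Hss; simpl; ring).
        change (d m * INR m ^ k * cos (INR (2 * k) * (PI / 2)) =
          d m * (INR m ^ k * cos (INR (2 * k) * (PI / 2)))). ring. }
  (* Taylor polynomials at [t], summed over [m], are combinations of the sums in [Z t] and vanish;
     only a remainder of order [2^(-n)] is left. *)
  assert (ZS : forall t, Z t -> Z (t + h)).
  { intros t Ht j. destruct (DOM j) as [W HS].
    set (b := fun n m => d m * sum_n (fun i => h ^ i / INR (fact i) * trig (s m) (j + i) t) n).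
    assert (Hb : forall n, is_series (b n) 0).
    { induction n as [|n IH].
      - pose proof (is_series_scal_r (h ^ 0 / INR (fact 0)) _ _ (Ht (j + 0)%nat)) as X.
        rewrite Rmult_0_l in X. eapply is_series_ext; [|exact X].
        intros m. unfold b. rewrite sum_O.
        match goal with |- @eq _ ?l ?r => change (@eq R l r) end. ring.
      - pose proof (is_series_scal_r (h ^ (S n) / INR (fact (S n))) _ _
          (Ht (j + S n)%nat)) as X.
        rewrite Rmult_0_l in X.
        pose proof (is_series_plus (V := R_NormedModule) _ _ _ _ IH X) as Y.
        match type of Y with is_series _ ?v => replace v with 0 in Y by (change (0 = 0 + 0); ring) end.
        eapply is_series_ext; [|exact Y].
        intros m. unfold b. rewrite sum_Sn. unfold plus.
        cbn -[fact INR pow trig sum_n].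
        match goal with |- @eq _ ?l ?r => change (@eq R l r) end. ring. }
    assert (Hh : 0 < h) by (unfold h; lra).
    assert (R1 : forall n m, Rabs (d m * trig (s m) j (t + h) - b n m) <=
       h * (1 / 2) ^ n * (Rabs (d m) * (s m ^ j * exp (2 * h * s m)))).
    { intros n m. unfold b. rewrite <- Rmult_minus_distr_l, Rabs_mult.
      replace (h * (1 / 2) ^ n * (Rabs (d m) * (s m ^ j * exp (2 * h * s m)))) with
        (Rabs (d m) * (h * (1 / 2) ^ n * (s m ^ j * exp (2 * h * s m)))) by ring.
      apply Rmult_le_compat_l; [apply Rabs_pos|]. now apply trig_taylor. }
    assert (DS : forall n, is_series (fun m => h * (1 / 2) ^ n *
       (Rabs (d m) * (s m ^ j * exp (2 * h * s m)))) (h * (1 / 2) ^ n * W)).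
    { intros n. now apply (is_series_scal (V := R_NormedModule)). }
    assert (EX : ex_series (fun m => d m * trig (s m) j (t + h))).
    { apply ex_series_ext with (fun m => plus (d m * trig (s m) j (t + h) - b 0%nat m) (b 0%nat m)).
      - intros m. change (d m * trig (s m) j (t + h) - b 0%nat m + b 0%nat m
          = d m * trig (s m) j (t + h)). ring.
      - apply (ex_series_plus (V := R_NormedModule)); [|now exists 0].
        apply (ex_series_le (V := R_CompleteNormedModule) _ _ (R1 O)). eexists. apply DS. }
    destruct EX as [l Hl]. change R in l.
    replace 0 with l; [exact Hl|].
    apply half_pow_squeeze with (h * W). intros n.
    replace (h * W * (1 / 2) ^ n) with (h * (1 / 2) ^ n * W) by ring.
    apply (Rser_bound _ _ _ _) with (2 := R1 n) (3 := DS n).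
    pose proof (is_series_minus (V := R_NormedModule) _ _ _ _ Hl (Hb n)) as X.
    match type of X with is_series _ ?v => replace v with l in X by (change (l = l + - 0 :> R); ring) end.
    exact X. }
  assert (ZK : forall k, Z (INR k * h)).
  { induction k as [|k IH]; [simpl; rewrite Rmult_0_l; exact Z0|].
    rewrite S_INR, Rmult_plus_distr_r, Rmult_1_l. now apply ZS. }
  destruct (ex_series_wt e He) as [w Hw].
  assert (W0 : is_series (fun m => A * wt e (INR m)) (A * w))
    by now apply (is_series_scal (V := R_NormedModule)).
  assert (S1 : forall m, 1 <= s (S m)).
  { intros m. rewrite <- sqrt_1. apply sqrt_le_1_alt. rewrite S_INR. pose proof (pos_INR m). lra. }
  (* Index 0 of [Z] at [T = k h] reads [d_0 T = - sum_{m >= 1} d_m sin (s_m T) / s_m]. Since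
     [s_m >= 1] there, the right side is bounded in [T], which forces [d_0 = 0] as [k] grows. *)
  assert (BD : forall k, Rabs (d O) * (INR k * h) <= A * w).
  { intros k. pose proof (ZK k O) as X.
    assert (Y : is_series (fun m => d m * (if Req_EM_T (s m) 0 then 0 else sin (s m * (INR k * h)) / s m))
       (- (d O * (INR k * h)))).
    { apply (is_series_decr_1 (V := R_NormedModule)).
      assert (S0 : s O = 0) by (unfold s; simpl; apply sqrt_0).
      rewrite S0. destruct (Req_EM_T 0 0) as [_|N]; [|easy].
      apply is_series_ext with (fun m => d (S m) * trig (s (S m)) 0 (INR k * h)).
      { intros m. specialize (S1 m). simpl trig. now destruct (Req_EM_T (s (S m)) 0); [lra|]. }
      apply (is_series_incr_1 (V := R_NormedModule) (fun m => d m * trig (s m) 0 (INR k * h))).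
      match goal with |- is_series _ ?v => replace v with 0; [exact X|] end.
      simpl trig. rewrite S0. destruct (Req_EM_T 0 0) as [_|N]; [|easy].
      change (0 = - (d 0%nat * (INR k * h)) + - (d 0%nat * 0) + d 0%nat * (INR k * h)). ring. }
    replace (Rabs (d O) * (INR k * h)) with (Rabs (- (d O * (INR k * h)))).
    - apply (Rser_bound _ _ _ _ Y) with (2 := W0). intros m.
      eapply Rle_trans; [|apply Hd]. rewrite Rabs_mult.
      rewrite <- (Rmult_1_r (Rabs (d m))) at 2. apply Rmult_le_compat_l; [apply Rabs_pos|].
      match goal with |- context [if ?c then _ else _] => destruct c as [E|E] end; [rewrite Rabs_R0; lra|].
      assert (1 <= s m).
      { destruct m as [|m]; [exfalso; apply E; unfold s; simpl; apply sqrt_0 | apply S1]. }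
      unfold Rdiv. rewrite Rabs_mult, (Rabs_pos_eq (/ s m)).
      + rewrite <- (Rmult_1_r 1). apply Rmult_le_compat; [apply Rabs_pos | | |].
        * left. apply Rinv_0_lt_compat. lra.
        * apply Rabs_le, SIN_bound.
        * rewrite <- Rinv_1. apply Rinv_le_contravar; lra.
      + left. apply Rinv_0_lt_compat. lra.
    - rewrite Rabs_Ropp, Rabs_mult, (Rabs_pos_eq (INR k * h)); [reflexivity|].
      apply Rmult_le_pos; [apply pos_INR | unfold h; lra]. }
  destruct (Req_dec (d O) 0) as [E|E]; [exact E|exfalso].
  pose proof (Rabs_pos_lt _ E) as P.
  assert (Q : 0 < Rabs (d O) * h) by (apply Rmult_lt_0_compat; [exact P | unfold h; lra]).
  destruct (archimed_cor1 (Rabs (d O) * h / (Rabs (A * w) + 1))) as (k & Hk & Hk0).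
  { apply Rdiv_lt_0_compat; [exact Q|]. pose proof (Rabs_pos (A * w)). lra. }
  specialize (BD k). pose proof (Rabs_pos (A * w)). pose proof (Rle_abs (A * w)).
  assert (K0 : 0 < INR k) by now apply lt_0_INR.
  apply (Rmult_lt_compat_r (INR k * (Rabs (A * w) + 1))) in Hk; [|apply Rmult_lt_0_compat; lra].
  replace (/ INR k * (INR k * (Rabs (A * w) + 1))) with (Rabs (A * w) + 1) in Hk by (field; lra).
  replace (Rabs (d O) * h / (Rabs (A * w) + 1) * (INR k * (Rabs (A * w) + 1))) with
    (Rabs (d O) * (INR k * h)) in Hk by (field; lra).
  lra.
Qed.

(** * Power series on the closed unit disc *)

Local Open Scope C_scope.

Lemma moments_zero_C (d : nat -> C) : decays d ->
  (forall k, Cser (fun m => d m * INR m ^ k) 0) -> d O = 0.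
Proof.
  intros (A & e & He & Hd) H.
  assert (X : Re (d O) = 0%R).
  { apply (moments_zero (fun m => Re (d m)) A e He).
    - intros m. eapply Rle_trans; [apply re_le_Cmod | apply Hd].
    - intros k. pose proof (proj1 (proj1 (Cser_Re_Im _ _) (H k))) as Y.
      eapply is_series_ext; [|exact Y]. intros m. cbv beta. rewrite <- RtoC_pow.
      unfold Re, Im; simpl. rewrite Rmult_0_r, Rminus_0_r. reflexivity. }
  assert (Y : Im (d O) = 0%R).
  { apply (moments_zero (fun m => Im (d m)) A e He).
    - intros m. eapply Rle_trans; [apply im_le_Cmod | apply Hd].
    - intros k. pose proof (proj2 (proj1 (Cser_Re_Im _ _) (H k))) as Y.
      eapply is_series_ext; [|exact Y]. intros m. cbv beta. rewrite <- RtoC_pow.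
      unfold Re, Im; simpl. rewrite Rmult_0_r, Rplus_0_l. reflexivity. }
  destruct (d O) as [x y]. simpl in X, Y. now rewrite X, Y.
Qed.

Lemma Cmod_pow_le_1 (w : C) (n : nat) : (Cmod w <= 1)%R -> (Cmod (w ^ n) <= 1)%R.
Proof.
  intros H. rewrite Cmod_pow. rewrite <- (pow1 n). apply pow_incr.
  split; [apply Cmod_ge_0 | exact H].
Qed.

Lemma decays_pow (c : nat -> C) (w : C) :
  (Cmod w <= 1)%R -> decays c -> decays (fun m => c m * w ^ m).
Proof.
  intros Hw. apply (decays_le _ _ 1). intros m. rewrite Cmod_mult, Rmult_1_l.
  rewrite <- (Rmult_1_r (Cmod (c m))) at 2.
  apply Rmult_le_compat_l; [apply Cmod_ge_0 | now apply Cmod_pow_le_1].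
Qed.

Lemma decays_Cser (c : nat -> C) : decays c -> Cser c (Csum c).
Proof. intros H. now apply Cser_abs, decays_ex_series. Qed.

(** * Taylor expansion up to the unit circle *)

(** Defined by Pascal's rule and zero above the diagonal, so the expansion of [w^m] needs no
    restriction [j <= m]. *)
Fixpoint binom (m k : nat) {struct m} : nat :=
  match m, k with
  | _, O => 1
  | O, S _ => 0
  | S m', S k' => binom m' k' + binom m' k
  end.

Lemma binom_0_r (m : nat) : binom m 0 = 1%nat.
Proof. now destruct m. Qed.

Lemma binom_gt (m k : nat) : (m < k)%nat -> binom m k = 0%nat.
Proof.
  revert k. induction m as [|m IH]; intros [|k] H; try lia; [reflexivity|].
  simpl. rewrite !IH by lia. reflexivity.
Qed.

(** Multiplication by [m] turns binomial coefficients into combinations of binomial coefficients;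
    iterated, it turns vanishing sums against binomials into vanishing moments. *)
Lemma mul_binom (m k : nat) :
  (m * binom m k = S k * binom m (S k) + k * binom m k)%nat.
Proof.
  revert k. induction m as [|m IH]; intros k; [destruct k; simpl; lia|].
  destruct k as [|k].
  - specialize (IH O). simpl. rewrite !binom_0_r in *. lia.
  - pose proof (IH k). pose proof (IH (S k)). simpl binom. nia.
Qed.

Lemma binom_le (m k : nat) : (INR (binom m k) <= (INR m + 1) ^ k)%R.
Proof.
  revert k. induction m as [|m IH]; intros [|k].
  - simpl; lra.
  - simpl binom. apply pow_le. simpl; lra.
  - simpl; lra.
  - simpl binom. rewrite plus_INR, S_INR. pose proof (pos_INR m).
    pose proof (IH k). pose proof (IH (S k)).
    apply Rle_trans with ((INR m + 1) ^ k * (INR m + 1 + 1))%R; [simpl in *; lra|].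
    simpl. rewrite Rmult_comm. apply Rmult_le_compat_l; [lra|].
    apply pow_incr. lra.
Qed.

(** Coefficient of [(w - w0)^j] in the expansion of [w^m] at [w0]. *)
Definition pow_coef (w0 : C) (j m : nat) : C := INR (binom m j) * w0 ^ (m - j).

(** The [k] terms have degrees below [k], so a Taylor remainder against [poly_eval f h k] has order
    [k]. *)
Fixpoint poly_eval (f : nat -> C) (h : C) (k : nat) : C :=
  match k with
  | O => 0
  | S k' => poly_eval f h k' + f k' * h ^ k'
  end.

Lemma pow_coef_S (w0 : C) (j m : nat) :
  pow_coef w0 (S j) (S m) = pow_coef w0 j m + w0 * pow_coef w0 (S j) m.
Proof.
  unfold pow_coef. simpl binom. rewrite plus_INR, RtoC_plus.
  destruct (le_lt_dec (S j) m) as [H|H].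
  - replace (S m - S j)%nat with (S (m - S j)) by lia.
    replace (m - j)%nat with (S (m - S j)) by lia. simpl. ring.
  - rewrite (binom_gt m (S j)) by lia. replace (S m - S j)%nat with (m - j)%nat by lia.
    simpl INR. ring.
Qed.

Lemma poly_eval_pow_coef_S (w0 h : C) (k m : nat) :
  poly_eval (fun j => pow_coef w0 j (S m)) h (S k) =
  w0 * poly_eval (fun j => pow_coef w0 j m) h (S k) + h * poly_eval (fun j => pow_coef w0 j m) h k.
Proof.
  induction k as [|k IH].
  - simpl. unfold pow_coef. rewrite !binom_0_r, !Nat.sub_0_r. simpl. ring.
  - remember (S k) as k1. simpl. rewrite IH. subst k1. rewrite pow_coef_S. simpl. ring.
Qed.

Lemma Cminus_0_r (z : C) : z - 0 = z.
Proof. ring. Qed.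

(** The remainders satisfy [R (k+1) (m+1) = w0 R (k+1) m + h R k m], which is the Pascal recursion
    of the bound. Only [|w0| <= 1] and [|w0 + h| <= 1] enter, so points of the circle are
    allowed. *)
Lemma pow_taylor (w0 h : C) (k m : nat) : (Cmod w0 <= 1)%R -> (Cmod (w0 + h) <= 1)%R ->
  (Cmod ((w0 + h) ^ m - poly_eval (fun j => pow_coef w0 j m) h k) <= INR (binom m k) * Cmod h ^ k)%R.
Proof.
  intros H0 H1. revert k. induction m as [|m IH]; intros k.
  - destruct k as [|k].
    + simpl poly_eval. rewrite Cminus_0_r. simpl. rewrite Cmod_1. lra.
    + simpl binom. simpl INR. rewrite Rmult_0_l.
      replace (poly_eval (fun j => pow_coef w0 j 0) h (S k)) with (1 : C).
      * simpl. replace (1 - 1) with (RtoC 0) by ring. rewrite Cmod_0. lra.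
      * induction k as [|k IHk]; [simpl; unfold pow_coef; simpl; ring|].
        change (RtoC 1 = poly_eval (fun j => pow_coef w0 j 0) h (S k) + pow_coef w0 (S k) 0 * h ^ S k).
        rewrite <- IHk. unfold pow_coef. simpl. ring.
  - destruct k as [|k].
    + simpl poly_eval. rewrite Cminus_0_r. rewrite binom_0_r. simpl pow. simpl INR.
      rewrite Rmult_1_l. now apply Cmod_pow_le_1.
    + rewrite poly_eval_pow_coef_S.
      replace ((w0 + h) ^ S m - (w0 * poly_eval (fun j => pow_coef w0 j m) h (S k)
          + h * poly_eval (fun j => pow_coef w0 j m) h k)) with
        (w0 * ((w0 + h) ^ m - poly_eval (fun j => pow_coef w0 j m) h (S k))
         + h * ((w0 + h) ^ m - poly_eval (fun j => pow_coef w0 j m) h k)) by (simpl; ring).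
      eapply Rle_trans; [apply Cmod_triangle|]. rewrite !Cmod_mult.
      pose proof (IH (S k)) as A. pose proof (IH k) as B.
      pose proof (Cmod_ge_0 h) as P.
      set (x := Cmod ((w0 + h) ^ m - poly_eval (fun j => pow_coef w0 j m) h (S k))) in *.
      set (y := Cmod ((w0 + h) ^ m - poly_eval (fun j => pow_coef w0 j m) h k)) in *.
      assert (X0 : (0 <= x)%R) by apply Cmod_ge_0.
      simpl binom. rewrite plus_INR. simpl pow in *.
      apply Rle_trans with (1 * x + Cmod h * y)%R.
      * apply Rplus_le_compat_r. now apply Rmult_le_compat_r.
      * apply (Rmult_le_compat_l _ _ _ P) in B. lra.
Qed.

(** [disc_coef c w0 j] is [1 / j!] times the [j]-th derivative at [w0] of
    [sum_m c_m w^m], also when [w0] is on the unit circle. *)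
Definition disc_coef (c : nat -> C) (w0 : C) (j : nat) : C :=
  Csum (fun m => c m * pow_coef w0 j m).

Definition disc_sum (c : nat -> C) (w : C) : C := Csum (fun m => c m * w ^ m).

Lemma Cmod_INR (n : nat) : Cmod (INR n) = INR n.
Proof. rewrite Cmod_R. apply Rabs_pos_eq, pos_INR. Qed.

Lemma Cser_disc_coef (c : nat -> C) (w0 : C) (j : nat) : decays c -> (Cmod w0 <= 1)%R ->
  Cser (fun m => c m * pow_coef w0 j m) (disc_coef c w0 j).
Proof.
  intros Hc Hw. apply decays_Cser. apply (decays_poly c _ 1 j); [|exact Hc].
  intros m. unfold pow_coef. rewrite !Cmod_mult, Cmod_INR.
  pose proof (Cmod_pow_le_1 w0 (m - j) Hw). pose proof (Cmod_ge_0 (w0 ^ (m - j))).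
  pose proof (Cmod_ge_0 (c m)). pose proof (binom_le m j). pose proof (pos_INR (binom m j)).
  rewrite Rmult_1_l, Rmult_comm. apply Rmult_le_compat_r; [lra|].
  rewrite <- (Rmult_1_r ((INR m + 1) ^ j)). apply Rmult_le_compat; lra.
Qed.

Lemma Cser_disc_sum (c : nat -> C) (w : C) : decays c -> (Cmod w <= 1)%R ->
  Cser (fun m => c m * w ^ m) (disc_sum c w).
Proof. intros Hc Hw. apply decays_Cser. now apply decays_pow. Qed.

(** The constant [sum |c_m| binom m k] is finite because of the decay, and it serves all base points
    of the closed disc at once. *)
Lemma disc_taylor (c : nat -> C) (k : nat) : decays c ->
  exists M, (0 <= M)%R /\ forall w0 h, (Cmod w0 <= 1)%R -> (Cmod (w0 + h) <= 1)%R ->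
   (Cmod (disc_sum c (w0 + h) - poly_eval (disc_coef c w0) h k) <= M * Cmod h ^ k)%R.
Proof.
  intros Hc.
  assert (D : decays (fun m => c m * INR (binom m k))).
  { apply (decays_poly c _ 1 k); [|exact Hc]. intros m.
    rewrite Cmod_mult, Cmod_INR, Rmult_1_l, Rmult_comm.
    apply Rmult_le_compat_r; [apply Cmod_ge_0 | apply binom_le]. }
  apply decays_ex_series in D. destruct D as [M HM].
  exists M. split.
  { pose proof (sum_n_le_series _ _ 0 (fun n => Cmod_ge_0 _) HM) as Q. rewrite sum_O in Q.
    eapply Rle_trans; [apply Cmod_ge_0 | exact Q]. }
  intros w0 h H0 H1.
  assert (P : forall n, Cser (fun m => c m * poly_eval (fun j => pow_coef w0 j m) h n)
      (poly_eval (disc_coef c w0) h n)).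
  { induction n as [|n IH].
    - apply Cser_zero. intros m. simpl. ring.
    - pose proof (Cser_scal (h ^ n) _ _ (Cser_disc_coef c w0 n Hc H0)) as Q.
      pose proof (Cser_plus _ _ _ _ IH Q) as Q2.
      simpl. rewrite (Cmult_comm (disc_coef c w0 n)).
      eapply Cser_ext; [|exact Q2]. intros m. simpl. ring. }
  pose proof (Cser_minus _ _ _ _ (Cser_disc_sum c (w0 + h) Hc H1) (P k)) as Q.
  rewrite Rmult_comm.
  apply (Cser_bound _ _ (fun m => Cmod h ^ k * Cmod (c m * INR (binom m k)))%R _ Q).
  - intros m.
    replace (c m * (w0 + h) ^ m - c m * poly_eval (fun j => pow_coef w0 j m) h k)
      with (c m * ((w0 + h) ^ m - poly_eval (fun j => pow_coef w0 j m) h k)) by ring.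
    rewrite !Cmod_mult, Cmod_INR.
    pose proof (pow_taylor w0 h k m H0 H1) as T.
    replace (Cmod h ^ k * (Cmod (c m) * INR (binom m k)))%R with
      (Cmod (c m) * (INR (binom m k) * Cmod h ^ k))%R by ring.
    apply Rmult_le_compat_l; [apply Cmod_ge_0 | exact T].
  - now apply (is_series_scal (V := R_NormedModule)).
Qed.

Lemma disc_coef_nonzero (c : nat -> C) (w0 : C) : decays c -> (Cmod w0 <= 1)%R ->
  c O <> 0 -> exists j, disc_coef c w0 j <> 0.
Proof.
  intros Hc Hw H0. apply NNPP. intros N.
  assert (Z : forall j, disc_coef c w0 j = 0).
  { intros j. apply NNPP. intros X. apply N. now exists j. }
  apply H0.
  (* For [i = 0] this is the vanishing of the Taylor coefficients, multiplied by [w0^j] so that no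
     division by [w0] occurs and [w0 = 0] is allowed; [mul_binom] raises [i]. *)
  assert (M : forall i j, Cser (fun m => c m * w0 ^ m * INR m ^ i * INR (binom m j)) 0).
  { induction i as [|i IH]; intros j.
    - pose proof (Cser_disc_coef c w0 j Hc Hw) as Q. rewrite Z in Q.
      apply (Cser_scal (w0 ^ j)) in Q. rewrite Cmult_0_r in Q.
      eapply Cser_ext; [|exact Q]. intros m. unfold pow_coef. simpl.
      destruct (le_lt_dec j m) as [L|L].
      + replace m with (j + (m - j))%nat at 5 by lia. rewrite Cpow_add_r. ring.
      + rewrite binom_gt by lia. simpl. ring.
    - pose proof (Cser_plus _ _ _ _ (Cser_scal (INR (S j)) _ _ (IH (S j)))
        (Cser_scal (INR j) _ _ (IH j))) as Q.
      rewrite !Cmult_0_r, Cplus_0_l in Q.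
      eapply Cser_ext; [|exact Q]. intros m. simpl Cpow.
      pose proof (f_equal INR (mul_binom m j)) as E.
      rewrite plus_INR, !mult_INR in E. apply (f_equal RtoC) in E.
      rewrite RtoC_plus, !RtoC_mult in E.
      transitivity (c m * w0 ^ m * INR m ^ i *
        (INR (S j) * INR (binom m (S j)) + INR j * INR (binom m j))); [ring|].
      rewrite <- E. ring. }
  pose proof (moments_zero_C (fun m => c m * w0 ^ m) (decays_pow c w0 Hw Hc)) as Q.
  simpl in Q. rewrite Cmult_1_r in Q. apply Q. intros k.
  eapply Cser_ext; [|apply (M k O)]. intros m. cbv beta. rewrite binom_0_r. simpl INR. ring.
Qed.

Lemma least_nat (P : nat -> Prop) : (exists n, P n) -> exists n, P n /\ forall k, (k < n)%nat -> ~ P k.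
Proof.
  intros [n Hn]. revert Hn. induction n as [n IH] using (well_founded_induction Nat.lt_wf_0).
  intros Hn. destruct (classic (exists k, (k < n)%nat /\ P k)) as [(k & Hk & Pk)|N].
  - now apply (IH k).
  - exists n. split; [exact Hn|]. intros k Hk Pk. apply N. now exists k.
Qed.

(** If [t] is the first nonzero Taylor coefficient and [k] its index, a zero at distance [r > 0]
    gives [|t| r^k <= M r^(k+1)]. The centre [w0] may be a zero or not, as the covering argument
    uses every point; [M + 1] guards against [M = 0]. *)
Lemma disc_zero_isolated (c : nat -> C) (w0 : C) : decays c -> (Cmod w0 <= 1)%R ->
  c O <> 0 -> exists d, (0 < d)%R /\
    forall w, (Cmod w <= 1)%R -> disc_sum c w = 0 -> (Cmod (w - w0) < d)%R -> w = w0.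
Proof.
  intros Hc Hw H0.
  destruct (least_nat _ (disc_coef_nonzero c w0 Hc Hw H0)) as (k & Hk & Hl).
  destruct (disc_taylor c (S k) Hc) as (M & HM & HT).
  apply Cmod_gt_0 in Hk.
  exists (Cmod (disc_coef c w0 k) / (M + 1))%R. split.
  { apply Rdiv_lt_0_compat; lra. }
  intros w H1 HZ Hd. apply NNPP. intros N.
  assert (Hh : (0 < Cmod (w - w0))%R).
  { apply Cmod_gt_0. intros E. apply N. replace w with (w - w0 + w0) by ring. rewrite E. ring. }
  specialize (HT w0 (w - w0) Hw). replace (w0 + (w - w0)) with w in HT by ring.
  specialize (HT H1). rewrite HZ in HT.
  assert (E : poly_eval (disc_coef c w0) (w - w0) (S k) = disc_coef c w0 k * (w - w0) ^ k).
  { simpl. replace (poly_eval (disc_coef c w0) (w - w0) k) with (RtoC 0); [ring|].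
    clear -Hl. assert (G : forall i, (i <= k)%nat -> poly_eval (disc_coef c w0) (w - w0) i = 0).
    { induction i as [|i IH]; intros Hi; [reflexivity|]. simpl. rewrite IH by lia.
      replace (disc_coef c w0 i) with (RtoC 0); [ring|].
      symmetry. apply NNPP. apply Hl. lia. }
    symmetry. now apply G. }
  rewrite E in HT.
  replace (0 - disc_coef c w0 k * (w - w0) ^ k) with (- (disc_coef c w0 k * (w - w0) ^ k)) in HT by ring.
  rewrite Cmod_opp, Cmod_mult, Cmod_pow in HT. simpl in HT.
  set (t := Cmod (disc_coef c w0 k)) in *. set (h := Cmod (w - w0)) in *.
  pose proof (pow_lt h k Hh) as Pk.
  assert (t <= M * h)%R.
  { apply Rmult_le_reg_r with (h ^ k)%R; [exact Pk|]. lra. }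
  apply (Rmult_lt_compat_r (M + 1)) in Hd; [|lra].
  replace (t / (M + 1) * (M + 1))%R with t in Hd by (field; lra). lra.
Qed.

Lemma disc_zeros_finite (c : nat -> C) : decays c -> c O <> 0 ->
  exists l, forall w, (Cmod w <= 1)%R -> disc_sum c w = 0 -> In w l.
Proof.
  intros Hc H0.
  (* The factor 2 covers the passage from the maximum of the coordinates, in which the compactness
     lemma measures distance, to the modulus. Centres in the square but outside the disc get a
     radius too small to reach the disc. *)
  assert (ISO : forall w0 : C, exists d : posreal, forall w, (Cmod w <= 1)%R -> disc_sum c w = 0 ->
     (Cmod (w - w0) < 2 * pos d)%R -> w = w0).
  { intros w0. destruct (Rle_lt_dec (Cmod w0) 1) as [H|H].
    - destruct (disc_zero_isolated c w0 Hc H H0) as (d & Hd & HI).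
      assert (P : (0 < d / 2)%R) by lra. exists (mkposreal _ P). simpl.
      intros w Hw1 Hw2 Hw3. apply HI; auto. lra.
    - assert (P : (0 < (Cmod w0 - 1) / 2)%R) by lra. exists (mkposreal _ P). simpl.
      intros w Hw1 _ Hw3. exfalso.
      pose proof (Cmod_triangle w (w0 - w)) as T. replace (w + (w0 - w)) with w0 in T by ring.
      replace (w0 - w) with (- (w - w0)) in T by ring. rewrite Cmod_opp in T. lra. }
  set (dl := fun x : Compactness.Tn 2 R =>
    proj1_sig (constructive_indefinite_description _ (ISO (fst x, fst (snd x))))).
  apply NNPP. intros N.
  (* The covering lemma gives a finite list under a double negation. A covering ball contains no
     zero apart from its centre, so the list of centres contains all zeros. *)
  apply (compactness_list 2 (-1, (-1, tt))%R (1, (1, tt))%R dl).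
  intros (l & Hl). apply N.
  exists (map (fun x : Compactness.Tn 2 R => (fst x, fst (snd x))) l).
  intros [x y] Hw HZ.
  pose proof (Rmax_Cmod (x, y)) as RM. simpl in RM.
  pose proof (Rmax_l (Rabs x) (Rabs y)). pose proof (Rmax_r (Rabs x) (Rabs y)).
  destruct (Hl (x, (y, tt))) as ((t1 & t2 & []) & Ht & _ & Hcl).
  { simpl. assert (X1 : (Rabs x <= 1)%R) by lra. assert (X2 : (Rabs y <= 1)%R) by lra.
    apply Rabs_le_between in X1. apply Rabs_le_between in X2. repeat split; lra. }
  apply in_map_iff. exists (t1, (t2, tt)). split; [|exact Ht].
  simpl. symmetry. unfold dl in Hcl. simpl in Hcl.
  destruct (constructive_indefinite_description _ (ISO (t1, t2))) as [d Hd]. simpl in Hcl.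
  apply Hd; auto.
  destruct Hcl as (C1 & C2 & _).
  eapply Rle_lt_trans; [apply Cmod_2Rmax|]. simpl.
  assert (S2 : (sqrt 2 <= 2)%R).
  { rewrite <- (sqrt_square 2) at 2 by lra. apply sqrt_le_1_alt. lra. }
  assert (MX : (Rmax (Rabs (x + - t1)) (Rabs (y + - t2)) < d)%R) by now apply Rmax_lub_lt.
  pose proof (Rabs_pos (x + - t1)). pose proof (Rmax_l (Rabs (x + - t1)) (Rabs (y + - t2))).
  pose proof (sqrt_pos 2). nra.
Qed.

(** * Complex derivatives in the strip *)

Lemma C_eq (z w : C) : Re z = Re w -> Im z = Im w -> z = w.
Proof. destruct z, w; simpl. now intros -> ->. Qed.

Lemma Cexp_plus (z w : C) : Cexp (z + w) = Cexp z * Cexp w.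
Proof.
  apply C_eq; unfold Cexp; simpl; rewrite exp_plus, ?cos_plus, ?sin_plus; unfold Re, Im; ring.
Qed.

Lemma Cexp_0 : Cexp 0 = 1.
Proof. apply C_eq; unfold Cexp; simpl; rewrite exp_0, ?cos_0, ?sin_0; ring. Qed.

Lemma Cmod_Cexp (z : C) : Cmod (Cexp z) = exp (Re z).
Proof.
  unfold Cmod, Cexp; simpl.
  replace (exp (Re z) * cos (Im z) * (exp (Re z) * cos (Im z) * 1) +
    exp (Re z) * sin (Im z) * (exp (Re z) * sin (Im z) * 1))%R with
    (exp (Re z) * exp (Re z) * (Rsqr (sin (Im z)) + Rsqr (cos (Im z))))%R by (unfold Rsqr; ring).
  rewrite sin2_cos2, Rmult_1_r. apply sqrt_square. left. apply exp_pos.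
Qed.

Lemma Cexp_nz (z : C) : Cexp z <> 0.
Proof. apply Cmod_gt_0. rewrite Cmod_Cexp. apply exp_pos. Qed.

Lemma Cexp_opp (z : C) : Cexp (- z) = / Cexp z.
Proof.
  assert (H : Cexp (- z) * Cexp z = 1) by (rewrite <- Cexp_plus, <- Cexp_0; f_equal; ring).
  replace (Cexp (- z)) with (Cexp (- z) * Cexp z * / Cexp z) by (field; apply Cexp_nz).
  rewrite H. ring.
Qed.

Lemma Cexp_INR (k : nat) (z : C) : Cexp (INR k * z) = Cexp z ^ k.
Proof.
  induction k as [|k IH].
  - simpl. rewrite <- Cexp_0. f_equal. ring.
  - rewrite S_INR, RtoC_plus, Cmult_plus_distr_r, Cexp_plus, IH, Cmult_1_l. simpl. ring.
Qed.

Lemma Cmod_le_Re_Im (z : C) : (Cmod z <= Rabs (Re z) + Rabs (Im z))%R.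
Proof.
  destruct z as [x y]. simpl.
  replace ((x, y) : C) with (RtoC x + Ci * RtoC y) by (apply C_eq; simpl; ring).
  eapply Rle_trans; [apply Cmod_triangle|]. rewrite Cmod_mult, Cmod_Ci, !Cmod_R. lra.
Qed.

Lemma exp_quadratic (x : R) : (Rabs x <= 1 / 2)%R -> (Rabs (exp x - 1 - x) <= 2 * x ^ 2)%R.
Proof.
  intros H. apply Rabs_le_between in H.
  assert (L : forall t, (1 + t <= exp t)%R).
  { intros t. destruct (Req_dec t 0) as [->|N]; [rewrite exp_0; lra | left; now apply exp_ineq1]. }
  pose proof (L x) as A. pose proof (L (- x)%R) as B. rewrite exp_Ropp in B.
  pose proof (exp_pos x) as P.
  apply (Rmult_le_compat_r (exp x)) in B; [|lra]. rewrite Rinv_l in B by lra.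
  rewrite Rabs_pos_eq by lra.
  assert (exp x <= 2)%R by nra. simpl.
  assert ((1 - x) * (exp x - 1 - x) <= x * x)%R by nra. nra.
Qed.

Lemma sin_lipschitz (y : R) : (Rabs (sin y) <= Rabs y)%R.
Proof.
  destruct (MVT_gen sin 0 y cos) as (c & _ & E).
  - intros x _. auto_derive; [trivial | ring].
  - intros x _. apply continuity_sin.
  - rewrite sin_0, !Rminus_0_r in E. rewrite E, Rabs_mult.
    rewrite <- (Rmult_1_l (Rabs y)) at 2. apply Rmult_le_compat_r; [apply Rabs_pos|].
    apply Rabs_le, COS_bound.
Qed.

Lemma cos_quadratic (y : R) : (Rabs (cos y - 1) <= y ^ 2)%R.
Proof.
  replace y with (2 * (y / 2))%R at 1 by field. rewrite cos_2a_sin.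
  replace (1 - 2 * sin (y / 2) * sin (y / 2) - 1)%R with (- (2 * (sin (y / 2) * sin (y / 2))))%R by ring.
  rewrite Rabs_Ropp, Rabs_mult, (Rabs_pos_eq 2), Rabs_mult by lra.
  pose proof (sin_lipschitz (y / 2)) as S. pose proof (Rabs_pos (sin (y / 2))).
  assert (Rabs (y / 2) * Rabs (y / 2) = y ^ 2 / 4)%R.
  { rewrite <- Rabs_mult, Rabs_pos_eq; [field|]. pose proof (Rle_0_sqr (y / 2)). unfold Rsqr in *. lra. }
  pose proof (pow2_ge_0 y). nra.
Qed.

Lemma sin_quadratic (y : R) : (Rabs y <= 1)%R -> (Rabs (sin y - y) <= y ^ 2)%R.
Proof.
  intros H. destruct (MVT_gen (fun y => sin y - y)%R 0 y (fun y => cos y - 1)%R) as (c & Hc & E).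
  - intros x _. auto_derive; [trivial | ring].
  - intros x _. apply continuity_pt_filterlim.
    apply (continuous_minus sin (fun x => x)); [|apply continuous_id].
    apply continuity_pt_filterlim, continuity_sin.
  - rewrite sin_0, !Rminus_0_r in E. rewrite E, Rabs_mult.
    assert (Rabs c <= Rabs y)%R.
    { unfold Rmin, Rmax, Rabs in *. destruct (Rle_dec 0 y), (Rcase_abs c), (Rcase_abs y); lra. }
    pose proof (cos_quadratic c) as Q. rewrite <- (pow2_abs c) in Q.
    pose proof (Rabs_pos c). pose proof (Rabs_pos y). rewrite <- (pow2_abs y).
    assert (Rabs c ^ 2 <= Rabs y)%R by (simpl; nra).
    simpl in *. pose proof (Rabs_pos (cos c - 1)). nra.
Qed.

(** One second-order estimate at 0 serves both for the derivative of [Cexp] and for its local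
    Lipschitz bound; the constant 20 is generous. *)
Lemma Cexp_quadratic (h : C) : (Cmod h <= 1 / 2)%R ->
  (Cmod (Cexp h - 1 - h) <= 20 * Cmod h ^ 2)%R.
Proof.
  intros H. destruct h as [x y].
  pose proof (Rmax_Cmod (x, y)) as RM. simpl in RM.
  pose proof (Rmax_l (Rabs x) (Rabs y)). pose proof (Rmax_r (Rabs x) (Rabs y)).
  set (r := Cmod (x, y)) in *.
  pose proof (exp_quadratic x ltac:(lra)) as E1.
  pose proof (cos_quadratic y) as E2. pose proof (sin_quadratic y ltac:(lra)) as E3.
  rewrite <- (pow2_abs x) in E1. rewrite <- (pow2_abs y) in E2, E3.
  pose proof (Rabs_pos x) as Px. pose proof (Rabs_pos y) as Py.
  assert (X2 : (Rabs x ^ 2 <= r ^ 2)%R) by (apply pow_incr; lra).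
  assert (Y2 : (Rabs y ^ 2 <= r ^ 2)%R) by (apply pow_incr; lra).
  assert (EX : (Rabs (exp x - 1) <= 2 * r)%R).
  { replace (exp x - 1)%R with ((exp x - 1 - x) + x)%R by ring.
    eapply Rle_trans; [apply Rabs_triang|]. simpl in *. nra. }
  assert (EX2 : (exp x <= 2)%R).
  { pose proof (Rle_abs (exp x - 1)). lra. }
  pose proof (exp_pos x) as EP.
  eapply Rle_trans; [apply Cmod_le_Re_Im|].
  replace (Re (Cexp (x, y) - 1 - (x, y)))%R with ((exp x - 1 - x) + exp x * (cos y - 1))%R
    by (simpl; ring).
  replace (Im (Cexp (x, y) - 1 - (x, y)))%R with (exp x * (sin y - y) + (exp x - 1) * y)%R
    by (simpl; ring).
  assert (A1 : (Rabs (exp x - 1 - x + exp x * (cos y - 1)) <= 4 * r ^ 2)%R).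
  { eapply Rle_trans; [apply Rabs_triang|]. rewrite Rabs_mult, (Rabs_pos_eq (exp x)) by lra.
    pose proof (Rabs_pos (cos y - 1)). nra. }
  assert (A2 : (Rabs (exp x * (sin y - y) + (exp x - 1) * y) <= 4 * r ^ 2)%R).
  { eapply Rle_trans; [apply Rabs_triang|]. rewrite !Rabs_mult, (Rabs_pos_eq (exp x)) by lra.
    pose proof (Rabs_pos (sin y - y)). pose proof (Rabs_pos (exp x - 1)).
    assert (Rabs (exp x - 1) * Rabs y <= 2 * r * r)%R by (apply Rmult_le_compat; lra).
    simpl in *. nra. }
  pose proof (pow2_ge_0 r). lra.
Qed.

Notation is_Cderive f z l :=
  (is_derive (K := C_AbsRing) (V := C_NormedModule) f z l) (only parsing).

Lemma is_Cderive_quadratic (f : C -> C) (z l : C) (M d : R) : (0 <= M)%R -> (0 < d)%R ->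
  (forall h, (Cmod h < d)%R -> (Cmod (f (z + h)%C - f z - h * l) <= M * Cmod h ^ 2)%R) ->
  is_Cderive f z l.
Proof.
  intros HM Hd H. split; [apply is_linear_scal_l|].
  intros x Hx e.
  pose proof (@is_filter_lim_locally_unique C_AbsRing (AbsRing_NormedModule C_AbsRing) z x Hx) as E.
  change (z = x :> C) in E. subst x. clear Hx.
  assert (P : (0 < Rmin d (e / (M + 1)))%R).
  { apply Rmin_pos; [exact Hd|]. apply Rdiv_lt_0_compat; [apply cond_pos | lra]. }
  exists (mkposreal _ P). intros y Hy. change C in y.
  change (Cmod (y - z) < Rmin d (e / (M + 1)))%R in Hy.
  change (Cmod ((f y - f z) - (y - z) * l) <= e * Cmod (y - z))%R.
  pose proof (Rmin_l d (e / (M + 1))). pose proof (Rmin_r d (e / (M + 1))).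
  specialize (H (y - z) ltac:(lra)). replace (z + (y - z)) with y in H by ring.
  eapply Rle_trans; [exact H|]. simpl.
  pose proof (Cmod_ge_0 (y - z)) as G. set (r := Cmod (y - z)) in *.
  assert (r * (M + 1) <= e)%R.
  { apply Rmult_le_reg_r with (/ (M + 1))%R; [apply Rinv_0_lt_compat; lra|].
    replace (r * (M + 1) * / (M + 1))%R with r by (field; lra). unfold Rdiv in *. lra. }
  nra.
Qed.

Lemma is_Cderive_Cexp (z : C) : is_Cderive Cexp z (Cexp z).
Proof.
  apply (is_Cderive_quadratic _ _ _ (Cmod (Cexp z) * 20) (1 / 2)).
  - pose proof (Cmod_ge_0 (Cexp z)). lra.
  - lra.
  - intros h Hh. rewrite Cexp_plus.
    replace (Cexp z * Cexp h - Cexp z - h * Cexp z) with (Cexp z * (Cexp h - 1 - h)) by ring.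
    rewrite Cmod_mult, Rmult_assoc. apply Rmult_le_compat_l; [apply Cmod_ge_0|].
    apply Cexp_quadratic. lra.
Qed.

Lemma is_Cderive_disc_sum (c : nat -> C) (w : C) : decays c -> (Cmod w < 1)%R ->
  is_Cderive (disc_sum c) w (disc_coef c w 1).
Proof.
  intros Hc Hw. destruct (disc_taylor c 2 Hc) as (M & HM & HT).
  apply (is_Cderive_quadratic _ _ _ M (1 - Cmod w)); [exact HM | lra|].
  intros h Hh. specialize (HT w h ltac:(lra)).
  replace (disc_sum c (w + h) - disc_sum c w - h * disc_coef c w 1) with
    (disc_sum c (w + h) - poly_eval (disc_coef c w) h 2).
  - apply HT. eapply Rle_trans; [apply Cmod_triangle | lra].
  - simpl. replace (disc_coef c w 0) with (disc_sum c w); [ring|].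
    unfold disc_sum, disc_coef, pow_coef. f_equal. apply functional_extensionality.
    intros m. rewrite binom_0_r, Nat.sub_0_r. simpl. ring.
Qed.

Lemma is_Cderive_linear (k z : C) : is_Cderive (fun x => k * x) z k.
Proof.
  apply (is_Cderive_quadratic _ _ _ 0 1); [lra | lra|].
  intros h _. replace (k * (z + h) - k * z - h * k) with (RtoC 0) by ring.
  rewrite Cmod_0. lra.
Qed.

Definition half_exp (z : C) : C := Cexp (Ci * z / 2).

Lemma half_exp_eq (x y : R) :
  half_exp (x, y) = (exp (- y / 2) * cos (x / 2), exp (- y / 2) * sin (x / 2))%R.
Proof.
  unfold half_exp.
  replace (Ci * (x, y) / 2) with ((- y / 2, x / 2)%R : C); [reflexivity|].
  apply C_eq; simpl; field.
Qed.

Lemma Cmod_half_exp (z : C) : Cmod (half_exp z) = exp (- Im z / 2).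
Proof.
  unfold half_exp. rewrite Cmod_Cexp. f_equal. destruct z as [x y]. simpl. field.
Qed.

Lemma Cmod_half_exp_le_1 (z : C) : (0 <= Im z)%R -> (Cmod (half_exp z) <= 1)%R.
Proof. intros H. rewrite Cmod_half_exp, <- exp_0. apply exp_le. lra. Qed.

Lemma Cmod_half_exp_lt_1 (z : C) : (0 < Im z)%R -> (Cmod (half_exp z) < 1)%R.
Proof. intros H. rewrite Cmod_half_exp, <- exp_0. apply exp_increasing. lra. Qed.

(** Stronger than continuity within [P], but immediate from Taylor's formula of order one and stable
    under products. With [P] the closed half-plane it covers real points too. *)
Definition lipschitz_at (P : C -> Prop) (f : C -> C) (z0 : C) : Prop :=
  exists M d, (0 <= M)%R /\ (0 < d)%R /\
    forall z, P z -> (Cmod (z - z0) < d)%R -> (Cmod (f z - f z0) <= M * Cmod (z - z0))%R.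

Lemma lipschitz_at_filterlim (P : C -> Prop) (f : C -> C) (z0 : C) :
  lipschitz_at P f z0 -> filterlim f (within P (locally z0)) (locally (f z0)).
Proof.
  intros (M & d & HM & Hd & H) Q [e HQ].
  (* A ball of radius [r] in the product uniformity of [C] is only known to lie within modulus
     [sqrt 2 r]; halving the radius compensates. *)
  assert (D : (0 < Rmin d (e / (M + 1)) / 2)%R).
  { apply Rdiv_lt_0_compat; [|lra]. apply Rmin_pos; [exact Hd|].
    apply Rdiv_lt_0_compat; [apply cond_pos | lra]. }
  exists (mkposreal _ D). intros z Hz HP. apply HQ.
  apply C_NormedModule_mixin_compat1. change (Cmod (f z - f z0) < e)%R.
  apply C_NormedModule_mixin_compat2 in Hz.
  change (Cmod (z - z0) < sqrt 2 * (Rmin d (e / (M + 1)) / 2))%R in Hz.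
  assert (S2 : (sqrt 2 <= 2)%R).
  { rewrite <- (sqrt_square 2) at 2 by lra. apply sqrt_le_1_alt. lra. }
  assert (B : (Cmod (z - z0) < Rmin d (e / (M + 1)))%R) by nra.
  pose proof (Rmin_l d (e / (M + 1))). pose proof (Rmin_r d (e / (M + 1))).
  eapply Rle_lt_trans; [apply H; [exact HP | lra]|].
  pose proof (Cmod_ge_0 (z - z0)) as G. set (r := Cmod (z - z0)) in *.
  assert (r * (M + 1) < e)%R.
  { apply Rmult_lt_reg_r with (/ (M + 1))%R; [apply Rinv_0_lt_compat; lra|].
    replace (r * (M + 1) * / (M + 1))%R with r by (field; lra). unfold Rdiv in *. lra. }
  nra.
Qed.

Lemma lipschitz_at_mult (P : C -> Prop) (f g : C -> C) (z0 : C) :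
  lipschitz_at P f z0 -> lipschitz_at P g z0 -> lipschitz_at P (fun z => f z * g z) z0.
Proof.
  intros (M & d & HM & Hd & H) (N & d' & HN & Hd' & H').
  exists (M * (Cmod (g z0) + N * d') + Cmod (f z0) * N)%R, (Rmin d d').
  pose proof (Cmod_ge_0 (g z0)) as G0. pose proof (Cmod_ge_0 (f z0)) as F0.
  split; [|split; [now apply Rmin_pos|]].
  { apply Rplus_le_le_0_compat; apply Rmult_le_pos; try lra.
    apply Rplus_le_le_0_compat; [lra|]. apply Rmult_le_pos; lra. }
  intros z HP Hz. pose proof (Rmin_l d d'). pose proof (Rmin_r d d').
  specialize (H z HP ltac:(lra)). specialize (H' z HP ltac:(lra)).
  replace (f z * g z - f z0 * g z0) with ((f z - f z0) * g z + f z0 * (g z - g z0)) by ring.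
  eapply Rle_trans; [apply Cmod_triangle|]. rewrite !Cmod_mult.
  pose proof (Cmod_ge_0 (z - z0)). 
  assert (GZ : (Cmod (g z) <= Cmod (g z0) + N * d')%R).
  { replace (g z) with (g z0 + (g z - g z0)) by ring.
    eapply Rle_trans; [apply Cmod_triangle|]. nra. }
  pose proof (Cmod_ge_0 (f z - f z0)). pose proof (Cmod_ge_0 (g z)).
  assert (Cmod (f z - f z0) * Cmod (g z) <= M * Cmod (z - z0) * (Cmod (g z0) + N * d'))%R
    by (apply Rmult_le_compat; lra).
  apply (Rmult_le_compat_l _ _ _ F0) in H'. lra.
Qed.

Lemma lipschitz_at_Cexp (P : C -> Prop) (k z0 : C) : lipschitz_at P (fun z => Cexp (k * z)) z0.
Proof.
  pose proof (Cmod_ge_0 k) as K0. pose proof (Cmod_ge_0 (Cexp (k * z0))) as E0.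
  exists (Cmod (Cexp (k * z0)) * (11 * Cmod k))%R, (/ (2 * (Cmod k + 1)))%R.
  split; [|split].
  - apply Rmult_le_pos; lra.
  - apply Rinv_0_lt_compat. lra.
  - intros z _ Hz. set (h := z - z0) in *.
    assert (KH : (Cmod (k * h) <= 1 / 2)%R).
    { rewrite Cmod_mult. apply Rmult_le_reg_r with (2 * (Cmod k + 1))%R; [lra|].
      apply (Rmult_lt_compat_r (2 * (Cmod k + 1))) in Hz; [|lra].
      rewrite Rinv_l in Hz by lra. pose proof (Cmod_ge_0 h). nra. }
    pose proof (Cexp_quadratic _ KH) as Q.
    replace (k * z) with (k * z0 + k * h) by (unfold h; ring). rewrite Cexp_plus.
    replace (Cexp (k * z0) * Cexp (k * h) - Cexp (k * z0)) with
      (Cexp (k * z0) * ((Cexp (k * h) - 1 - k * h) + k * h)) by ring.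
    rewrite Cmod_mult, Rmult_assoc. apply Rmult_le_compat_l; [exact E0|].
    eapply Rle_trans; [apply Cmod_triangle|]. rewrite Rmult_assoc, <- (Cmod_mult k h).
    pose proof (Cmod_ge_0 (k * h)). simpl in Q. nra.
Qed.

Lemma lipschitz_at_disc_sum (c : nat -> C) (z0 : C) : decays c -> (0 <= Im z0)%R ->
  lipschitz_at (fun z => (0 <= Im z)%R) (fun z => disc_sum c (half_exp z)) z0.
Proof.
  intros Hc H0. destruct (disc_taylor c 1 Hc) as (M & HM & HT).
  destruct (lipschitz_at_Cexp (fun z => (0 <= Im z)%R) (Ci / 2) z0) as (N & d & HN & Hd & H).
  assert (E : forall z, half_exp z = Cexp (Ci / 2 * z)) by (intros z; unfold half_exp; f_equal; field).
  exists (M * N)%R, d. split; [now apply Rmult_le_pos|]. split; [exact Hd|].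
  intros z Hz Hzd. specialize (H z Hz Hzd). rewrite <- !E in H.
  specialize (HT (half_exp z0) (half_exp z - half_exp z0) (Cmod_half_exp_le_1 z0 H0)).
  replace (half_exp z0 + (half_exp z - half_exp z0)) with (half_exp z) in HT by ring.
  specialize (HT (Cmod_half_exp_le_1 z Hz)).
  replace (poly_eval (disc_coef c (half_exp z0)) (half_exp z - half_exp z0) 1)
    with (disc_sum c (half_exp z0)) in HT.
  - rewrite pow_1 in HT. eapply Rle_trans; [exact HT|].
    rewrite Rmult_assoc. now apply Rmult_le_compat_l.
  - simpl. replace (disc_coef c (half_exp z0) 0) with (disc_sum c (half_exp z0)); [ring|].
    unfold disc_sum, disc_coef, pow_coef. f_equal. apply functional_extensionality.
    intros m. rewrite binom_0_r, Nat.sub_0_r. simpl. ring.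
Qed.

Lemma half_exp_nz (z : C) : half_exp z <> 0.
Proof. apply Cexp_nz. Qed.

Lemma half_exp_sqr (z : C) : half_exp z ^ 2 = Cexp (Ci * z).
Proof. simpl. unfold half_exp. rewrite Cmult_1_r, <- Cexp_plus. f_equal. field. Qed.

(** The [j]-th derivative in [z] of [w^-2 sum_m c_m w^m], [w = exp (i z / 2)]. *)
Definition strip_coef (c : nat -> C) (j m : nat) : C := c m * (Ci * (INR m - 2) / 2) ^ j.

Definition strip_deriv (c : nat -> C) (j : nat) (z : C) : C :=
  Cexp (- Ci * z) * disc_sum (strip_coef c j) (half_exp z).

Lemma decays_strip_coef (c : nat -> C) (j : nat) : decays c -> decays (strip_coef c j).
Proof.
  apply (decays_poly c _ 1 j). intros m. unfold strip_coef.
  rewrite Cmod_mult, Cmod_pow, Rmult_1_l, Rmult_comm.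
  apply Rmult_le_compat_r; [apply Cmod_ge_0|]. apply pow_incr. split; [apply Cmod_ge_0|].
  replace (Ci * (INR m - 2) / 2) with (Ci * RtoC ((INR m - 2) / 2)).
  - rewrite Cmod_mult, Cmod_Ci, Cmod_R, Rmult_1_l. apply Rabs_le.
    pose proof (pos_INR m). lra.
  - rewrite RtoC_div, RtoC_minus by lra. unfold Cdiv. ring.
Qed.

Lemma binom_1_r (m : nat) : binom m 1 = m.
Proof. induction m as [|m IH]; [reflexivity|]. simpl. rewrite IH, binom_0_r. reflexivity. Qed.

(** The operator [w d/dw] multiplies the [m]-th coefficient by [m], and [d/dz] is [i / 2] times this
    operator for [w = exp (i z / 2)]; the term with [- 2] comes from the factor [w^(-2)]. *)
Lemma disc_sum_strip_coef_S (c : nat -> C) (j : nat) (w : C) : decays c -> (Cmod w <= 1)%R ->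
  disc_sum (strip_coef c (S j)) w =
  Ci / 2 * (w * disc_coef (strip_coef c j) w 1 - 2 * disc_sum (strip_coef c j) w).
Proof.
  intros Hc Hw. pose proof (decays_strip_coef c j Hc) as Hj.
  apply Cser_Csum.
  pose proof (Cser_scal (Ci / 2) _ _ (Cser_minus _ _ _ _
    (Cser_scal w _ _ (Cser_disc_coef _ w 1 Hj Hw))
    (Cser_scal 2 _ _ (Cser_disc_sum _ w Hj Hw)))) as Q.
  eapply Cser_ext; [|exact Q]. intros m. cbv beta. unfold strip_coef, pow_coef.
  rewrite binom_1_r. destruct m as [|m].
  - simpl. field.
  - replace (S m - 1)%nat with m by lia. rewrite !Cpow_S.
    set (u := (Ci * (INR (S m) - 2) / 2) ^ j). field.
Qed.

(** The chain and product rules use the module structure [AbsRing_NormedModule C_AbsRing], the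
    statement uses [C_NormedModule]; the two differ only in packaging. *)
Lemma is_Cderive_AbsRing (f : C -> C) (z l : C) :
  is_Cderive f z l <-> is_derive (V := AbsRing_NormedModule C_AbsRing) f z l.
Proof.
  split; intros [[A B D] E]; (split; [split; [exact A | exact B | exact D] | exact E]).
Qed.

Lemma is_Cderive_comp (f g : C -> C) (z df dg : C) :
  is_Cderive f (g z) df -> is_Cderive g z dg -> is_Cderive (fun x => f (g x)) z (dg * df).
Proof. rewrite (is_Cderive_AbsRing g). apply (is_derive_comp (V := C_NormedModule)). Qed.

Lemma is_Cderive_mult (f g : C -> C) (z df dg : C) :
  is_Cderive f z df -> is_Cderive g z dg ->
  is_Cderive (fun x => f x * g x) z (df * g z + f z * dg).
Proof.
  rewrite !is_Cderive_AbsRing. intros Hf Hg.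
  exact (is_derive_mult (K := C_AbsRing) f g z df dg Hf Hg Cmult_comm).
Qed.

Lemma is_Cderive_strip_deriv (c : nat -> C) (j : nat) (z : C) : decays c -> (0 < Im z)%R ->
  is_Cderive (strip_deriv c j) z (strip_deriv c (S j) z).
Proof.
  intros Hc Hz.
  pose proof (decays_strip_coef c j Hc) as Hj.
  pose proof (is_Cderive_comp Cexp (fun x => - Ci * x) z _ _
    (is_Cderive_Cexp _) (is_Cderive_linear (- Ci) z)) as D1.
  assert (D2 : is_Cderive half_exp z (Ci / 2 * half_exp z)).
  { pose proof (is_Cderive_comp Cexp (fun x => Ci / 2 * x) z _ _
      (is_Cderive_Cexp _) (is_Cderive_linear (Ci / 2) z)) as D.
    assert (E : forall x, Cexp (Ci / 2 * x) = half_exp x)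
      by (intros x; unfold half_exp; f_equal; field).
    rewrite E in D.
    exact (is_derive_ext (V := C_NormedModule) _ _ _ _ E D). }
  pose proof (is_Cderive_mult _ _ z _ _ D1 (is_Cderive_comp (disc_sum (strip_coef c j)) half_exp z _ _
    (is_Cderive_disc_sum _ _ Hj (Cmod_half_exp_lt_1 z Hz)) D2)) as D.
  match type of D with is_derive _ _ ?l => replace (strip_deriv c (S j) z) with (l : C); [exact D|] end.
  unfold strip_deriv.
  rewrite disc_sum_strip_coef_S by (auto using Cmod_half_exp_le_1, Rlt_le).
  field.
Qed.

(** The order is read off in the variable [z], where [strip_deriv] provides all derivatives up to
    the real line. If all of them vanished at [z0], so would the moments of [c_m w0^m] in powers of
    [m - 2], hence those in powers of [m]. *)
Lemma strip_zero_multiplicity (c : nat -> C) (F : C -> C) (z0 : C) : decays c -> c O <> 0 ->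
  (forall z, (0 <= Im z)%R -> half_exp z ^ 2 * F z = disc_sum c (half_exp z)) ->
  (0 <= Im z0)%R -> exists m, zero_multiplicity F z0 m.
Proof.
  intros Hc H0 HF Hz0.
  assert (Hw := Cmod_half_exp_le_1 z0 Hz0).
  assert (X : exists m, strip_deriv c m z0 <> 0).
  { apply NNPP. intros N.
    assert (Z : forall j, Cser (fun m => c m * half_exp z0 ^ m * (Ci * (INR m - 2) / 2) ^ j) 0).
    { intros j. pose proof (Cser_disc_sum _ _ (decays_strip_coef c j Hc) Hw) as Q.
      replace (disc_sum (strip_coef c j) (half_exp z0)) with (RtoC 0) in Q.
      - eapply Cser_ext; [|exact Q]. intros m. unfold strip_coef. ring.
      - symmetry. apply NNPP. intros M. apply N. exists j. now apply Cmult_neq_0; [apply Cexp_nz|]. }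
    assert (M : forall i j, Cser (fun m => c m * half_exp z0 ^ m * INR m ^ i *
        (Ci * (INR m - 2) / 2) ^ j) 0).
    { induction i as [|i IH]; intros j.
      - eapply Cser_ext; [|apply (Z j)]. intros m. simpl. ring.
      (* [m = 2 + (- 2 i) (i (m - 2) / 2)] raises the exponent of [m] by one. *)
      - pose proof (Cser_plus _ _ _ _ (Cser_scal 2 _ _ (IH j))
          (Cser_scal (- 2 * Ci) _ _ (IH (S j)))) as Q.
        rewrite !Cmult_0_r, Cplus_0_l in Q.
        eapply Cser_ext; [|exact Q]. intros m. cbv beta. simpl Cpow.
        set (u := (Ci * (INR m - 2) / 2) ^ j).
        replace (- 2 * Ci * (c m * half_exp z0 ^ m * INR m ^ i * (Ci * (INR m - 2) / 2 * u)))
          with (- (Ci * Ci) * (c m * half_exp z0 ^ m * INR m ^ i * ((INR m - 2) * u))) by field.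
        replace (Ci * Ci) with (- (1) : C) by (apply C_eq; simpl; ring). ring. }
    pose proof (moments_zero_C (fun m => c m * half_exp z0 ^ m) (decays_pow c _ Hw Hc)) as Q.
    simpl in Q. rewrite Cmult_1_r in Q. apply H0, Q. intros k.
    eapply Cser_ext; [|apply (M k O)]. intros m. simpl. ring. }
  destruct (least_nat _ X) as (m & Hm & Hl).
  exists m, (strip_deriv c). split; [|split; [|split; [|split]]].
  - intros z Hz. unfold strip_deriv.
    replace (strip_coef c 0) with c.
    + rewrite <- HF by exact Hz. rewrite half_exp_sqr.
      replace (- Ci * z) with (- (Ci * z)) by ring. rewrite Cexp_opp. field. apply Cexp_nz.
    + apply functional_extensionality. intros k. unfold strip_coef. simpl. ring.
  - intros j z _ Hz. now apply is_Cderive_strip_deriv.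
  - intros j _. apply lipschitz_at_filterlim.
    apply lipschitz_at_mult; [apply lipschitz_at_Cexp|].
    apply lipschitz_at_disc_sum; [now apply decays_strip_coef | exact Hz0].
  - intros j Hj. apply NNPP. now apply Hl.
  - exact Hm.
Qed.

(** * Infinite products *)

Lemma Cprod_n_cons (u : nat -> C) (N : nat) :
  Cprod_n u (S N) = u O * Cprod_n (fun k => u (S k)) N.
Proof.
  induction N as [|N IH]; [reflexivity|].
  change (Cprod_n u (S N) * u (S (S N)) = u O * (Cprod_n (fun k => u (S k)) N * u (S (S N)))).
  rewrite IH. ring.
Qed.

(** [|u_k| <= 1 + |1 - u_k| <= exp (t_k - t_(k+1))], and the exponents telescope. *)
Lemma Cprod_n_bound (u : nat -> C) (t : nat -> R) (N : nat) :
  (forall k, Cmod (1 - u k) <= t k - t (S k))%R -> (Cmod (Cprod_n u N) <= exp (t O - t (S N)))%R.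
Proof.
  intros H.
  assert (B : forall k, (Cmod (u k) <= exp (t k - t (S k)))%R).
  { intros k. replace (u k) with (1 + - (1 - u k)) by ring.
    eapply Rle_trans; [apply Cmod_triangle|]. rewrite Cmod_opp, Cmod_1.
    specialize (H k). destruct (Req_dec (t k - t (S k)) 0) as [E|E].
    - rewrite E in *. rewrite exp_0. lra.
    - left. eapply Rle_lt_trans; [|apply exp_ineq1, E]. lra. }
  induction N as [|N IH]; [apply B|].
  simpl Cprod_n. rewrite Cmod_mult.
  replace (t O - t (S (S N)))%R with ((t O - t (S N)) + (t (S N) - t (S (S N))))%R by ring.
  rewrite exp_plus. apply Rmult_le_compat; auto using Cmod_ge_0.
Qed.

Lemma Cprod_convergent (u : nat -> C) (t : nat -> R) :
  (forall k, 0 <= t k)%R -> (forall k, Cmod (1 - u k) <= t k - t (S k))%R ->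
  filterlim (Cprod_n u) eventually (locally (T := C_UniformSpace) (Cprod u)).
Proof.
  intros Ht H.
  (* Partial products are the partial sums of their increments, and each increment
     [P_k (u_(k+1) - 1)] is dominated by [exp (t 0)] times a telescoping difference. *)
  set (d := fun k => match k with O => u O | S k' => Cprod_n u (S k') - Cprod_n u k' end).
  assert (E : forall N, sum_n d N = Cprod_n u N).
  { induction N as [|N IH]; [now rewrite sum_O|].
    rewrite sum_Sn, IH. change (Cprod_n u N + (Cprod_n u (S N) - Cprod_n u N) = Cprod_n u (S N)). ring. }
  assert (X : Cser (fun k => d (S k)) (Csum (fun k => d (S k)))).
  { apply Cser_dom with (fun k => exp (t O) * (t (S k) - t (S (S k))))%R.
    - intros k. unfold d. simpl Cprod_n.
      replace (Cprod_n u k * u (S k) - Cprod_n u k) with (- (Cprod_n u k * (1 - u (S k)))) by ring.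
      rewrite Cmod_opp, Cmod_mult. apply Rmult_le_compat; auto using Cmod_ge_0.
      eapply Rle_trans; [now apply Cprod_n_bound with (t := t)|]. apply exp_le.
      specialize (Ht (S k)). lra.
    - apply ex_series_Rscal. apply (telescoping _ (fun k => t (S k))).
      + intros k. apply Ht.
      + intros k. specialize (H (S k)). pose proof (Cmod_ge_0 (1 - u (S k))). lra. }
  apply Cser_cons in X.
  assert (Y : filterlim (Cprod_n u) eventually
    (locally (T := C_UniformSpace) (d O + Csum (fun k => d (S k))))).
  { eapply filterlim_ext; [exact E | exact X]. }
  unfold Cprod. rewrite (Clim_seq_unique _ _ Y). exact Y.
Qed.

Lemma Cprod_cons (u : nat -> C) (t : nat -> R) :
  (forall k, 0 <= t k)%R -> (forall k, Cmod (1 - u k) <= t k - t (S k))%R ->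
  Cprod u = u O * Cprod (fun k => u (S k)).
Proof.
  intros Ht H. apply Clim_seq_unique.
  pose proof (Cprod_convergent (fun k => u (S k)) (fun k => t (S k))
    (fun k => Ht (S k)) (fun k => H (S k))) as X.
  assert (Y : filterlim (fun N => Cprod_n u (S N)) eventually
    (locally (T := C_UniformSpace) (u O * Cprod (fun k => u (S k))))).
  { eapply filterlim_ext; [intros N; symmetry; apply Cprod_n_cons|].
    eapply filterlim_comp; [exact X|].
    apply (filterlim_scal_r (V := C_NormedModule) (u O : C_AbsRing)). }
  apply filterlim_C_Re_Im in Y. apply filterlim_C_Re_Im.
  destruct Y as [Y1 Y2].
  split; [exact (proj2 (is_lim_seq_incr_1 (fun n => Re (Cprod_n u n)) _) Y1)
         |exact (proj2 (is_lim_seq_incr_1 (fun n => Im (Cprod_n u n)) _) Y2)].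
Qed.

Lemma Cprod_upper (u : nat -> C) (t : nat -> R) :
  (forall k, 0 <= t k)%R -> (forall k, Cmod (1 - u k) <= t k - t (S k))%R ->
  (Cmod (Cprod u) <= exp (t O))%R.
Proof.
  intros Ht H. apply (Cmod_lim_le (Cprod_n u)); [now apply Cprod_convergent with t|].
  intros n. eapply Rle_trans; [now apply Cprod_n_bound with (t := t)|].
  apply exp_le. specialize (Ht (S n)). lra.
Qed.

(** The lower bound is the upper bound for the product of the inverses. *)
Lemma Cprod_lower (u : nat -> C) (t s : nat -> R) :
  (forall k, 0 <= t k)%R -> (forall k, Cmod (1 - u k) <= t k - t (S k))%R ->
  (forall k, 0 <= s k)%R -> (forall k, Cmod (1 - / u k) <= s k - s (S k))%R ->
  (forall k, u k <> 0) -> (exp (- s O) <= Cmod (Cprod u))%R.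
Proof.
  intros Ht H Hs H' Hu.
  assert (I : forall N, Cprod_n u N * Cprod_n (fun k => / u k) N = 1).
  { induction N as [|N IH]; [simpl; now apply Cinv_r|].
    simpl. transitivity (Cprod_n u N * Cprod_n (fun k => / u k) N * (u (S N) * / u (S N))); [ring|].
    rewrite IH, Cinv_r by apply Hu. ring. }
  pose proof (is_lim_seq_Cmod _ _ (Cprod_convergent u t Ht H)) as L.
  apply (is_lim_seq_le (fun _ => exp (- s O)) (fun N => Cmod (Cprod_n u N))
    (exp (- s O)) (Cmod (Cprod u))); [|apply is_lim_seq_const | exact L].
  intros N. pose proof (Cprod_n_bound (fun k => / u k) s N H') as B.
  assert (B' : (Cmod (Cprod_n (fun k => / u k)%C N) <= exp (s O))%R).
  { eapply Rle_trans; [exact B|]. apply exp_le. specialize (Hs (S N)). lra. }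
  specialize (I N). apply (f_equal Cmod) in I. rewrite Cmod_mult, Cmod_1 in I.
  rewrite exp_Ropp. pose proof (exp_pos (s O)).
  pose proof (Cmod_ge_0 (Cprod_n u N)).
  apply Rmult_le_reg_r with (exp (s O)); [lra|]. rewrite Rinv_l by lra.
  rewrite <- I. now apply Rmult_le_compat_l.
Qed.

(** * Short-range coefficients *)

(** The hypothesis for [delta = 1/2], which larger exponents imply. It is stated on the whole line
    so that reflection preserves it. *)
Definition short_range (a v : Z -> C) : Prop :=
  (forall n, a n <> 0) /\
  exists M e, (0 < e)%R /\
    forall n, (Cmod (1 - a n) + Cmod (v n) <= M * wt e (IZR (Z.abs n)))%R.

Lemma exists_pos_lower_bound (f : nat -> R) (N : nat) : (forall k, 0 < f k)%R ->
  exists m, (0 < m)%R /\ forall k, (k < N)%nat -> (m <= f k)%R.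
Proof.
  intros Hf. induction N as [|N (m & Hm & IH)].
  - exists 1%R. split; [lra|]. intros; lia.
  - exists (Rmin m (f N)). split; [now apply Rmin_pos|]. intros k Hk.
    destruct (Nat.eq_dec k N) as [->|E]; [apply Rmin_r|].
    eapply Rle_trans; [apply Rmin_l | apply IH; lia].
Qed.

Lemma wt_eventually_small (c eta : R) : (0 < c)%R -> (0 < eta)%R ->
  exists N : nat, forall x, (INR N <= x)%R -> (wt c x <= eta)%R.
Proof.
  intros Hc He. pose proof (ex_series_lim_0 _ (ex_series_wt c Hc)) as L.
  apply is_lim_seq_spec in L. destruct (L (mkposreal _ He)) as [N HN].
  exists N. intros x Hx. specialize (HN N (Nat.le_refl N)). simpl in HN.
  rewrite Rminus_0_r, Rabs_pos_eq in HN by (left; apply wt_pos).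
  eapply Rle_trans; [|left; apply HN]. apply wt_le; lra.
Qed.

Lemma wt_abs_le (e : R) (n : Z) : (0 <= e)%R -> (-1 <= n)%Z ->
  (wt e (IZR (Z.abs n)) <= exp e * wt e (IZR n + 1))%R.
Proof.
  intros He Hn. assert (A : (0 <= IZR (Z.abs n))%R) by (apply IZR_le; lia).
  eapply Rle_trans; [apply (wt_shift e (IZR (Z.abs n)) 1); lra|].
  rewrite sqrt_1, Rmult_1_r. apply Rmult_le_compat_l; [left; apply exp_pos|].
  apply wt_le; [lra|]. apply Rplus_le_compat_r, IZR_le. lia.
Qed.

(** Starting at -1 includes [a (-1)], which occurs in [hcoef] at 0, and the index -1 of the
    reflected solution. The argument [n + 1] is then nonnegative, and the rate is written [2 e] to
    fit [wt_step]. *)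
Lemma short_range_right (a v : Z -> C) : short_range a v ->
  exists M e, (0 < e)%R /\ (0 <= M)%R /\ forall n, (-1 <= n)%Z ->
    (Cmod (1 - a n) <= M * wt (2 * e) (IZR n + 1) /\ Cmod (v n) <= M * wt (2 * e) (IZR n + 1))%R.
Proof.
  intros (Ha & M & e & He & H).
  assert (M0 : (0 <= M)%R).
  { specialize (H 0%Z). pose proof (Cmod_ge_0 (1 - a 0%Z)). pose proof (Cmod_ge_0 (v 0%Z)).
    pose proof (wt_pos e (IZR (Z.abs 0))). nra. }
  exists (M * exp e)%R, (e / 2)%R. split; [lra|]. split.
  { apply Rmult_le_pos; [exact M0 | left; apply exp_pos]. }
  intros n Hn. specialize (H n).
  pose proof (Rmult_le_compat_l M _ _ M0 (wt_abs_le e n ltac:(lra) Hn)).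
  replace (2 * (e / 2))%R with e by field. rewrite Rmult_assoc.
  pose proof (Cmod_ge_0 (1 - a n)). pose proof (Cmod_ge_0 (v n)). lra.
Qed.

(** Bounds uniform in [n] need [|a_n|] away from 0: far out [|1 - a_n| <= 1/2], and only finitely
    many nonzero values remain. Then [1 - 1 / a_n] decays like [1 - a_n], as the lower bound for
    products requires. *)
Lemma prod_ge_props (a v : Z -> C) : short_range a v ->
  exists lo hi, (0 < lo)%R /\ (0 < hi)%R /\ forall n, (-1 <= n)%Z ->
    (lo <= Cmod (prod_ge n a) <= hi)%R /\ prod_ge n a = a n * prod_ge (n + 1) a.
Proof.
  intros Hs. pose proof (proj1 Hs) as Ha.
  destruct (short_range_right a v Hs) as (M & e & He & HM & H).
  destruct (wt_step e He) as (k & Hk & HS).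
  assert (LB : exists m, (0 < m)%R /\ forall n, (-1 <= n)%Z -> (m <= Cmod (a n))%R).
  { destruct (wt_eventually_small (2 * e) (/ (2 * (M + 1)))) as [N HN];
      [lra | apply Rinv_0_lt_compat; lra|].
    destruct (exists_pos_lower_bound (fun k => Cmod (a (Z.of_nat k - 1)%Z)) N) as (m & Hm & HB).
    { intros j. now apply Cmod_gt_0. }
    exists (Rmin m (1 / 2)). split; [apply Rmin_pos; lra|]. intros n Hn.
    destruct (Z_lt_le_dec (n + 1) (Z.of_nat N)) as [L|L].
    - eapply Rle_trans; [apply Rmin_l|].
      specialize (HB (Z.to_nat (n + 1)) ltac:(lia)). rewrite Z2Nat.id in HB by lia.
      now replace (n + 1 - 1)%Z with n in HB by lia.
    - eapply Rle_trans; [apply Rmin_r|].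
      assert (X : (INR N <= IZR n + 1)%R).
      { rewrite <- plus_IZR, INR_IZR_INZ. now apply IZR_le. }
      specialize (HN _ X). destruct (H n Hn) as [H1 _].
      apply (Rmult_le_compat_l M) in HN; [|exact HM].
      assert (Y : (M * / (2 * (M + 1)) <= 1 / 2)%R).
      { apply Rmult_le_reg_r with (2 * (M + 1))%R; [lra|].
        rewrite Rmult_assoc, Rinv_l by lra. lra. }
      pose proof (Cmod_triangle (1 - a n) (a n)) as T.
      replace (1 - a n + a n) with (RtoC 1) in T by ring. rewrite Cmod_1 in T. lra. }
  destruct LB as (m & Hm & HB).
  set (t := fun c n i => (c * wt e (IZR n + INR i + 1))%R).
  assert (St : forall c n i, (0 <= c)%R -> (-1 <= n)%Z ->
     (c * k * wt (2 * e) (IZR (n + Z.of_nat i) + 1) <= t c n i - t c n (S i))%R).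
  { intros c n i Hc Hn. unfold t. rewrite S_INR, plus_IZR, <- INR_IZR_INZ.
    apply IZR_le in Hn. pose proof (pos_INR i).
    specialize (HS (IZR n + INR i + 1)%R ltac:(lra)).
    replace (IZR n + (INR i + 1) + 1)%R with (IZR n + INR i + 1 + 1)%R by ring.
    rewrite Rmult_assoc, <- Rmult_minus_distr_l. now apply Rmult_le_compat_l. }
  assert (T0 : forall c n i, (0 <= c)%R -> (0 <= t c n i)%R).
  { intros c n i Hc. apply Rmult_le_pos; [exact Hc | left; apply wt_pos]. }
  assert (Tb : forall c n, (0 <= c)%R -> (t c n 0%nat <= c)%R).
  { intros c n Hc. unfold t. rewrite <- (Rmult_1_r c) at 2. apply Rmult_le_compat_l; [exact Hc|].
    apply wt_le_1. lra. }
  (* Chosen so that [c1 k = M] and [c2 k = M / m], the constants in the bounds for [1 - a_n] and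
     [1 - 1 / a_n]. *)
  set (c1 := (M / k)%R). set (c2 := (M / m / k)%R).
  assert (C1 : (0 <= c1)%R) by (apply Rmult_le_pos; [lra | left; now apply Rinv_0_lt_compat]).
  assert (C2 : (0 <= c2)%R).
  { apply Rmult_le_pos; [|left; now apply Rinv_0_lt_compat].
    apply Rmult_le_pos; [lra | left; now apply Rinv_0_lt_compat]. }
  assert (U1 : forall n i, (-1 <= n)%Z ->
     (Cmod (1 - a (n + Z.of_nat i)%Z) <= t c1 n i - t c1 n (S i))%R).
  { intros n i Hn. eapply Rle_trans; [apply H; lia|]. eapply Rle_trans; [|now apply St].
    right. unfold c1. field. lra. }
  assert (U2 : forall n i, (-1 <= n)%Z ->
     (Cmod (1 - / a (n + Z.of_nat i)%Z) <= t c2 n i - t c2 n (S i))%R).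
  { intros n i Hn. set (r := (n + Z.of_nat i)%Z).
    replace (1 - / a r) with (- ((1 - a r) / a r)) by (field; apply Ha).
    rewrite Cmod_opp, Cmod_div by apply Ha.
    eapply Rle_trans; [|now apply St].
    pose proof (HB r ltac:(lia)) as B. destruct (H r ltac:(lia)) as [H1 _].
    replace (c2 * k * wt (2 * e) (IZR (n + Z.of_nat i) + 1))%R with
      (M * wt (2 * e) (IZR r + 1) * / m)%R by (unfold c2, r; field; lra).
    apply Rmult_le_compat; [apply Cmod_ge_0 | left; apply Rinv_0_lt_compat; lra | exact H1|].
    apply Rinv_le_contravar; lra. }
  exists (exp (- c2)), (exp c1). split; [apply exp_pos|]. split; [apply exp_pos|].
  intros n Hn. split; [split|].
  - eapply Rle_trans; [|apply (Cprod_lower _ (t c1 n) (t c2 n)); auto].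
    apply exp_le. specialize (Tb c2 n C2). lra.
  - eapply Rle_trans; [apply (Cprod_upper _ (t c1 n)); auto|]. now apply exp_le, Tb.
  - unfold prod_ge. rewrite (Cprod_cons _ (t c1 n)) by auto.
    rewrite Z.add_0_r. do 2 f_equal. apply functional_extensionality. intros i. f_equal. lia.
Qed.

(** * Decay of the Jost kernels *)

Lemma sum_ge_bound (u : Z -> C) (t : Z -> R) (n : Z) :
  (forall r, (n <= r)%Z -> 0 <= t r)%R ->
  (forall r, (n + 1 <= r)%Z -> Cmod (u r) <= t (r - 1)%Z - t r)%R ->
  Cser (fun k => u (n + 1 + Z.of_nat k)%Z) (sum_ge (n + 1) u) /\ (Cmod (sum_ge (n + 1) u) <= t n)%R.
Proof.
  intros Ht Hu.
  set (b := fun k => (t (n + Z.of_nat k)%Z - t (n + Z.of_nat (S k))%Z)%R).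
  assert (B : forall k, (Cmod (u (n + 1 + Z.of_nat k)%Z) <= b k)%R).
  { intros k. unfold b. eapply Rle_trans; [apply Hu; lia|].
    replace (n + 1 + Z.of_nat k - 1)%Z with (n + Z.of_nat k)%Z by lia.
    replace (n + Z.of_nat (S k))%Z with (n + 1 + Z.of_nat k)%Z by lia. apply Rle_refl. }
  destruct (telescoping b (fun k => t (n + Z.of_nat k)%Z)) as [E1 E2].
  { intros k. apply Ht. lia. }
  { intros k. split; [eapply Rle_trans; [apply Cmod_ge_0 | apply B]|]. unfold b. lra. }
  pose proof (Cser_dom _ _ B E1) as S. split; [exact S|].
  apply Rle_trans with (Series b).
  - apply (Cser_bound _ _ b _ S B). now apply Series_correct.
  - rewrite Z.add_0_r in E2. exact E2.
Qed.

Lemma sum_ge_cons (u : Z -> C) (n : Z) :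
  Cser (fun k => u (n + 1 + Z.of_nat k)%Z) (sum_ge (n + 1) u) ->
  sum_ge n u = u n + sum_ge (n + 1) u.
Proof.
  intros H. apply Cser_Csum.
  replace (u n) with (u (n + Z.of_nat 0)%Z) by (f_equal; lia).
  apply (Cser_cons (fun k => u (n + Z.of_nat k)%Z)).
  eapply Cser_ext; [|exact H]. intros k. cbv beta. f_equal. lia.
Qed.

Lemma Kplus_S4 (a p q : Z -> C) (k : nat) (n : Z) :
  Kplus a p q (S (S (S (S (S k))))) n =
  Kplus a p q (S k) (n + 1)%Z
  + sum_ge (n + 1) (fun r =>
      (1 - a r ^ 2) * Kplus a p q (S k) (r + 1)%Z
      + hcoef a q r * Kplus a p q (S (S (S k))) r
      + 2 * p r * (Kplus a p q (S (S k)) r + Kplus a p q (S (S (S (S k)))) r)).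
Proof. reflexivity. Qed.

(** The weight 4 on [p] combines the factor in [2 p] with another 2, since it multiplies a sum of
    two kernels. *)
Definition pencil_size (a p q : Z -> C) (r : Z) : R :=
  (Cmod (1 - a r ^ 2) + Cmod (hcoef a q r) + 4 * Cmod (p r))%R.

Lemma pencil_term_bound (a p q : Z -> C) (r : Z) (A B D : C) (X : R) :
  (0 <= X)%R -> (Cmod A <= X)%R -> (Cmod B <= X)%R -> (Cmod D <= 2 * X)%R ->
  (Cmod ((1 - a r ^ 2) * A + hcoef a q r * B + 2 * p r * D) <= pencil_size a p q r * X)%R.
Proof.
  intros HX HA HB HD. unfold pencil_size.
  eapply Rle_trans; [apply Cmod_triangle|].
  eapply Rle_trans; [apply Rplus_le_compat_r, Cmod_triangle|]. rewrite !Cmod_mult.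
  replace (Cmod 2) with 2%R by (rewrite Cmod_R, Rabs_pos_eq; lra).
  pose proof (Cmod_ge_0 (1 - a r ^ 2)). pose proof (Cmod_ge_0 (hcoef a q r)).
  pose proof (Cmod_ge_0 (p r)). nra.
Qed.

(** In the application [T n] bounds [sum_{r > n}] of the coefficients and
    [U n] bounds [sum_{r >= n} T r]. *)
Lemma Kplus_bound_abstract (a p q : Z -> C) (T U : Z -> R) :
  (forall n, (-1 <= n)%Z -> 0 <= T n)%R ->
  (forall n, (-1 <= n)%Z -> 0 <= U n)%R ->
  (forall n, (-1 <= n)%Z -> T n <= U n - U (n + 1)%Z)%R ->
  (forall r, (0 <= r)%Z -> pencil_size a p q r <= T (r - 1)%Z - T r)%R ->
  forall k n, (-1 <= n)%Z ->
    (Cmod (Kplus a p q (S k) n) <= exp (U n) * T (n + Z.of_nat (k / 4))%Z)%R.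
Proof.
  intros T0 U0 TU HT.
  assert (rho0 : forall r, (0 <= pencil_size a p q r)%R).
  { intros r. unfold pencil_size. pose proof (Cmod_ge_0 (1 - a r ^ 2)).
    pose proof (Cmod_ge_0 (hcoef a q r)). pose proof (Cmod_ge_0 (p r)). lra. }
  assert (Tmono : forall n m, (-1 <= n <= m)%Z -> (T m <= T n)%R).
  { intros n m [Hn Hm].
    assert (G : forall j : nat, (T (n + Z.of_nat j)%Z <= T n)%R).
    { induction j as [|j IH]; [rewrite Z.add_0_r; lra|].
      specialize (HT (n + Z.of_nat (S j))%Z ltac:(lia)).
      specialize (rho0 (n + Z.of_nat (S j))%Z).
      replace (n + Z.of_nat (S j) - 1)%Z with (n + Z.of_nat j)%Z in HT by lia. lra. }
    specialize (G (Z.to_nat (m - n))). rewrite Z2Nat.id in G by lia.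
    now replace (n + (m - n))%Z with m in G by lia. }
  assert (Umono : forall n m, (-1 <= n <= m)%Z -> (U m <= U n)%R).
  { intros n m [Hn Hm].
    assert (G : forall j : nat, (U (n + Z.of_nat j)%Z <= U n)%R).
    { induction j as [|j IH]; [rewrite Z.add_0_r; lra|].
      specialize (TU (n + Z.of_nat j)%Z ltac:(lia)). specialize (T0 (n + Z.of_nat j)%Z ltac:(lia)).
      replace (n + Z.of_nat j + 1)%Z with (n + Z.of_nat (S j))%Z in TU by lia. lra. }
    specialize (G (Z.to_nat (m - n))). rewrite Z2Nat.id in G by lia.
    now replace (n + (m - n))%Z with m in G by lia. }
  assert (E1 : forall n, (-1 <= n)%Z -> (1 <= exp (U n))%R).
  { intros n Hn. rewrite <- exp_0. now apply exp_le, U0. }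
  assert (EE : forall n, (-1 <= n)%Z -> (exp (U (n + 1)%Z) * (1 + T n) <= exp (U n))%R).
  { intros n Hn. replace (U n) with (U (n + 1)%Z + (U n - U (n + 1)%Z))%R by ring.
    rewrite exp_plus. apply Rmult_le_compat_l; [left; apply exp_pos|].
    specialize (TU n Hn). destruct (Req_dec (U n - U (n + 1)%Z) 0) as [E|E].
    - rewrite E in *. rewrite exp_0. lra.
    - left. eapply Rle_lt_trans; [|apply exp_ineq1, E]. lra. }
  assert (SUM : forall n u X, (-1 <= n)%Z -> (0 <= X)%R ->
     (forall r, (n + 1 <= r)%Z -> Cmod (u r) <= pencil_size a p q r * X)%R ->
     (Cmod (sum_ge (n + 1) u) <= X * T n)%R).
  { intros n u X Hn HX Hu. apply (sum_ge_bound u (fun r => X * T r)%R).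
    - intros r Hr. apply Rmult_le_pos; [exact HX | apply T0; lia].
    - intros r Hr. eapply Rle_trans; [now apply Hu|].
      specialize (HT r ltac:(lia)). rewrite <- Rmult_minus_distr_l, Rmult_comm.
      now apply Rmult_le_compat_l. }
  (* the prefactor [exp (U n)] absorbs one factor [1 + T n] per recursion step *)
  assert (ETM : forall n m r x : Z, (-1 <= n)%Z -> (n + 1 <= r)%Z -> (-1 <= x <= m)%Z ->
     (exp (U r) * T m <= exp (U (n + 1)%Z) * T x)%R).
  { intros n m r x Hn Hr Hm. apply Rmult_le_compat; [left; apply exp_pos | apply T0; lia | |].
    - apply exp_le, Umono. lia.
    - apply Tmono. lia. }
  set (Q := fun k => forall n, (-1 <= n)%Z ->
    (Cmod (Kplus a p q (S k) n) <= exp (U n) * T (n + Z.of_nat (k / 4))%Z)%R).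
  assert (small : forall k, (k < 4)%nat -> (k / 4 = 0)%nat) by (intros; now apply Nat.div_small).
  (* The [1] stands for the inhomogeneous terms of the kernels of index 2 to 4. Since
     [exp (U (n + 1)) >= 1], it is absorbed by the same factor [1 + T n] as in the general step. *)
  assert (BASE : forall n u, (-1 <= n)%Z ->
     (forall r, (n + 1 <= r)%Z ->
        Cmod (u r) <= pencil_size a p q r * (1 + exp (U (n + 1)%Z) * T n))%R ->
     (Cmod (sum_ge (n + 1) u) <= exp (U n) * T (n + 0)%Z)%R).
  { intros n u Hn Hu. rewrite Z.add_0_r. pose proof (T0 n Hn). pose proof (E1 (n + 1)%Z ltac:(lia)).
    eapply Rle_trans; [apply SUM; [exact Hn | | exact Hu]|].
    - apply Rplus_le_le_0_compat; [lra|]. apply Rmult_le_pos; lra.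
    - apply Rmult_le_compat_r; [assumption|]. specialize (EE n Hn). lra. }
  assert (Q0 : Q 0%nat).
  { intros n Hn. simpl. rewrite Cmod_mult.
    replace (Cmod 2) with 2%R by (rewrite Cmod_R, Rabs_pos_eq; lra).
    rewrite Z.add_0_r. pose proof (T0 n Hn). pose proof (E1 n Hn).
    assert (Cmod (sum_ge (n + 1) p) <= (1 / 2) * T n)%R.
    { apply SUM; [exact Hn | lra|]. intros r Hr. unfold pencil_size.
      pose proof (Cmod_ge_0 (1 - a r ^ 2)). pose proof (Cmod_ge_0 (hcoef a q r)).
      pose proof (Cmod_ge_0 (p r)). lra. }
    nra. }
  assert (IN : forall k n r, (k < 4)%nat -> Q k -> (-1 <= n)%Z -> (n + 1 <= r)%Z ->
     (Cmod (Kplus a p q (S k) r) <= exp (U (n + 1)%Z) * T n)%R).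
  { intros k n r Hk HQ Hn Hr. eapply Rle_trans; [apply HQ; lia|].
    rewrite small by exact Hk. apply ETM; lia. }
  assert (Q1 : Q 1%nat).
  { intros n Hn. apply BASE; [exact Hn|]. intros r Hr.
    pose proof (IN 0%nat n r ltac:(lia) Q0 Hn Hr). pose proof (Cmod_ge_0 (Kplus a p q 1 r)).
    change (Cmod (hcoef a q r + 2 * p r * Kplus a p q 1 r) <=
      pencil_size a p q r * (1 + exp (U (n + 1)%Z) * T n))%R.
    replace (hcoef a q r + 2 * p r * Kplus a p q 1 r) with
      ((1 - a r ^ 2) * 0 + hcoef a q r * 1 + 2 * p r * Kplus a p q 1 r) by ring.
    apply pencil_term_bound; rewrite ?Cmod_0, ?Cmod_1; lra. }
  assert (Q2 : Q 2%nat).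
  { intros n Hn. apply BASE; [exact Hn|]. intros r Hr.
    pose proof (IN 0%nat n r ltac:(lia) Q0 Hn Hr). pose proof (Cmod_ge_0 (Kplus a p q 1 r)).
    pose proof (IN 1%nat n r ltac:(lia) Q1 Hn Hr).
    change (Cmod (hcoef a q r * Kplus a p q 1 r + 2 * p r * (Kplus a p q 2 r + 1)) <=
      pencil_size a p q r * (1 + exp (U (n + 1)%Z) * T n))%R.
    replace (hcoef a q r * Kplus a p q 1 r + 2 * p r * (Kplus a p q 2 r + 1)) with
      ((1 - a r ^ 2) * 0 + hcoef a q r * Kplus a p q 1 r + 2 * p r * (Kplus a p q 2 r + 1)) by ring.
    pose proof (Cmod_triangle (Kplus a p q 2 r) 1) as TR. rewrite Cmod_1 in TR.
    apply pencil_term_bound; rewrite ?Cmod_0, ?Cmod_1; lra. }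
  assert (Q3 : Q 3%nat).
  { intros n Hn. apply BASE; [exact Hn|]. intros r Hr.
    pose proof (IN 0%nat n r ltac:(lia) Q0 Hn Hr). pose proof (Cmod_ge_0 (Kplus a p q 1 r)).
    pose proof (IN 1%nat n r ltac:(lia) Q1 Hn Hr). pose proof (IN 2%nat n r ltac:(lia) Q2 Hn Hr).
    pose proof (Cmod_triangle (Kplus a p q 3 r) (Kplus a p q 1 r)) as TR.
    change (Cmod (1 - a r ^ 2 + hcoef a q r * Kplus a p q 2 r
        + 2 * p r * (Kplus a p q 3 r + Kplus a p q 1 r)) <=
      pencil_size a p q r * (1 + exp (U (n + 1)%Z) * T n))%R.
    rewrite <- (Cmult_1_r (1 - a r ^ 2)).
    apply pencil_term_bound; rewrite ?Cmod_0, ?Cmod_1; lra. }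
  (* Four consecutive levels, as the recursion for [m + 4] refers to the levels [m] to [m + 3]. *)
  assert (ALL : forall k, Q k /\ Q (S k) /\ Q (S (S k)) /\ Q (S (S (S k)))).
  { induction k as [|k (I0 & I1 & I2 & I3)]; [auto|].
    repeat split; auto. intros n Hn. rewrite Kplus_S4.
    replace (S (S (S (S k))) / 4)%nat with (S (k / 4))%nat.
    2: { replace (S (S (S (S k)))) with (1 * 4 + k)%nat by lia. now rewrite Nat.div_add_l by lia. }
    (* A kernel at level index [j >= k] and position [r >= n + 1] has [r + j / 4 >= x]: the advance
       in position makes up for the unit lost in the quotient by 4. *)
    set (x := (n + Z.of_nat (S (k / 4)))%Z).
    set (Y := (exp (U (n + 1)%Z) * T x)%R).
    assert (Hx : (n + 1 <= x)%Z) by (unfold x; lia).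
    assert (Y0 : (0 <= Y)%R) by (apply Rmult_le_pos; [left; apply exp_pos | apply T0; lia]).
    assert (INY : forall j r, Q j -> (k <= j)%nat -> (n + 1 <= r)%Z ->
       (Cmod (Kplus a p q (S j) r) <= Y)%R).
    { intros j r HQ Hj Hr. eapply Rle_trans; [apply HQ; lia|]. apply ETM; [lia | lia|].
      pose proof (Nat.Div0.div_le_mono k j 4 Hj). unfold x. lia. }
    eapply Rle_trans; [apply Cmod_triangle|].
    apply Rle_trans with (Y + Y * T n)%R.
    - apply Rplus_le_compat.
      + apply INY; auto; lia.
      + apply SUM; [exact Hn | exact Y0|]. intros r Hr.
        pose proof (INY k (r + 1)%Z I0 ltac:(lia) ltac:(lia)).
        pose proof (INY _ r I1 ltac:(lia) Hr). pose proof (INY _ r I2 ltac:(lia) Hr).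
        pose proof (INY _ r I3 ltac:(lia) Hr).
        pose proof (Cmod_triangle (Kplus a p q (S (S k)) r) (Kplus a p q (S (S (S (S k)))) r)).
        apply pencil_term_bound; lra.
    - unfold Y. replace (exp (U (n + 1)%Z) * T x + exp (U (n + 1)%Z) * T x * T n)%R with
        ((exp (U (n + 1)%Z) * (1 + T n)) * T x)%R by ring.
      apply Rmult_le_compat_r; [apply T0; lia | now apply EE]. }
  intros k. apply (ALL k).
Qed.

(** The rates are [4 e] for the coefficients, [2 e] for their tail sums and [e] for the tail sums of
    these, since [wt_step] halves the rate at each summation. With [j] the integer part of [k / 4],
    [wt (2 e) (n + 1 + j)] splits into a factor in [n] and one in [j], and
    [sqrt (k + 1) <= 2 sqrt j + 2] turns the latter into rate [e / 2] in [k]. *)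
Lemma Kplus_bound (a p q : Z -> C) (M e : R) : (0 < e)%R ->
  (forall r, (0 <= r)%Z -> pencil_size a p q r <= M * wt (4 * e) (IZR r))%R ->
  exists A, (0 <= A)%R /\ forall n k, (-1 <= n)%Z ->
    (Cmod (Kplus a p q (S k) n) <= A * wt e (IZR n + 1) * wt (e / 2) (INR (S k)))%R.
Proof.
  intros He HM.
  destruct (wt_step (2 * e) ltac:(lra)) as (k1 & Hk1 & S1).
  destruct (wt_step e He) as (k2 & Hk2 & S2).
  assert (M0 : (0 <= M)%R).
  { specialize (HM 0%Z (Z.le_refl 0)). pose proof (wt_pos (4 * e) 0).
    unfold pencil_size in HM. pose proof (Cmod_ge_0 (1 - a 0%Z ^ 2)).
    pose proof (Cmod_ge_0 (hcoef a q 0%Z)). pose proof (Cmod_ge_0 (p 0%Z)). nra. }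
  set (B := (M / k1)%R). set (B' := (B / k2)%R).
  assert (B0 : (0 <= B)%R) by (apply Rmult_le_pos; [lra | left; now apply Rinv_0_lt_compat]).
  assert (B0' : (0 <= B')%R) by (apply Rmult_le_pos; [lra | left; now apply Rinv_0_lt_compat]).
  pose proof (Kplus_bound_abstract a p q (fun n => B * wt (2 * e) (IZR n + 1))%R
    (fun n => B' * wt e (IZR n + 1))%R) as KB.
  exists (exp B' * (B * exp e))%R. split.
  { apply Rmult_le_pos; [left; apply exp_pos|]. apply Rmult_le_pos; [exact B0 | left; apply exp_pos]. }
  intros n k Hn.
  assert (Hn' : (0 <= IZR n + 1)%R) by (apply IZR_le in Hn; lra).
  eapply Rle_trans; [apply KB; [| | | | exact Hn]|]; clear KB.
  - intros m _. apply Rmult_le_pos; [exact B0 | left; apply wt_pos].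
  - intros m _. apply Rmult_le_pos; [exact B0' | left; apply wt_pos].
  - intros m Hm. apply IZR_le in Hm. rewrite plus_IZR.
    specialize (S2 (IZR m + 1)%R ltac:(lra)). rewrite <- Rmult_minus_distr_l.
    replace B with (B' * k2)%R by (unfold B'; field; lra).
    rewrite Rmult_assoc. now apply Rmult_le_compat_l.
  - intros r Hr. eapply Rle_trans; [now apply HM|]. apply IZR_le in Hr. rewrite minus_IZR.
    replace (IZR r - 1 + 1)%R with (IZR r) by ring.
    specialize (S1 (IZR r) Hr). replace (2 * (2 * e))%R with (4 * e)%R in S1 by ring.
    rewrite <- Rmult_minus_distr_l. replace M with (B * k1)%R by (unfold B; field; lra).
    rewrite Rmult_assoc. now apply Rmult_le_compat_l.
  - rewrite plus_IZR, <- INR_IZR_INZ.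
    set (j := (k / 4)%nat). pose proof (pos_INR j) as Hj.
    replace (IZR n + INR j + 1)%R with (IZR n + 1 + INR j)%R by ring.
    pose proof (wt_split e _ _ ltac:(lra) Hn' Hj) as W1.
    assert (W2 : (wt e (INR j) <= exp e * wt (e / 2) (INR (S k)))%R).
    { unfold wt. rewrite <- exp_plus. apply exp_le.
      assert (SQ : (sqrt (INR (S k)) <= 2 * sqrt (INR j) + 2)%R).
      { apply Rle_trans with (sqrt (4 * INR j + 4)).
        - apply sqrt_le_1_alt.
          replace (4 * INR j + 4)%R with (INR (4 * j + 4)) by (rewrite plus_INR, mult_INR; simpl; ring).
          apply le_INR. unfold j. pose proof (Nat.div_mod_eq k 4).
          pose proof (Nat.mod_upper_bound k 4 ltac:(lia)). lia.
        - eapply Rle_trans; [apply sqrt_plus_le; lra|].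
          rewrite sqrt_mult by lra. replace 4%R with (2 * 2)%R by ring.
          rewrite sqrt_square by lra. lra. }
      apply (Rmult_le_compat_l (e / 2)) in SQ; lra. }
    assert (W3 : (wt e (IZR n + 1) <= 1)%R) by (apply wt_le_1; lra).
    pose proof (wt_pos e (IZR n + 1)) as W4. pose proof (wt_pos e (INR j)) as W5.
    assert (X1 : (exp (B' * wt e (IZR n + 1)) <= exp B')%R) by (apply exp_le; nra).
    rewrite !Rmult_assoc. apply Rmult_le_compat; [left; apply exp_pos | | exact X1|].
    { apply Rmult_le_pos; [exact B0 | left; apply wt_pos]. }
    apply Rmult_le_compat_l; [exact B0|].
    eapply Rle_trans; [exact W1|].
    replace (exp e * (wt e (IZR n + 1) * wt (e / 2) (INR (S k))))%R with
      (wt e (IZR n + 1) * (exp e * wt (e / 2) (INR (S k))))%R by ring.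
    apply Rmult_le_compat_l; lra.
Qed.

Definition pencil_decays (a p q : Z -> C) : Prop :=
  exists M e, (0 < e)%R /\
    forall r, (0 <= r)%Z -> (pencil_size a p q r <= M * wt (4 * e) (IZR r))%R.

Lemma short_range_pencil_decays (a v : Z -> C) : short_range a v ->
  pencil_decays a (fun n => - v n) (fun n => v n ^ 2).
Proof.
  intros Hs. destruct (short_range_right a v Hs) as (M & e & He & HM & H).
  exists (M * (8 + 2 * M))%R, (e / 2)%R. split; [lra|]. intros r Hr.
  replace (4 * (e / 2))%R with (2 * e)%R by field.
  destruct (H r ltac:(lia)) as [A1 V1]. destruct (H (r - 1)%Z ltac:(lia)) as [A2 _].
  rewrite minus_IZR in A2. replace (IZR r - 1 + 1)%R with (IZR r) in A2 by ring.
  assert (W : (wt (2 * e) (IZR r + 1) <= wt (2 * e) (IZR r))%R) by (apply wt_le; lra).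
  pose proof (wt_le_1 (2 * e) (IZR r) ltac:(lra)) as W1.
  pose proof (wt_pos (2 * e) (IZR r)) as W0.
  set (w := wt (2 * e) (IZR r)) in *.
  assert (A1' : (Cmod (1 - a r) <= M * w)%R) by nra.
  assert (V1' : (Cmod (v r) <= M * w)%R) by nra.
  assert (Mw : (M * w <= M)%R) by nra.
  pose proof (Cmod_ge_0 (1 - a r)). pose proof (Cmod_ge_0 (v r)).
  unfold pencil_size. rewrite Cmod_opp.
  assert (B1 : (Cmod (1 - a r ^ 2) <= M * w * (2 + M))%R).
  { replace (1 - a r ^ 2) with ((1 - a r) * (2 - (1 - a r))) by ring.
    rewrite Cmod_mult. apply Rmult_le_compat; auto using Cmod_ge_0.
    unfold Cminus at 1. eapply Rle_trans; [apply Cmod_triangle|].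
    rewrite Cmod_opp, Cmod_R, Rabs_pos_eq; lra. }
  assert (B2 : (Cmod (hcoef a (fun n => v n ^ 2)%C r) <= M * w * (2 + M))%R).
  { unfold hcoef.
    replace (2 - a r - a (r - 1)%Z + v r ^ 2) with ((1 - a r) + (1 - a (r - 1)%Z) + v r ^ 2) by ring.
    eapply Rle_trans; [apply Cmod_triangle|].
    eapply Rle_trans; [apply Rplus_le_compat_r, Cmod_triangle|]. rewrite Cmod_pow. simpl.
    assert (Cmod (v r) * (Cmod (v r) * 1) <= M * w * M)%R by (apply Rmult_le_compat; lra). lra. }
  lra.
Qed.

Lemma pencil_sum_Cser (a p q : Z -> C) (u : Z -> C) (X : R) (n : Z) : pencil_decays a p q ->
  (-1 <= n)%Z -> (forall r, (n + 1 <= r)%Z -> Cmod (u r) <= pencil_size a p q r * X)%R ->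
  Cser (fun k => u (n + 1 + Z.of_nat k)%Z) (sum_ge (n + 1) u).
Proof.
  intros (M & e & He & HM) Hn Hu.
  destruct (wt_step (2 * e) ltac:(lra)) as (k & Hk & HS).
  apply (sum_ge_bound u (fun r => Rabs M * Rabs X / k * wt (2 * e) (IZR r + 1))%R).
  - intros r _. apply Rmult_le_pos; [|left; apply wt_pos].
    apply Rmult_le_pos; [apply Rmult_le_pos; apply Rabs_pos | left; now apply Rinv_0_lt_compat].
  - intros r Hr. eapply Rle_trans; [now apply Hu|].
    specialize (HM r ltac:(lia)).
    assert (R0 : (0 <= IZR r)%R) by (apply IZR_le; lia).
    specialize (HS (IZR r) R0). rewrite minus_IZR. replace (IZR r - 1 + 1)%R with (IZR r) by ring.
    replace (2 * (2 * e))%R with (4 * e)%R in HS by ring.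
    rewrite <- Rmult_minus_distr_l.
    apply Rle_trans with (Rabs M * Rabs X / k * (k * wt (4 * e) (IZR r)))%R.
    + replace (Rabs M * Rabs X / k * (k * wt (4 * e) (IZR r)))%R with
        ((Rabs M * wt (4 * e) (IZR r)) * Rabs X)%R by (field; lra).
      assert (S0 : (0 <= pencil_size a p q r)%R).
      { unfold pencil_size. pose proof (Cmod_ge_0 (1 - a r ^ 2)).
        pose proof (Cmod_ge_0 (hcoef a q r)). pose proof (Cmod_ge_0 (p r)). lra. }
      apply Rle_trans with (pencil_size a p q r * Rabs X)%R.
      * apply Rmult_le_compat_l; [exact S0 | apply Rle_abs].
      * apply Rmult_le_compat_r; [apply Rabs_pos|]. eapply Rle_trans; [exact HM|].
        apply Rmult_le_compat_r; [left; apply wt_pos | apply Rle_abs].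
    + apply Rmult_le_compat_l; [|exact HS].
      apply Rmult_le_pos; [apply Rmult_le_pos; apply Rabs_pos | left; now apply Rinv_0_lt_compat].
Qed.

(** Coefficients in powers of [w] of the bracket [1 + sum_m K_{n,m} w^m] of the Jost solution. *)
Definition jost_coef (a p q : Z -> C) (n : Z) (m : nat) : C :=
  match m with O => 1 | S _ => Kplus a p q m n end.

(** On coefficients, multiplication of the power series by [w]. *)
Definition delay (u : nat -> C) (m : nat) : C := match m with O => 0 | S k => u k end.

(** Subtracting the formulas at [n] from those at [n - 1] leaves only the term [r = n] of each sum.
    With coefficient 1 at index 0 and 0 at negative indices, the formulas for [m = 1, ..., 4] and
    the general one merge into a single recurrence. *)
Lemma jost_coef_rec (a p q : Z -> C) (n : Z) (m : nat) : pencil_decays a p q -> (0 <= n)%Z ->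
  let j := jost_coef a p q n in
  jost_coef a p q (n - 1) m - j m =
  hcoef a q n * delay (delay j) m + 2 * p n * (delay (delay (delay j)) m + delay j m)
  + (delay (delay (delay (delay j))) m
     - a n ^ 2 * delay (delay (delay (delay (jost_coef a p q (n + 1))))) m).
Proof.
  intros Hd Hn. cbv zeta.
  (* A bound uniform in level and position makes the sums converge, so that the term [r = n] can be
     split off. *)
  assert (BD : exists A, (0 <= A)%R /\ forall k r, (-1 <= r)%Z -> (Cmod (Kplus a p q (S k) r) <= A)%R).
  { destruct Hd as (M & e & He & HM). destruct (Kplus_bound a p q M e He HM) as (A & HA & HB).
    exists A. split; [exact HA|]. intros k r Hr. eapply Rle_trans; [now apply HB|].
    pose proof (wt_le_1 e (IZR r + 1) ltac:(lra)). pose proof (wt_pos e (IZR r + 1)).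
    pose proof (wt_le_1 (e / 2) (INR (S k)) ltac:(lra)). pose proof (wt_pos (e / 2) (INR (S k))).
    rewrite Rmult_assoc. rewrite <- (Rmult_1_r A) at 2. apply Rmult_le_compat_l; [exact HA|].
    apply Rle_trans with (1 * 1)%R; [apply Rmult_le_compat; lra | lra]. }
  destruct BD as (A & HA & BD).
  assert (STEP : forall u x y z, (forall r, u r = (1 - a r ^ 2) * x r + hcoef a q r * y r + 2 * p r * z r) ->
    (forall r, (0 <= r)%Z -> Cmod (x r) <= A + 1 /\ Cmod (y r) <= A + 1 /\ Cmod (z r) <= 2 * (A + 1))%R ->
    sum_ge (n - 1 + 1) u - sum_ge (n + 1) u = u n).
  { intros u x y z Eu Hu. replace (n - 1 + 1)%Z with n by lia.
    rewrite (sum_ge_cons u n); [ring|]. apply (pencil_sum_Cser a p q u (A + 1)); [exact Hd | lia|].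
    intros r Hr. rewrite Eu. destruct (Hu r ltac:(lia)) as (X1 & X2 & X3).
    apply pencil_term_bound; lra. }
  assert (C0 : (Cmod 0 <= A + 1)%R) by (rewrite Cmod_0; lra).
  assert (C1 : (Cmod 1 <= A + 1)%R) by (rewrite Cmod_1; lra).
  destruct m as [|[|[|[|[|m]]]]].
  - simpl. ring.
  - simpl.
    transitivity (2 * (sum_ge (n - 1 + 1) p - sum_ge (n + 1) p)); [ring|].
    assert (E : sum_ge (n - 1 + 1) p - sum_ge (n + 1) p = p n).
    { replace (n - 1 + 1)%Z with n by lia. rewrite (sum_ge_cons p n); [ring|].
      apply (pencil_sum_Cser a p q p 1); [exact Hd | lia|].
      intros r _. unfold pencil_size. pose proof (Cmod_ge_0 (1 - a r ^ 2)).
      pose proof (Cmod_ge_0 (hcoef a q r)). pose proof (Cmod_ge_0 (p r)). lra. }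
    rewrite E. ring.
  - transitivity (hcoef a q n + 2 * p n * Kplus a p q 1 n); [|simpl; ring].
    apply (STEP (fun r => hcoef a q r + 2 * p r * Kplus a p q 1 r) (fun _ => 0) (fun _ => 1) (Kplus a p q 1)).
    + intros r. ring.
    + intros r Hr. pose proof (BD 0%nat r ltac:(lia)). repeat split; try lra.
  - transitivity (hcoef a q n * Kplus a p q 1 n + 2 * p n * (Kplus a p q 2 n + 1)); [|simpl; ring].
    apply (STEP (fun r => hcoef a q r * Kplus a p q 1 r + 2 * p r * (Kplus a p q 2 r + 1))
      (fun _ => 0) (Kplus a p q 1) (fun r => Kplus a p q 2 r + 1)).
    + intros r. ring.
    + intros r Hr. pose proof (BD 0%nat r ltac:(lia)). pose proof (BD 1%nat r ltac:(lia)).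
      pose proof (Cmod_triangle (Kplus a p q 2 r) 1) as TR. rewrite Cmod_1 in TR. repeat split; lra.
  - transitivity ((1 - a n ^ 2) + hcoef a q n * Kplus a p q 2 n
        + 2 * p n * (Kplus a p q 3 n + Kplus a p q 1 n)); [|simpl; ring].
    apply (STEP (fun r => (1 - a r ^ 2) + hcoef a q r * Kplus a p q 2 r
        + 2 * p r * (Kplus a p q 3 r + Kplus a p q 1 r))
      (fun _ => 1) (Kplus a p q 2) (fun r => Kplus a p q 3 r + Kplus a p q 1 r)).
    + intros r. ring.
    + intros r Hr. pose proof (BD 0%nat r ltac:(lia)). pose proof (BD 1%nat r ltac:(lia)).
      pose proof (BD 2%nat r ltac:(lia)).
      pose proof (Cmod_triangle (Kplus a p q 3 r) (Kplus a p q 1 r)). repeat split; lra.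
  - change (Kplus a p q (S (S (S (S (S m))))) (n - 1) - Kplus a p q (S (S (S (S (S m))))) n =
      hcoef a q n * Kplus a p q (S (S (S m))) n
      + 2 * p n * (Kplus a p q (S (S m)) n + Kplus a p q (S (S (S (S m)))) n)
      + (Kplus a p q (S m) n - a n ^ 2 * Kplus a p q (S m) (n + 1)%Z)).
    rewrite !Kplus_S4.
    set (u := fun r => (1 - a r ^ 2) * Kplus a p q (S m) (r + 1)%Z
      + hcoef a q r * Kplus a p q (S (S (S m))) r
      + 2 * p r * (Kplus a p q (S (S m)) r + Kplus a p q (S (S (S (S m)))) r)).
    assert (X : sum_ge (n - 1 + 1) u - sum_ge (n + 1) u = u n).
    { apply (STEP u (fun r => Kplus a p q (S m) (r + 1)%Z) (Kplus a p q (S (S (S m))))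
        (fun r => Kplus a p q (S (S m)) r + Kplus a p q (S (S (S (S m)))) r)).
      + reflexivity.
      + intros r Hr. pose proof (BD m (r + 1)%Z ltac:(lia)). pose proof (BD (S m) r ltac:(lia)).
        pose proof (BD (S (S m)) r ltac:(lia)). pose proof (BD (S (S (S m))) r ltac:(lia)).
        pose proof (Cmod_triangle (Kplus a p q (S (S m)) r) (Kplus a p q (S (S (S (S m)))) r)).
        repeat split; lra. }
    transitivity ((Kplus a p q (S m) (n - 1 + 1)%Z - Kplus a p q (S m) (n + 1)%Z)
      + (sum_ge (n - 1 + 1) u - sum_ge (n + 1) u)); [ring|].
    rewrite X. unfold u. replace (n - 1 + 1)%Z with n by lia. ring.
Qed.

Lemma Cser_disc_sum_tail (c : nat -> C) (w : C) : decays c -> (Cmod w <= 1)%R ->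
  Cser (fun k => c (S k) * w ^ S k) (disc_sum c w - c O).
Proof.
  intros Hc Hw. pose proof (Cser_disc_sum c w Hc Hw) as Q.
  apply (is_series_incr_1 (V := C_NormedModule) (fun m => c m * w ^ m)).
  match goal with |- is_series _ ?l => replace (l : C) with (disc_sum c w); [exact Q|] end.
  change (disc_sum c w = disc_sum c w - c O + c O * 1). ring.
Qed.

(** The second bound is uniform on the closed disc; it is the asymptotics of [f_n^+] by
    [alpha_n^+ e^{inz}], valid up to the real axis. *)
Lemma jost_coef_decays (a p q : Z -> C) : pencil_decays a p q ->
  exists A e, (0 < e)%R /\ (0 <= A)%R /\ forall n, (-1 <= n)%Z ->
    decays (jost_coef a p q n) /\
    forall w, (Cmod w <= 1)%R -> (Cmod (disc_sum (jost_coef a p q n) w - 1) <= A * wt e (IZR n + 1))%R.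
Proof.
  intros (M & e & He & HM). destruct (Kplus_bound a p q M e He HM) as (A & HA & HB).
  destruct (ex_series_wt (e / 2)) as [s Hs]; [lra|].
  assert (s0 : (0 <= s)%R).
  { pose proof (sum_n_le_series _ _ 0 (fun n => Rlt_le _ _ (wt_pos _ _)) Hs) as Q.
    rewrite sum_O in Q. pose proof (wt_pos (e / 2) (INR 0)). lra. }
  exists (A * s)%R, e. split; [exact He|]. split; [now apply Rmult_le_pos|].
  intros n Hn.
  assert (D : decays (jost_coef a p q n)).
  { exists (A + 1)%R, (e / 2)%R. split; [lra|].
    assert (P0 : (wt (e / 2) (INR 0) = 1)%R).
    { unfold wt. simpl. rewrite sqrt_0, Rmult_0_r, Ropp_0. apply exp_0. }
    intros [|k].
    - rewrite P0. simpl. rewrite Cmod_1. lra.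
    - eapply Rle_trans; [now apply HB|].
      pose proof (wt_le_1 e (IZR n + 1) ltac:(lra)). pose proof (wt_pos e (IZR n + 1)).
      apply Rmult_le_compat_r; [left; apply wt_pos|]. nra. }
  split; [exact D|]. intros w Hw.
  pose proof (Cser_disc_sum_tail _ w D Hw) as X.
  apply (Cser_bound _ _ (fun k => A * wt e (IZR n + 1) * wt (e / 2) (INR k))%R _ X).
  - intros k. change (jost_coef a p q n (S k)) with (Kplus a p q (S k) n).
    rewrite Cmod_mult. pose proof (Cmod_pow_le_1 w (S k) Hw).
    pose proof (Cmod_ge_0 (w ^ S k)). pose proof (Cmod_ge_0 (Kplus a p q (S k) n)).
    apply Rle_trans with (Cmod (Kplus a p q (S k) n)); [nra|].
    eapply Rle_trans; [now apply HB|]. apply Rmult_le_compat_l.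
    + apply Rmult_le_pos; [exact HA | left; apply wt_pos].
    + apply wt_le; [lra|]. rewrite S_INR. lra.
  - replace (A * s * wt e (IZR n + 1))%R with (A * wt e (IZR n + 1) * s)%R by ring.
    now apply (is_series_scal (V := R_NormedModule)).
Qed.

Lemma Cser_delay (u : nat -> C) (w l : C) :
  Cser (fun m => u m * w ^ m) l -> Cser (fun m => delay u m * w ^ m) (w * l).
Proof.
  intros H. replace (w * l) with (delay u 0 * w ^ 0 + w * l) by (simpl; ring).
  apply (Cser_cons (fun m => delay u m * w ^ m)).
  eapply Cser_ext; [|apply (Cser_scal w _ _ H)]. intros m. simpl. ring.
Qed.

(** The recurrence in terms of generating functions. With [lambda = w + 1 / w] it is the difference
    equation of the Jost solution, freed of [alpha_n^+ e^{inz}]. *)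
Lemma jost_sum_rec (a p q : Z -> C) (n : Z) (w : C) : pencil_decays a p q -> (0 <= n)%Z ->
  (Cmod w <= 1)%R ->
  let G := fun k => disc_sum (jost_coef a p q k) w in
  G (n - 1)%Z - G n =
  (hcoef a q n * w ^ 2 + 2 * p n * (w ^ 3 + w)) * G n + w ^ 4 * (G n - a n ^ 2 * G (n + 1)%Z).
Proof.
  intros Hd Hn Hw G. destruct (jost_coef_decays a p q Hd) as (A & e & _ & _ & HJ).
  assert (S : forall k, (-1 <= k)%Z -> Cser (fun m => jost_coef a p q k m * w ^ m) (G k)).
  { intros k Hk. apply Cser_disc_sum; [now apply HJ | exact Hw]. }
  assert (S1 := S (n - 1)%Z ltac:(lia)). assert (S2 := S n ltac:(lia)).
  assert (S3 := S (n + 1)%Z ltac:(lia)).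
  pose proof (Cser_delay _ _ _ S2) as D1. pose proof (Cser_delay _ _ _ D1) as D2.
  pose proof (Cser_delay _ _ _ D2) as D3. pose proof (Cser_delay _ _ _ D3) as D4.
  pose proof (Cser_delay _ _ _ (Cser_delay _ _ _ (Cser_delay _ _ _ (Cser_delay _ _ _ S3)))) as E4.
  apply (Cser_unique _ _ _ (Cser_minus _ _ _ _ S1 S2)).
  pose proof (Cser_plus _ _ _ _
    (Cser_plus _ _ _ _ (Cser_scal (hcoef a q n) _ _ D2)
      (Cser_scal (2 * p n) _ _ (Cser_plus _ _ _ _ D3 D1)))
    (Cser_minus _ _ _ _ D4 (Cser_scal (a n ^ 2) _ _ E4))) as Q.
  match type of Q with Cser _ ?l => match goal with |- Cser _ ?r =>
    replace r with l by (simpl; ring) end end.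
  eapply Cser_ext; [|exact Q]. intros m. cbv beta.
  pose proof (jost_coef_rec a p q n m Hd Hn) as R. cbv zeta in R.
  transitivity ((jost_coef a p q (n - 1) m - jost_coef a p q n m) * w ^ m); [|ring].
  rewrite R. ring.
Qed.

(** * Jost solutions and Wronskians *)

Lemma two_Ccos_half (z : C) : 2 * Ccos (z / 2) = half_exp z + / half_exp z.
Proof.
  unfold Ccos, half_exp. rewrite Cexp_opp.
  replace (Ci * (z / 2)) with (Ci * z / 2) by field. field. apply Cexp_nz.
Qed.

Lemma Gamma_eq (a v : Z -> C) (lam : C) (y : Z -> C) (n : Z) :
  Gamma a v lam y n =
  a n * (y (n + 1)%Z - y n) - a (n - 1)%Z * (y n - y (n - 1)%Z) + (v n - lam) ^ 2 * y n.
Proof.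
  unfold Gamma, Delta.
  replace (n + 1 - 1)%Z with n by lia. replace (n - 1 + 1)%Z with n by lia. reflexivity.
Qed.

Lemma Gamma_zero_unique (a v : Z -> C) (lam : C) (y : Z -> C) (m : Z) :
  (forall n, a n <> 0) -> (forall n, Gamma a v lam y n = 0) ->
  y m = 0 -> y (m + 1)%Z = 0 -> forall n, y n = 0.
Proof.
  intros Ha Hy H0 H1.
  assert (UP : forall k : nat, y (m + Z.of_nat k)%Z = 0 /\ y (m + Z.of_nat k + 1)%Z = 0).
  { induction k as [|k [I0 I1]]; [rewrite Z.add_0_r; now split|].
    replace (m + Z.of_nat (S k))%Z with (m + Z.of_nat k + 1)%Z by lia. split; [exact I1|].
    set (n := (m + Z.of_nat k + 1)%Z) in *. specialize (Hy n). rewrite Gamma_eq in Hy.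
    replace (n - 1)%Z with (m + Z.of_nat k)%Z in Hy by (unfold n; lia). rewrite I0, I1 in Hy.
    replace (y (n + 1)%Z) with (/ a n * (a n * (y (n + 1)%Z - 0) -
      a (m + Z.of_nat k)%Z * (0 - 0) + (v n - lam) ^ 2 * 0)) by (field; apply Ha).
    rewrite Hy. ring. }
  assert (DOWN : forall k : nat, y (m - Z.of_nat k)%Z = 0 /\ y (m - Z.of_nat k + 1)%Z = 0).
  { induction k as [|k [I0 I1]]; [rewrite Z.sub_0_r; now split|].
    replace (m - Z.of_nat (S k) + 1)%Z with (m - Z.of_nat k)%Z by lia. split; [|exact I0].
    set (n := (m - Z.of_nat k)%Z) in *. specialize (Hy n). rewrite Gamma_eq in Hy.
    replace (m - Z.of_nat (S k))%Z with (n - 1)%Z by (unfold n; lia). rewrite I0, I1 in Hy.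
    replace (y (n - 1)%Z) with (/ a (n - 1)%Z * (a n * (0 - 0) -
      a (n - 1)%Z * (0 - y (n - 1)%Z) + (v n - lam) ^ 2 * 0)) by (field; apply Ha).
    rewrite Hy. ring. }
  intros n. destruct (Z_le_gt_dec m n) as [L|L].
  - destruct (UP (Z.to_nat (n - m))) as [E _]. rewrite Z2Nat.id in E by lia.
    now replace (m + (n - m))%Z with n in E by lia.
  - destruct (DOWN (Z.to_nat (m - n))) as [E _]. rewrite Z2Nat.id in E by lia.
    now replace (m - (m - n))%Z with n in E by lia.
Qed.

Lemma sgnZ_succ (n : Z) : sgnZ (n + 1) = - sgnZ n.
Proof.
  unfold sgnZ. rewrite Z.even_add. simpl. destruct (Z.even n); simpl; ring.
Qed.

Lemma Cmod_sgnZ (n : Z) : Cmod (sgnZ n) = 1%R.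
Proof. unfold sgnZ. destruct (Z.even n); [apply Cmod_1 | apply Cmod_m1]. Qed.

Lemma alpha_plus_succ (a v : Z -> C) (n : Z) : short_range a v -> (-1 <= n)%Z ->
  alpha_plus a (n + 1) = - a n * alpha_plus a n.
Proof.
  intros Hs Hn. destruct (prod_ge_props a v Hs) as (lo & hi & Hlo & _ & H).
  destruct (H n Hn) as [_ E]. destruct (H (n + 1)%Z ltac:(lia)) as [[B _] _].
  unfold alpha_plus. rewrite E, sgnZ_succ. field. split; [|apply Hs].
  apply Cmod_gt_0. lra.
Qed.

Definition wave (z : C) (n : Z) : C := Cexp (Ci * IZR n * z).

Lemma wave_succ (z : C) (n : Z) : wave z (n + 1) = half_exp z ^ 2 * wave z n.
Proof.
  unfold wave. rewrite half_exp_sqr, <- Cexp_plus. f_equal. rewrite plus_IZR, RtoC_plus. ring.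
Qed.

Lemma Cmod_wave (z : C) (n : Z) : Cmod (wave z n) = exp (- (IZR n * Im z)).
Proof.
  unfold wave. rewrite Cmod_Cexp. f_equal. destruct z as [x y]. simpl. ring.
Qed.

Lemma jost_plus_eq (a p q : Z -> C) (z : C) (n : Z) : pencil_decays a p q ->
  (0 <= Im z)%R -> (-1 <= n)%Z ->
  jost_plus a p q z n = alpha_plus a n * wave z n * disc_sum (jost_coef a p q n) (half_exp z).
Proof.
  intros Hd Hz Hn. destruct (jost_coef_decays a p q Hd) as (A & e & _ & _ & HJ).
  pose proof (Cser_disc_sum_tail _ _ (proj1 (HJ n Hn)) (Cmod_half_exp_le_1 z Hz)) as X.
  unfold jost_plus, wave. f_equal.
  replace (Csum (fun k => Kplus a p q (S k) n * Cexp (Ci * INR (S k) * z / 2)))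
    with (disc_sum (jost_coef a p q n) (half_exp z) - 1); [ring|].
  symmetry. apply Cser_Csum. eapply Cser_ext; [|exact X].
  intros k. change (jost_coef a p q n (S k)) with (Kplus a p q (S k) n). f_equal.
  unfold half_exp. rewrite <- Cexp_INR. generalize (RtoC (INR (S k))). intros x. f_equal. f_equal. field.
Qed.

Notation vp v := (fun n : Z => - v n)%C (only parsing).
Notation vq v := (fun n : Z => v n ^ 2)%C (only parsing).

Lemma jost_plus_solution (a v : Z -> C) (z : C) (n : Z) : short_range a v ->
  (0 <= Im z)%R -> (0 <= n)%Z ->
  Gamma a v (2 * Ccos (z / 2)) (jost_plus a (vp v) (vq v) z) n = 0.
Proof.
  intros Hs Hz Hn. pose proof (short_range_pencil_decays a v Hs) as Hd.
  rewrite Gamma_eq, two_Ccos_half, !jost_plus_eq by (auto; lia).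
  pose proof (jost_sum_rec a _ _ n (half_exp z) Hd Hn (Cmod_half_exp_le_1 z Hz)) as R. cbv zeta in R.
  rewrite (wave_succ z n), (alpha_plus_succ a v n Hs) by lia.
  (* Waves and products at the three indices are reduced to index [n - 1]; what remains is a common
     factor times the relation of [jost_sum_rec]. *)
  replace (wave z n) with (half_exp z ^ 2 * wave z (n - 1)) by (rewrite <- wave_succ; f_equal; lia).
  replace (alpha_plus a n) with (- a (n - 1)%Z * alpha_plus a (n - 1))
    by (rewrite <- (alpha_plus_succ a v (n - 1) Hs) by lia; f_equal; lia).
  set (w := half_exp z) in *. assert (Hw : w <> 0) by apply half_exp_nz.
  set (G0 := disc_sum (jost_coef a (vp v) (vq v) (n - 1)) w) in *.
  set (G1 := disc_sum (jost_coef a (vp v) (vq v) n) w) in *.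
  set (G2 := disc_sum (jost_coef a (vp v) (vq v) (n + 1)) w) in *.
  replace G0 with (G1 + (G0 - G1)) by ring. rewrite R. unfold hcoef. field. exact Hw.
Qed.

Lemma jost_plus_bounded (a v : Z -> C) (z : C) : short_range a v -> (0 <= Im z)%R ->
  exists B, (0 <= B)%R /\
    forall n, (0 <= n)%Z -> (Cmod (jost_plus a (vp v) (vq v) z n) <= B)%R.
Proof.
  intros Hs Hz. pose proof (short_range_pencil_decays a v Hs) as Hd.
  destruct (prod_ge_props a v Hs) as (lo & hi & Hlo & Hhi & HP).
  destruct (jost_coef_decays _ _ _ Hd) as (A & e & He & HA & HJ).
  exists (/ lo * (1 + A))%R. 
  assert (L0 : (0 < / lo)%R) by now apply Rinv_0_lt_compat. split.
  { apply Rmult_le_pos; lra. }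
  intros n Hn. rewrite jost_plus_eq by (auto; lia). rewrite !Cmod_mult.
  assert (X1 : (Cmod (alpha_plus a n) <= / lo)%R).
  { destruct (HP n ltac:(lia)) as [[B _] _]. unfold alpha_plus.
    rewrite Cmod_div, Cmod_sgnZ by (apply Cmod_gt_0; lra). unfold Rdiv. rewrite Rmult_1_l.
    now apply Rinv_le_contravar. }
  assert (X2 : (Cmod (wave z n) <= 1)%R).
  { rewrite Cmod_wave, <- exp_0. apply exp_le. apply IZR_le in Hn.
    pose proof (Rmult_le_pos _ _ Hn Hz). lra. }
  assert (X3 : (Cmod (disc_sum (jost_coef a (vp v) (vq v) n) (half_exp z)) <= 1 + A)%R).
  { destruct (HJ n ltac:(lia)) as [_ B]. specialize (B _ (Cmod_half_exp_le_1 z Hz)).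
    pose proof (wt_le_1 e (IZR n + 1) ltac:(lra)) as W.
    apply (Rmult_le_compat_l A) in W; [|exact HA].
    set (G := disc_sum _ _) in *. replace G with (1 + (G - 1)) by ring.
    eapply Rle_trans; [apply Cmod_triangle|]. rewrite Cmod_1. lra. }
  apply Rmult_le_compat; auto using Cmod_ge_0.
  - apply Rmult_le_pos; apply Cmod_ge_0.
  - rewrite <- (Rmult_1_r (/ lo)). apply Rmult_le_compat; auto using Cmod_ge_0.
Qed.

(** For real [z] the wave has modulus 1 and the power series tends to 1 as [n] grows. This includes
    the points with [lambda = 2] or [lambda = -2]. *)
Lemma jost_plus_bounded_below (a v : Z -> C) (z : C) : short_range a v -> Im z = 0%R ->
  exists b N, (0 < b)%R /\ (0 <= N)%Z /\
    forall n, (N <= n)%Z -> (b <= Cmod (jost_plus a (vp v) (vq v) z n))%R.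
Proof.
  intros Hs Hz. pose proof (short_range_pencil_decays a v Hs) as Hd.
  destruct (prod_ge_props a v Hs) as (lo & hi & Hlo & Hhi & HP).
  destruct (jost_coef_decays _ _ _ Hd) as (A & e & He & HA & HJ).
  destruct (wt_eventually_small e (/ (2 * (A + 1)))) as [N HN]; [lra | apply Rinv_0_lt_compat; lra|].
  assert (L0 : (0 < / hi)%R) by now apply Rinv_0_lt_compat.
  exists (/ hi * (1 / 2))%R, (Z.of_nat N). split; [lra|]. split; [lia|].
  intros n Hn. rewrite jost_plus_eq by (auto; first [lra | lia]). rewrite !Cmod_mult.
  rewrite Cmod_wave, Hz, Rmult_0_r, Ropp_0, exp_0, Rmult_1_r.
  apply Rmult_le_compat; [lra | lra | |].
  - destruct (HP n ltac:(lia)) as [[B B'] _]. unfold alpha_plus.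
    rewrite Cmod_div, Cmod_sgnZ by (apply Cmod_gt_0; lra). unfold Rdiv. rewrite Rmult_1_l.
    apply Rinv_le_contravar; lra.
  - destruct (HJ n ltac:(lia)) as [_ B].
    specialize (B _ (Cmod_half_exp_le_1 z ltac:(rewrite Hz; lra))).
    assert (W : (wt e (IZR n + 1) <= / (2 * (A + 1)))%R).
    { apply HN. apply IZR_le in Hn. rewrite <- INR_IZR_INZ in Hn. lra. }
    apply (Rmult_le_compat_l A) in W; [|exact HA].
    assert (Y : (A * / (2 * (A + 1)) <= 1 / 2)%R).
    { apply Rmult_le_reg_r with (2 * (A + 1))%R; [lra|].
      rewrite Rmult_assoc, Rinv_l by lra. lra. }
    set (G := disc_sum _ _) in *.
    pose proof (Cmod_triangle G (- (G - 1))) as T. replace (G + - (G - 1)) with (RtoC 1) in T by ring.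
    rewrite Cmod_1, Cmod_opp in T. lra.
Qed.

(** The Wronskian of the two solutions is constant along the half-line and tends to 0, because [f]
    is bounded and [y] decays. Boundedness of [f] suffices, so real [z] are covered. *)
Lemma jost_plus_parallel (a v : Z -> C) (z : C) (y : Z -> C) : short_range a v -> (0 <= Im z)%R ->
  (forall n, Gamma a v (2 * Ccos (z / 2)) y n = 0) ->
  is_lim_seq (fun k => Cmod (y (Z.of_nat k))) 0 ->
  let f := jost_plus a (vp v) (vq v) z in
  forall n, (-1 <= n)%Z -> y n * f (n + 1)%Z = y (n + 1)%Z * f n.
Proof.
  intros Hs Hz Hy Hlim f.
  destruct (jost_plus_bounded a v z Hs Hz) as (B & HB & HF). fold f in HF.
  destruct (short_range_right a v Hs) as (M & e & He & HM & HA).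
  assert (W : forall k : nat, wronskian a y f (-1 + Z.of_nat k) = wronskian a y f (-1)).
  { induction k as [|k IH]; [reflexivity|]. rewrite <- IH.
    set (n := (-1 + Z.of_nat (S k))%Z).
    replace (-1 + Z.of_nat k)%Z with (n - 1)%Z by (unfold n; lia).
    pose proof (Hy n) as E1. pose proof (jost_plus_solution a v z n Hs Hz ltac:(unfold n; lia)) as E2.
    fold f in E2. rewrite Gamma_eq in E1, E2. unfold wronskian.
    replace (n - 1 + 1)%Z with n by lia.
    set (l := 2 * Ccos (z / 2)) in *.
    match type of E1 with ?x = _ => match type of E2 with ?x' = _ =>
      transitivity (a (n - 1)%Z * (y (n - 1)%Z * f n - y n * f (n - 1)%Z)
        + (y n * x' - x * f n)); [ring|]; rewrite E1, E2; ring end end. }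
  assert (AB : forall n, (-1 <= n)%Z -> (Cmod (a n) <= 1 + M)%R).
  { intros n Hn. destruct (HA n Hn) as [X _].
    pose proof (wt_le_1 (2 * e) (IZR n + 1) ltac:(lra)) as Q.
    apply (Rmult_le_compat_l M) in Q; [|exact HM].
    replace (a n) with (1 + - (1 - a n)) by ring.
    eapply Rle_trans; [apply Cmod_triangle|]. rewrite Cmod_opp, Cmod_1. lra. }
  assert (W0 : wronskian a y f (-1) = 0).
  { apply Cmod_eq_0. apply Rle_antisym; [|apply Cmod_ge_0].
    assert (L : is_lim_seq (fun k => (1 + M) * B *
        (Cmod (y (Z.of_nat k)) + Cmod (y (Z.of_nat (S k)))))%R (Rbar_mult ((1 + M) * B)%R (0 + 0)%R)).
    { apply is_lim_seq_scal_l. apply is_lim_seq_plus'; [exact Hlim|].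
      apply (is_lim_seq_incr_1 (fun k => Cmod (y (Z.of_nat k)))), Hlim. }
    simpl in L. replace ((1 + M) * B * (0 + 0))%R with 0%R in L by ring.
    apply (is_lim_seq_le (fun _ => Cmod (wronskian a y f (-1))) _ (Cmod (wronskian a y f (-1))) 0
      ) with (2 := is_lim_seq_const _) (3 := L).
    intros k. rewrite <- (W (S k)). unfold wronskian.
    replace (-1 + Z.of_nat (S k))%Z with (Z.of_nat k) by lia.
    replace (Z.of_nat k + 1)%Z with (Z.of_nat (S k)) by lia.
    rewrite Cmod_mult, Rmult_assoc. apply Rmult_le_compat; auto using Cmod_ge_0.
    - apply AB. lia.
    - unfold Cminus. eapply Rle_trans; [apply Cmod_triangle|]. rewrite Cmod_opp, !Cmod_mult.
      pose proof (HF (Z.of_nat k) ltac:(lia)). pose proof (HF (Z.of_nat (S k)) ltac:(lia)).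
      rewrite Rmult_plus_distr_l, !(Rmult_comm B).
      apply Rplus_le_compat; apply Rmult_le_compat_l; auto using Cmod_ge_0. }
  intros n Hn. specialize (W (Z.to_nat (n + 1))). rewrite Z2Nat.id, W0 in W by lia.
  replace (-1 + (n + 1))%Z with n in W by lia. unfold wronskian in W.
  assert (Ha := proj1 Hs n).
  replace (y n * f (n + 1)%Z) with (/ a n * (a n * (y n * f (n + 1)%Z - y (n + 1)%Z * f n))
    + y (n + 1)%Z * f n) by (field; exact Ha).
  rewrite W. ring.
Qed.

(** Far to the right [f] has no zeros and [y] is a constant multiple of it. As [|f|] stays above
    [b], the decay of [y] makes the multiple 0, and two consecutive zeros of [y] propagate to the
    whole line. *)
Lemma no_decaying_solution_real (a v : Z -> C) (z : C) (y : Z -> C) : short_range a v -> Im z = 0%R ->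
  (forall n, Gamma a v (2 * Ccos (z / 2)) y n = 0) ->
  is_lim_seq (fun k => Cmod (y (Z.of_nat k))) 0 -> forall n, y n = 0.
Proof.
  intros Hs Hz Hy Hlim.
  pose proof (jost_plus_parallel a v z y Hs ltac:(lra) Hy Hlim) as HP.
  destruct (jost_plus_bounded_below a v z Hs Hz) as (b & N & Hb & HN & HF).
  destruct (jost_plus_bounded a v z Hs ltac:(lra)) as (B & HB & HU).
  set (f := jost_plus a (vp v) (vq v) z) in *. cbv zeta in HP.
  assert (Fnz : forall n, (N <= n)%Z -> f n <> 0).
  { intros n Hn. apply Cmod_gt_0. specialize (HF n Hn). lra. }
  assert (R : forall k : nat, y (N + Z.of_nat k)%Z = y N / f N * f (N + Z.of_nat k)%Z).
  { induction k as [|k IH].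
    - rewrite Z.add_0_r. field. apply Fnz. lia.
    - set (n := (N + Z.of_nat k)%Z) in *.
      replace (N + Z.of_nat (S k))%Z with (n + 1)%Z by (unfold n; lia).
      specialize (HP n ltac:(unfold n; lia)). rewrite IH in HP.
      pose proof (Fnz n ltac:(unfold n; lia)). pose proof (Fnz N ltac:(lia)).
      replace (y (n + 1)%Z) with (y (n + 1)%Z * f n / f n) by (field; auto).
      rewrite <- HP. field. auto. }
  assert (Z0 : y N / f N = 0).
  { apply Cmod_eq_0. apply Rle_antisym; [|apply Cmod_ge_0].
    apply Rmult_le_reg_r with b; [exact Hb|]. rewrite Rmult_0_l.
    assert (L : is_lim_seq (fun k => Cmod (y (N + Z.of_nat k)%Z)) 0).
    { apply (is_lim_seq_incr_n (fun k => Cmod (y (Z.of_nat k))) (Z.to_nat N)) in Hlim.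
      eapply is_lim_seq_ext; [|exact Hlim]. intros k. simpl. do 2 f_equal. lia. }
    apply (is_lim_seq_le (fun _ => (Cmod (y N / f N) * b)%R) _ (Cmod (y N / f N) * b)%R 0)
      with (2 := is_lim_seq_const _) (3 := L).
    intros k. rewrite R, Cmod_mult. apply Rmult_le_compat_l; [apply Cmod_ge_0|]. apply HF. lia. }
  apply (Gamma_zero_unique a v (2 * Ccos (z / 2)) y N (proj1 Hs) Hy).
  - specialize (R O). rewrite Z.add_0_r, Z0 in R. rewrite R. ring.
  - specialize (R 1%nat). rewrite Z0 in R. change (Z.of_nat 1) with 1%Z in R. rewrite R. ring.
Qed.

(** * Reflection of the line *)

(** [a_n] couples the sites [n] and [n + 1]; under [n -> - n] this bond joins [- n - 1] to [- n],
    whence the extra shift compared with [reflect]. *)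
Definition reflect_a (a : Z -> C) (k : Z) : C := a (- k - 1)%Z.
Definition reflect (p : Z -> C) (k : Z) : C := p (- k)%Z.

Lemma sum_le_reflect (u : Z -> C) (n : Z) : sum_le n u = sum_ge (- n) (reflect u).
Proof.
  unfold sum_le, sum_ge, reflect. f_equal. apply functional_extensionality. intros k. f_equal. lia.
Qed.

Lemma hcoef_reflect (a q : Z -> C) (r : Z) :
  hcoef a q (- r) = hcoef (reflect_a a) (reflect q) r.
Proof.
  unfold hcoef, reflect_a, reflect. replace (- (r - 1) - 1)%Z with (- r)%Z by lia. ring.
Qed.

(** The left recursion is the right one for the reflected coefficients, so that all estimates carry
    over to the left Jost solution. The induction carries four consecutive levels, the depth of the
    recursion. *)
Lemma Kminus_reflect (a p q : Z -> C) (m : nat) (n : Z) :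
  Kminus a p q m n = Kplus (reflect_a a) (reflect p) (reflect q) m (- n).
Proof.
  revert n.
  set (P := fun m => forall n, Kminus a p q m n = Kplus (reflect_a a) (reflect p) (reflect q) m (- n)).
  assert (SH : forall n : Z, (- (n - 1))%Z = (- n + 1)%Z) by (intros; lia).
  assert (P1 : P 1%nat) by (intros n; simpl; now rewrite sum_le_reflect, SH).
  assert (EXT : forall n u u', (forall r, u (- r)%Z = u' r) -> sum_le (n - 1) u = sum_ge (- n + 1) u').
  { intros n u u' H. rewrite sum_le_reflect, SH. f_equal. apply functional_extensionality, H. }
  assert (RF : forall (j : nat) r, P j -> Kminus a p q j (- r) = Kplus (reflect_a a) (reflect p) (reflect q) j r).
  { intros j r H. rewrite H. f_equal. lia. }
  assert (P2 : P 2%nat).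
  { intros n. apply EXT. intros r.
    change (hcoef a q (- r) + 2 * reflect p r * Kminus a p q 1 (- r) =
      hcoef (reflect_a a) (reflect q) r + 2 * reflect p r * Kplus (reflect_a a) (reflect p) (reflect q) 1 r).
    now rewrite hcoef_reflect, RF. }
  assert (P3 : P 3%nat).
  { intros n. apply EXT. intros r.
    change (hcoef a q (- r) * Kminus a p q 1 (- r) + 2 * reflect p r * (Kminus a p q 2 (- r) + 1) =
      hcoef (reflect_a a) (reflect q) r * Kplus (reflect_a a) (reflect p) (reflect q) 1 r
      + 2 * reflect p r * (Kplus (reflect_a a) (reflect p) (reflect q) 2 r + 1)).
    now rewrite hcoef_reflect, !RF. }
  assert (P4 : P 4%nat).
  { intros n. apply EXT. intros r.
    change (1 - reflect_a a r ^ 2 + hcoef a q (- r) * Kminus a p q 2 (- r)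
        + 2 * reflect p r * (Kminus a p q 3 (- r) + Kminus a p q 1 (- r)) =
      1 - reflect_a a r ^ 2
      + hcoef (reflect_a a) (reflect q) r * Kplus (reflect_a a) (reflect p) (reflect q) 2 r
      + 2 * reflect p r * (Kplus (reflect_a a) (reflect p) (reflect q) 3 r
          + Kplus (reflect_a a) (reflect p) (reflect q) 1 r)).
    now rewrite hcoef_reflect, !RF. }
  assert (ALL : forall k, P (S k) /\ P (S (S k)) /\ P (S (S (S k))) /\ P (S (S (S (S k))))).
  { induction k as [|k (I1 & I2 & I3 & I4)]; [auto|].
    repeat split; auto. intros n. rewrite Kplus_S4.
    change (Kminus a p q (S k) (n - 1) + sum_le (n - 1) (fun r =>
          (1 - a (r - 1)%Z ^ 2) * Kminus a p q (S k) (r - 1)%Z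
          + hcoef a q r * Kminus a p q (S (S (S k))) r
          + 2 * p r * (Kminus a p q (S (S k)) r + Kminus a p q (S (S (S (S k)))) r)) =
      Kplus (reflect_a a) (reflect p) (reflect q) (S k) (- n + 1)
      + sum_ge (- n + 1) (fun r =>
        (1 - reflect_a a r ^ 2) * Kplus (reflect_a a) (reflect p) (reflect q) (S k) (r + 1)%Z
        + hcoef (reflect_a a) (reflect q) r * Kplus (reflect_a a) (reflect p) (reflect q) (S (S (S k))) r
        + 2 * reflect p r * (Kplus (reflect_a a) (reflect p) (reflect q) (S (S k)) r
            + Kplus (reflect_a a) (reflect p) (reflect q) (S (S (S (S k)))) r))).
    f_equal.
    - rewrite I1. f_equal. lia.
    - apply EXT. intros r. rewrite hcoef_reflect, !RF by assumption.
      replace (- r - 1)%Z with (- (r + 1))%Z at 2 by lia. rewrite RF by assumption. reflexivity. }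
  destruct m as [|m]; [reflexivity|]. apply (ALL m).
Qed.

Lemma jost_minus_reflect (a p q : Z -> C) (z : C) (n : Z) :
  jost_minus a p q z n = jost_plus (reflect_a a) (reflect p) (reflect q) z (- n).
Proof.
  unfold jost_minus, jost_plus, alpha_minus, alpha_plus. f_equal; [f_equal; [f_equal|]|].
  - unfold sgnZ. now rewrite Z.even_opp.
  - unfold prod_le, prod_ge, reflect_a. f_equal.
    apply functional_extensionality. intros k. f_equal. lia.
  - f_equal. rewrite opp_IZR, RtoC_opp. ring.
  - f_equal. f_equal. apply functional_extensionality. intros k. now rewrite Kminus_reflect.
Qed.

Lemma Gamma_reflect (a v : Z -> C) (lam : C) (y : Z -> C) (n : Z) :
  Gamma (reflect_a a) (reflect v) lam (reflect y) n = Gamma a v lam y (- n).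
Proof.
  rewrite !Gamma_eq. unfold reflect_a, reflect.
  replace (- (n - 1) - 1)%Z with (- n)%Z by lia. replace (- (n - 1))%Z with (- n + 1)%Z by lia.
  replace (- (n + 1))%Z with (- n - 1)%Z by lia. ring.
Qed.

(** The reflection moves [a] by one site relative to [v]. In the new constant, [M * exp e] pays for
    this shift in [1 - a], and [M] bounds [v]. *)
Lemma short_range_reflect (a v : Z -> C) : short_range a v -> short_range (reflect_a a) (reflect v).
Proof.
  intros (Ha & M & e & He & H). split; [intros n; apply Ha|].
  assert (M0 : (0 <= M)%R).
  { specialize (H 0%Z). pose proof (Cmod_ge_0 (1 - a 0%Z)). pose proof (Cmod_ge_0 (v 0%Z)).
    pose proof (wt_pos e (IZR (Z.abs 0))). nra. }
  exists (M * exp e + M)%R, e. split; [exact He|]. intros n. unfold reflect_a, reflect.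
  pose proof (H (- n - 1)%Z) as X. pose proof (H (- n)%Z) as Y. rewrite Z.abs_opp in Y.
  pose proof (Cmod_ge_0 (v (- n - 1)%Z)). pose proof (Cmod_ge_0 (1 - a (- n)%Z)).
  assert (W : (wt e (IZR (Z.abs (- n - 1))) <= exp e * wt e (IZR (Z.abs n)))%R).
  { eapply Rle_trans; [apply (wt_shift e _ 1); [lra | apply IZR_le; lia | lra]|].
    rewrite sqrt_1, Rmult_1_r. apply Rmult_le_compat_l; [left; apply exp_pos|].
    apply wt_le; [lra|]. rewrite <- plus_IZR. apply IZR_le. lia. }
  apply (Rmult_le_compat_l M) in W; [|exact M0]. lra.
Qed.

(** * The function [Phi] and the theorem *)

(** [4 PI] is a full period of [exp (i z / 2)]. The argument of [w] is [asin (y / r)] in the right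
    half-plane and [PI - asin (y / r)] in the left one, hence lies in [[- PI / 2, 3 PI / 2]]; the
    modulus [r] gives [Im z = - 2 ln r]. *)
Lemma half_exp_surj (w : C) : w <> 0 ->
  exists z, (- PI <= Re z <= 3 * PI)%R /\ half_exp z = w.
Proof.
  intros Hw. pose proof (proj1 (Cmod_gt_0 w) Hw) as Hr. destruct w as [x y].
  set (r := Cmod (x, y)) in *.
  assert (Hxy : (x * x + y * y = r * r)%R).
  { unfold r, Cmod. simpl. rewrite sqrt_sqrt; [ring | nra]. }
  assert (Hy : (- 1 <= y / r <= 1)%R).
  { assert (- r <= y <= r)%R by nra.
    split; apply Rmult_le_reg_r with r; auto; unfold Rdiv; rewrite Rmult_assoc, Rinv_l; lra. }
  pose proof (asin_bound (y / r)) as AB. pose proof PI_RGT_0 as PP.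
  assert (Hc : cos (asin (y / r)) = (Rabs x / r)%R).
  { rewrite cos_asin by exact Hy.
    replace (1 - (y / r)²)%R with ((Rabs x / r) * (Rabs x / r))%R.
    - apply sqrt_square. apply Rmult_le_pos; [apply Rabs_pos | left; now apply Rinv_0_lt_compat].
    - unfold Rsqr. replace (Rabs x / r * (Rabs x / r))%R with ((Rabs x * Rabs x) / (r * r))%R by (field; lra).
      rewrite <- Rabs_mult, Rabs_pos_eq by apply Rle_0_sqr.
      replace (x * x)%R with (r * r - y * y)%R by lra. field. lra. }
  assert (He : exp (- (- 2 * ln r) / 2) = r).
  { replace (- (- 2 * ln r) / 2)%R with (ln r) by field. now apply exp_ln. }
  destruct (Rle_lt_dec 0 x) as [Hx|Hx].
  - exists ((2 * asin (y / r))%R, (- 2 * ln r)%R). split; [simpl; lra|].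
    rewrite half_exp_eq, He. replace (2 * asin (y / r) / 2)%R with (asin (y / r)) by field.
    rewrite Hc, sin_asin, Rabs_pos_eq by auto. f_equal; field; lra.
  - exists ((2 * (PI - asin (y / r)))%R, (- 2 * ln r)%R). split; [simpl; lra|].
    rewrite half_exp_eq, He.
    replace (2 * (PI - asin (y / r)) / 2)%R with (PI - asin (y / r))%R by field.
    rewrite Rtrigo_facts.cos_pi_minus, sin_PI_x, Hc, sin_asin, Rabs_left by auto.
    f_equal; field; lra.
Qed.

Lemma Csqrt_exists (u : C) : exists s : C, s * s = u.
Proof.
  destruct (classic (u = 0)) as [->|H]; [exists 0; ring|].
  destruct (half_exp_surj u H) as (z & _ & E). exists (Cexp (Ci * z / 4)).
  rewrite <- Cexp_plus, <- E. unfold half_exp. f_equal. field.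
Qed.

(** The roots of [w^2 - lambda w + 1] have product 1, so one of them lies in the closed disc. *)
Lemma joukowski_surj (lam : C) : exists w : C, w <> 0 /\ (Cmod w <= 1)%R /\ lam = w + / w.
Proof.
  destruct (Csqrt_exists (lam * lam / 4 - 1)) as [s Hs].
  assert (P : (lam / 2 + s) * (lam / 2 - s) = 1).
  { transitivity (lam * lam / 4 - s * s); [field|]. rewrite Hs. ring. }
  assert (G : forall u v : C, u * v = 1 -> u + v = lam -> (Cmod u <= 1)%R ->
     exists w : C, w <> 0 /\ (Cmod w <= 1)%R /\ lam = w + / w).
  { intros u v E1 E2 Hu. assert (Nu : u <> 0).
    { intros ->. rewrite Cmult_0_l in E1. apply (f_equal Cmod) in E1. rewrite Cmod_0, Cmod_1 in E1. lra. }
    exists u. split; [exact Nu|]. split; [exact Hu|].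
    rewrite <- E2. replace v with (u * v * / u) at 1 by (field; exact Nu). rewrite E1. ring. }
  destruct (Rle_lt_dec (Cmod (lam / 2 + s)) 1) as [L|L].
  - apply (G _ _ P); [field | exact L].
  - apply (G (lam / 2 - s) (lam / 2 + s)); [rewrite <- P; ring | field|].
    apply (f_equal Cmod) in P. rewrite Cmod_mult, Cmod_1 in P.
    pose proof (Cmod_ge_0 (lam / 2 - s)). nra.
Qed.

Lemma spectral_param (lam : C) :
  exists z, (- PI <= Re z <= 3 * PI)%R /\ (0 <= Im z)%R /\ lam = 2 * Ccos (z / 2).
Proof.
  destruct (joukowski_surj lam) as (w & Hw & H1 & E).
  destruct (half_exp_surj w Hw) as (z & Hz & Ez).
  exists z. split; [exact Hz|]. split.
  - rewrite <- Ez, Cmod_half_exp, <- exp_0 in H1.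
    destruct (Rle_lt_dec 0 (Im z)) as [L|L]; [exact L|exfalso].
    assert (exp 0 < exp (- Im z / 2))%R by (apply exp_increasing; lra). lra.
  - now rewrite two_Ccos_half, Ez.
Qed.

Lemma l2_lim_0 (u : nat -> C) : ex_series (fun k => Cmod (u k) ^ 2)%R ->
  is_lim_seq (fun k => Cmod (u k)) 0.
Proof.
  intros H. apply ex_series_lim_0 in H.
  apply (is_lim_seq_continuous sqrt) in H; [|apply continuity_pt_sqrt; lra].
  rewrite sqrt_0 in H. eapply is_lim_seq_ext; [|exact H].
  intros k. cbv beta. simpl. rewrite Rmult_1_r. apply sqrt_square, Cmod_ge_0.
Qed.

Lemma eigenvalue_zero (a v : Z -> C) (lam : C) : short_range a v -> is_eigenvalue (Gamma a v) lam ->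
  exists z, in_Pplus z /\ Phi a (vp v) (vq v) z = 0 /\ lam = 2 * Ccos (z / 2).
Proof.
  intros Hs (y & (n0 & Hn0) & [L1 L2] & Hy).
  apply l2_lim_0 in L1. apply (l2_lim_0 (fun k => y (- Z.of_nat k)%Z)) in L2.
  destruct (spectral_param lam) as (z & HR & HI & E). subst lam.
  exists z. split; [|split; [|reflexivity]].
  - split; [exact HR|]. destruct HI as [HI|HI]; [exact HI|exfalso].
    apply Hn0. now apply (no_decaying_solution_real a v z y).
  - pose proof (jost_plus_parallel a v z y Hs HI Hy L1 0%Z ltac:(lia)) as P1.
    assert (HyR : forall n, Gamma (reflect_a a) (reflect v) (2 * Ccos (z / 2)) (reflect y) n = 0).
    { intros n. rewrite Gamma_reflect. apply Hy. }
    (* The indices -1 and 0 of the reflected line are the sites 1 and 0. *)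
    pose proof (jost_plus_parallel (reflect_a a) (reflect v) z (reflect y)
      (short_range_reflect a v Hs) HI HyR L2 (-1)%Z ltac:(lia)) as P2.
    unfold Phi, wronskian. rewrite !jost_minus_reflect.
    change (reflect (vp v)) with (vp (reflect v)). change (reflect (vq v)) with (vq (reflect v)).
    change (- 0)%Z with 0%Z in *. change (- (0 + 1))%Z with (-1)%Z. 
    change (-1 + 1)%Z with 0%Z in P2. change (0 + 1)%Z with 1%Z in *.
    change (reflect y (-1)%Z) with (y 1%Z) in P2. change (reflect y 0%Z) with (y 0%Z) in P2.
    set (f0 := jost_plus a (vp v) (vq v) z 0%Z) in *.
    set (f1 := jost_plus a (vp v) (vq v) z 1%Z) in *.
    set (g0 := jost_plus (reflect_a a) (vp (reflect v)) (vq (reflect v)) z 0%Z) in *.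
    set (g1 := jost_plus (reflect_a a) (vp (reflect v)) (vq (reflect v)) z (-1)%Z) in *.
    (* The pairs [(f0, f1)] and [(g0, g1)] are both proportional to [(y 0, y 1)]. This pair is not
       zero, since two consecutive zeros would make [y] vanish identically, so the two pairs are
       proportional to each other. *)
    assert (NZ : y 0%Z <> 0 \/ y 1%Z <> 0).
    { apply NNPP. intros N. apply not_or_and in N. destruct N as [N0 N1].
      apply NNPP in N0. apply NNPP in N1. apply Hn0.
      now apply (Gamma_zero_unique a v (2 * Ccos (z / 2)) y 0%Z (proj1 Hs) Hy). }
    assert (W : g0 * f1 - g1 * f0 = 0); [|rewrite W; ring].
    destruct NZ as [N|N].
    + replace (g0 * f1 - g1 * f0) with (/ y 0%Z * (g0 * (y 0%Z * f1) - y 0%Z * g1 * f0)) by (field; exact N).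
      rewrite P1, <- P2. ring.
    + replace (g0 * f1 - g1 * f0) with (/ y 1%Z * (y 1%Z * g0 * f1 - g1 * (y 1%Z * f0))) by (field; exact N).
      rewrite <- P1, P2. ring.
Qed.

(** * The power series of [w^2 Phi] *)

Lemma decays_delay (u : nat -> C) : decays u -> decays (delay u).
Proof.
  intros (A & e & He & H).
  assert (A0 : (0 <= A)%R).
  { specialize (H O). pose proof (Cmod_ge_0 (u O)). pose proof (wt_pos e (INR 0)). nra. }
  exists (A * exp e)%R, e. split; [exact He|]. intros [|m].
  - simpl. rewrite Cmod_0. apply Rmult_le_pos; [|left; apply wt_pos].
    apply Rmult_le_pos; [exact A0 | left; apply exp_pos].
  - simpl delay. eapply Rle_trans; [apply H|]. rewrite Rmult_assoc.
    apply Rmult_le_compat_l; [exact A0|].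
    pose proof (wt_shift e (INR m) 1 ltac:(lra) (pos_INR m) ltac:(lra)) as W.
    rewrite sqrt_1, Rmult_1_r in W. now rewrite S_INR.
Qed.

Definition conv (u v : nat -> C) (m : nat) : C := sum_n (fun k => u k * v (m - k)%nat) m.

Lemma sum_n_mult_loc (f g : nat -> C) (x : C) (n : nat) :
  (forall k, (k <= n)%nat -> f k = g k * x) -> sum_n f n = sum_n g n * x.
Proof.
  induction n as [|n IH]; intros H; [rewrite !sum_O; now apply H|].
  rewrite !sum_Sn, IH, H by auto. 
  change (sum_n g n * x + g (S n) * x = (sum_n g n + g (S n)) * x). ring.
Qed.

Lemma disc_sum_conv (u v : nat -> C) (w : C) : decays u -> decays v -> (Cmod w <= 1)%R ->
  disc_sum (conv u v) w = disc_sum u w * disc_sum v w.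
Proof.
  intros Hu Hv Hw. apply Cser_Csum.
  pose proof (Cser_mult _ _ _ _ (decays_ex_series _ (decays_pow u w Hw Hu))
    (decays_ex_series _ (decays_pow v w Hw Hv))
    (Cser_disc_sum u w Hu Hw) (Cser_disc_sum v w Hv Hw)) as Q.
  eapply Cser_ext; [|exact Q]. intros n. cbv beta. unfold conv.
  apply sum_n_mult_loc. intros k Hk.
  replace (w ^ n) with (w ^ k * w ^ (n - k)) by (rewrite <- Cpow_add_r; f_equal; lia). ring.
Qed.

Lemma disc_sum_plus (c d : nat -> C) (w : C) : decays c -> decays d -> (Cmod w <= 1)%R ->
  disc_sum (fun m => c m + d m) w = disc_sum c w + disc_sum d w.
Proof.
  intros Hc Hd Hw. apply Cser_Csum.
  eapply Cser_ext; [|apply (Cser_plus _ _ _ _ (Cser_disc_sum c w Hc Hw) (Cser_disc_sum d w Hd Hw))].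
  intros m. simpl. ring.
Qed.

Lemma disc_sum_scal (k : C) (c : nat -> C) (w : C) : decays c -> (Cmod w <= 1)%R ->
  disc_sum (fun m => k * c m) w = k * disc_sum c w.
Proof.
  intros Hc Hw. apply Cser_Csum.
  eapply Cser_ext; [|apply (Cser_scal k _ _ (Cser_disc_sum c w Hc Hw))].
  intros m. simpl. ring.
Qed.

Lemma disc_sum_delay (c : nat -> C) (w : C) : decays c -> (Cmod w <= 1)%R ->
  disc_sum (delay c) w = w * disc_sum c w.
Proof. intros Hc Hw. apply Cser_Csum, Cser_delay. now apply Cser_disc_sum. Qed.

Lemma decays_scal (k : C) (c : nat -> C) : decays c -> decays (fun m => k * c m).
Proof. apply (decays_le _ _ (Cmod k)). intros m. rewrite Cmod_mult. lra. Qed.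

Lemma alpha_plus_nz (a v : Z -> C) (n : Z) : short_range a v -> (-1 <= n)%Z -> alpha_plus a n <> 0.
Proof.
  intros Hs Hn. destruct (prod_ge_props a v Hs) as (lo & hi & Hlo & Hhi & H).
  destruct (H n Hn) as [[B _] _]. assert (N : prod_ge n a <> 0) by (apply Cmod_gt_0; lra).
  apply Cmod_gt_0. unfold alpha_plus. rewrite Cmod_div, Cmod_sgnZ by exact N.
  apply Rdiv_lt_0_compat; lra.
Qed.

(** At index 1 the left solution carries the wave factor [w^(-2)] and the right one [w^2]; at index
    0 there is none. After multiplication by [w^2] the product [f^-_0 f^+_1] starts at [w^4], so the
    constant term comes from [f^-_1 f^+_0] alone and is a product of nonzero numbers. *)
Lemma Phi_disc_sum (a v : Z -> C) : short_range a v ->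
  exists c, decays c /\ c O <> 0 /\
    forall z, (0 <= Im z)%R -> half_exp z ^ 2 * Phi a (vp v) (vq v) z = disc_sum c (half_exp z).
Proof.
  intros Hs. pose proof (short_range_reflect a v Hs) as Hr.
  pose proof (short_range_pencil_decays a v Hs) as Dp.
  pose proof (short_range_pencil_decays _ _ Hr) as Dm.
  destruct (jost_coef_decays _ _ _ Dp) as (A & e & _ & _ & HJ).
  destruct (jost_coef_decays _ _ _ Dm) as (A' & e' & _ & _ & HJ').
  set (k0 := jost_coef a (vp v) (vq v) 0) in *. set (k1 := jost_coef a (vp v) (vq v) 1) in *.
  set (j0 := jost_coef (reflect_a a) (vp (reflect v)) (vq (reflect v)) 0) in *.
  set (j1 := jost_coef (reflect_a a) (vp (reflect v)) (vq (reflect v)) (-1)) in *.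
  assert (Dk0 : decays k0) by (apply HJ; lia). assert (Dk1 : decays k1) by (apply HJ; lia).
  assert (Dj0 : decays j0) by (apply HJ'; lia). assert (Dj1 : decays j1) by (apply HJ'; lia).
  set (al := alpha_plus a). set (be := alpha_plus (reflect_a a)).
  assert (D1 : decays (conv j0 k1)) by now apply decays_conv.
  assert (D2 : decays (conv j1 k0)) by now apply decays_conv.
  set (s := a 0%Z * be 0%Z * al 1%Z). set (t := - (a 0%Z * be (-1)%Z * al 0%Z)).
  exists (fun m => s * delay (delay (delay (delay (conv j0 k1)))) m + t * conv j1 k0 m).
  split; [|split].
  - apply decays_plus; apply decays_scal; [now do 4 apply decays_delay | exact D2].
  - simpl. unfold conv. rewrite sum_O. simpl.
    replace (s * 0 + t * (1 * 1)) with ((- (1)) * (a 0%Z * (be (-1)%Z * al 0%Z))) by (unfold t; ring).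
    apply Cmult_neq_0; [apply Cmod_gt_0; rewrite Cmod_m1; lra|].
    apply Cmult_neq_0; [apply Hs|]. apply Cmult_neq_0.
    + now apply (alpha_plus_nz _ (reflect v)).
    + now apply (alpha_plus_nz _ v).
  - intros z Hz. pose proof (Cmod_half_exp_le_1 z Hz) as Hw.
    rewrite disc_sum_plus, !disc_sum_scal, !disc_sum_delay, !disc_sum_conv
      by (auto; try apply decays_scal; auto using decays_delay).
    unfold Phi, wronskian. rewrite !jost_minus_reflect.
    change (reflect (vp v)) with (vp (reflect v)). change (reflect (vq v)) with (vq (reflect v)).
    change (- 0)%Z with 0%Z. change (- (0 + 1))%Z with (-1)%Z. change (0 + 1)%Z with 1%Z.
    rewrite !jost_plus_eq by (auto; lia). fold k0 k1 j0 j1 al be.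
    assert (W0 : wave z 0 = 1).
    { unfold wave. rewrite <- Cexp_0. f_equal. ring. }
    assert (W1 : wave z 1 = half_exp z ^ 2).
    { change 1%Z with (0 + 1)%Z. rewrite wave_succ, W0. ring. }
    assert (Nw := half_exp_nz z).
    assert (W2 : wave z (-1) = / half_exp z ^ 2).
    { pose proof (wave_succ z (-1)) as E. change (-1 + 1)%Z with 0%Z in E. rewrite W0 in E.
      replace (wave z (-1)) with (half_exp z ^ 2 * wave z (-1) / half_exp z ^ 2)
        by (field; exact Nw).
      rewrite <- E. field. exact Nw. }
    rewrite W0, W1, W2. unfold s, t. field. exact Nw.
Qed.

(** At [n = 0] both sides are 0 by the convention in [Zabs_pow]; otherwise [|n| >= 1], and powers
    increase with the exponent. *)
Lemma sqrt_le_Zabs_pow (n : Z) (delta : R) : (1 / 2 <= delta)%R ->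
  (sqrt (IZR (Z.abs n)) <= Zabs_pow n delta)%R.
Proof.
  intros H. unfold Zabs_pow. destruct (Z.eq_dec n 0) as [->|N].
  - simpl. rewrite sqrt_0. lra.
  - assert (P : (1 <= IZR (Z.abs n))%R) by (apply IZR_le; lia).
    rewrite <- Rpower_sqrt by lra. apply Rle_Rpower; lra.
Qed.

Lemma exp_bound_short_range (a v : Z -> C) (eps delta : R) :
  (forall n, a n <> 0) -> (0 < eps)%R -> (1 / 2 <= delta)%R ->
  bound (fun x : R => exists n : Z,
     x = (exp (eps * Zabs_pow n delta) * (Cmod (1 - a n) + Cmod (v n)))%R) ->
  short_range a v.
Proof.
  intros Ha He Hd [M HM]. split; [exact Ha|]. exists M, eps. split; [exact He|].
  intros n. specialize (HM _ (ex_intro _ n eq_refl)).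
  set (X := (Cmod (1 - a n) + Cmod (v n))%R) in *.
  assert (X0 : (0 <= X)%R) by (apply Rplus_le_le_0_compat; apply Cmod_ge_0).
  pose proof (sqrt_le_Zabs_pow n delta Hd) as S.
  assert (E : (exp (eps * sqrt (IZR (Z.abs n))) * X <= M)%R).
  { eapply Rle_trans; [|exact HM]. apply Rmult_le_compat_r; [exact X0|].
    apply exp_le. apply Rmult_le_compat_l; lra. }
  unfold wt. rewrite exp_Ropp. pose proof (exp_pos (eps * sqrt (IZR (Z.abs n)))) as P.
  apply Rmult_le_reg_l with (exp (eps * sqrt (IZR (Z.abs n)))); [exact P|].
  replace (exp (eps * sqrt (IZR (Z.abs n))) * (M * / exp (eps * sqrt (IZR (Z.abs n)))))%R with M
    by (field; lra). exact E.
Qed.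

Theorem corollary3 (a v : Z -> C) (ha : forall n : Z, a n <> 0)
  (eps delta : R) (heps : (0 < eps)%R) (hdelta : (1 / 2 <= delta <= 1)%R)
  (hsup : bound (fun x : R => exists n : Z,
     x = (exp (eps * Zabs_pow n delta) * (Cmod (1 - a n) + Cmod (v n)))%R)) :
  let F := Phi a (fun n => - v n) (fun n => v n ^ 2) in
  finite_set (is_eigenvalue (Gamma a v)) /\
  finite_set (is_spectral_singularity F) /\
  (forall lam : C,
     is_eigenvalue (Gamma a v) lam \/ is_spectral_singularity F lam ->
     finite_multiplicity F lam).
Proof.
  intros F.
  assert (Hs : short_range a v) by (apply (exp_bound_short_range a v eps delta); auto; lra).
  destruct (Phi_disc_sum a v Hs) as (c & Hc & H0 & HF). fold F in HF.
  assert (EV : forall lam, is_eigenvalue (Gamma a v) lam ->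
    exists z, in_Pplus z /\ F z = 0 /\ lam = 2 * Ccos (z / 2)).
  { intros lam. now apply eigenvalue_zero. }
  destruct (disc_zeros_finite c Hc H0) as [l Hl].
  (* All [z] over the same [w] give the same [lambda = w + 1 / w], so the finite list of [w] serves
     for eigenvalues and spectral singularities alike. *)
  assert (IN : forall z, (0 <= Im z)%R -> F z = 0 ->
    In (2 * Ccos (z / 2)) (map (fun w => w + / w) l)).
  { intros z Hz Fz. rewrite two_Ccos_half. apply in_map_iff. exists (half_exp z).
    split; [reflexivity|]. apply Hl; [now apply Cmod_half_exp_le_1|].
    rewrite <- HF, Fz by exact Hz. ring. }
  split; [|split].
  - exists (map (fun w => w + / w) l). intros lam HE.
    destruct (EV lam HE) as (z & [_ Hz] & Fz & ->). apply IN; [lra | exact Fz].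
  - exists (map (fun w => w + / w) l). intros lam (z & [Hz _] & Fz & ->).
    apply IN; [lra | exact Fz].
  - intros lam HL. split.
    + destruct HL as [HE|(z & Hz & Fz & E)].
      * destruct (EV lam HE) as (z & Hz & Fz & E). exists z. split; auto.
      * exists z. split; auto.
    + intros z (HP & _ & _). apply (strip_zero_multiplicity c F z Hc H0 HF).
      destruct HP as [[_ Hz]|[Hz _]]; lra.
Qed.
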